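(* Let $X$ be a smooth, projective, absolutely irreducible variety over the field $\mathbf{R}$ of real numbers such that the set $X(\mathbf{R})$ of real points is not empty, and let $K=\mathbf{R}(X)$ be its function field. Let $D(X)\subset K^*$ be the multiplicative subgroup of all $f\in K^*$ such that for every point $M$ of the scheme $X$ one can write $f=u\cdot g$ with $u\in O_{X,M}^*$ a unit of the local ring $O_{X,M}$ and $g\in K^*$ a sum of squares of elements of $K$. Then an element $f\in K^*$ lies in $D(X)$ if and only if $f^2$ lies in $K^{*2}\cap\sum K^4$, i.e. if and only if $f^2$ is a sum of fourth powers of elements of $K$.
   Context: For a field $K$ and a positive integer $n$, $\sum K^n$ denotes the set of all finite sums of $n$-th powers of elements of $K$, and $K^{*2}$ denotes the group of nonzero squares in $K$. ''Point of $X$'' is meant in the scheme-theoretic sense (points are not necessarily closed). For $M\in X$, the local ring $O_{X,M}$ is viewed as a subring of the function field $K=\mathbf{R}(X)$. *)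

(* Defs.v *)
From HB Require Import structures.
From mathcomp Require Import all_boot all_order all_algebra.
From mathcomp Require Import fraction ring_quotient mpoly complex.
From mathcomp Require Import boolp reals.

Set Implicit Arguments.
Unset Strict Implicit.
Unset Printing Implicit Defensive.

Import GRing.Theory.
Local Open Scope ring_scope.

(* Conventions.  A projective variety over a field k is an integral closed
   subscheme X of P^n_k, i.e. X = Proj (k[X_0, ..., X_n] / I) for a homogeneous
   prime ideal I that does not contain the irrelevant ideal (X_0, ..., X_n);
   X is represented by I.  [prime_idealr] ideals are proper, and, although they
   are boolean predicates, classically every prime ideal is one of them. *)

Section ProjectiveSchemes.

Variables (k : fieldType) (n : nat).
Local Notation poly := {mpoly k[n.+1]}.

Definition homog_ideal (I : {pred poly}) : Prop :=
  forall (d : nat) (p : poly),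
    p \in I -> pihomog (Measure.clone _ mdeg _) d p \in I.

Definition not_irrelevant (I : {pred poly}) : Prop :=
  exists i : 'I_n.+1, 'X_i \notin I.

Definition proj_variety (I : prime_idealr poly) : Prop :=
  homog_ideal I /\ not_irrelevant I.

(* The points of the scheme Proj (k[X_0, ..., X_n] / (A)), closed or not: the
   homogeneous primes of k[X_0, ..., X_n] containing A but not (X_0, ..., X_n).
   Only the ideal generated by A matters. *)
Definition scheme_point (A : {pred poly}) (P : prime_idealr poly) : Prop :=
  [/\ homog_ideal P, not_irrelevant P & {subset A <= P}].

(* Irreducibility of the Zariski topology on that set of points: the closed sets
   are the sets of points containing some given set of polynomials. *)
Definition irreducible_scheme (A : {pred poly}) : Prop :=
  (exists P, scheme_point A P) /\
  forall B1 B2 : {pred poly},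
    (forall P, scheme_point A P -> {subset B1 <= P} \/ {subset B2 <= P}) ->
    (forall P, scheme_point A P -> {subset B1 <= P}) \/
    (forall P, scheme_point A P -> {subset B2 <= P}).

(* Smoothness over k at the point P, by the Jacobian definition (as in Bosch,
   Luetkebohmert, Raynaud, Neron Models, 2.2): P lies in the chart X_i <> 0,
   an affine space A^n over k with coordinates X_j / X_i (j <> i), and near P the
   ideal of X is generated by c sections whose differentials are linearly
   independent over the residue field at P.
   The sections are g_l / X_i ^ deg g_l.  The stalk at P of the ideal of X is
   generated by them iff every f in I has a multiple h * f, h not in P, in the
   ideal (g_l)_l of k[X_0, ..., X_n]; and the partial derivative of the l-th one
   w.r.t. X_j / X_i is the partial derivative of g_l w.r.t. X_j, up to a power
   of X_i. *)
Definition smooth_at (I P : prime_idealr poly) : Prop :=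
  exists (i : 'I_n.+1) (c : nat) (g : 'I_c -> poly) (s : 'I_c -> 'I_n.+1),
    [/\ 'X_i \notin P,
        forall l, g l \in I /\ exists d : nat, g l \is d.-homog,
        forall f, f \in I ->
          exists h, h \notin P /\
          exists a : 'I_c -> poly, h * f = \sum_(l < c) a l * g l,
        forall m, s m != i
      & \det (\matrix_(l < c, m < c) (g l)^`M(s m)) \notin P].

Definition smooth_variety (I : prime_idealr poly) : Prop :=
  forall P, scheme_point I P -> smooth_at I P.

End ProjectiveSchemes.

Section Subfield.

Variables (F : fieldType) (S : divringClosed F).

Record subfield_type : Type := SubfieldElt {
  subfield_val :> F;
  _ : subfield_val \in S
}.

HB.instance Definition _ := [isSub for subfield_val].
HB.instance Definition _ := [Choice of subfield_type by <:].
HB.instance Definition _ :=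
  [SubChoice_isSubIntegralDomain of subfield_type by <:].
HB.instance Definition _ :=
  [SubIntegralDomain_isSubField of subfield_type by <:].

End Subfield.

(* The homogeneous coordinate ring k[X_0, ..., X_n] / I, as an integral domain. *)
Section CoordinateRing.

Variables (k : fieldType) (n : nat) (I : prime_idealr {mpoly k[n.+1]}).

Definition coord_ring : Type := {ideal_quot I}.
HB.instance Definition _ := GRing.ComNzRing.on coord_ring.

Definition coord_unit : {pred coord_ring} := fun x => `[< exists y, y * x = 1 >].
Definition coord_inv (x : coord_ring) : coord_ring :=
  if pselect (exists y, y * x = 1) is left h then projT1 (cid h) else x.

Lemma coord_mulVx : {in coord_unit, left_inverse 1 coord_inv *%R}.
Proof.
move=> x /asboolP ux; rewrite /coord_inv; case: pselect => // h.
exact: (projT2 (cid h)).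
Qed.

Lemma coord_unitPl (x y : coord_ring) : y * x = 1 -> coord_unit x.
Proof. by move=> yx; apply/asboolP; exists y. Qed.

Lemma coord_invr_out : {in [predC coord_unit], coord_inv =1 id}.
Proof.
move=> x /asboolPn ux; rewrite /coord_inv; by case: pselect.
Qed.

HB.instance Definition _ := GRing.ComNzRing_hasMulInverse.Build coord_ring
  coord_mulVx coord_unitPl coord_invr_out.

Lemma coord_idomain : GRing.integral_domain_axiom coord_ring.
Proof. exact: Quotient.rquot_IdomainAxiom. Qed.

HB.instance Definition _ := GRing.ComUnitRing_isIntegral.Build coord_ring
  coord_idomain.

Definition coord (F : {mpoly k[n.+1]}) : coord_ring :=
  (\pi_({ideal_quot I}) F)%qT.

Lemma coordM : {morph coord : F G / F * G}.
Proof. by move=> F G; rewrite /coord [RHS]piE. Qed.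

Lemma coordB : {morph coord : F G / F - G}.
Proof. by move=> F G; rewrite /coord [RHS]piE. Qed.

Lemma coord1 : coord 1 = 1.
Proof. by rewrite /coord [RHS]piE. Qed.

Lemma coord_eq0 F : (coord F == 0) = (F \in I).
Proof.
rewrite -[X in X = _]/(\pi_({ideal_quot I})%qT F == 0).
by rewrite -[X in _ == X]pi_zeror -Quotient.idealrBE subr0.
Qed.

End CoordinateRing.

Section FunctionField.

Variables (k : fieldType) (n : nat) (I : prime_idealr {mpoly k[n.+1]}).

(* F / G in the fraction field of the homogeneous coordinate ring. *)
Definition quotient_of_forms (F G : {mpoly k[n.+1]}) : {fraction coord_ring I} :=
  FracField.tofrac (coord I F) / FracField.tofrac (coord I G).

Definition homog_fraction (P : prime_idealr {mpoly k[n.+1]})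
    (x : {fraction coord_ring I}) : Prop :=
  exists (d : nat) (F G : {mpoly k[n.+1]}),
    [/\ F \is d.-homog, G \is d.-homog, G \notin P & x = quotient_of_forms F G].

Definition degree0 : {pred {fraction coord_ring I}} :=
  fun x => `[< homog_fraction I x >].

Lemma degree0_divring_closed : divring_closed degree0.
Proof.
have tf0 G : G \notin I -> FracField.tofrac (coord I G) != 0.
  by move=> GI; rewrite tofrac_eq0 coord_eq0.
have tfM F G : FracField.tofrac (coord I (F * G))
    = FracField.tofrac (coord I F) * FracField.tofrac (coord I G).
  by rewrite coordM tofracM.
split.
- apply/asboolP; exists 0%N, 1, 1.
  have I1 : 1 \notin I by rewrite idealr1.
  by split; rewrite ?dhomog1 // /quotient_of_forms coord1 tofrac1 divr1.
- move=> _ _ /asboolP[d [F [G [hF hG GI ->]]]] /asboolP[e [F' [G' [hF' hG' GI' ->]]]].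
  apply/asboolP; exists (d + e)%N, (F * G' - F' * G), (G * G'); split.
  + apply: rpredB; first exact: dhomogM.
    by rewrite addnC; apply: dhomogM.
  + exact: dhomogM.
  + by rewrite prime_idealrM negb_or GI.
  + by rewrite /quotient_of_forms coordB tofracB !tfM -mulNr addf_div ?tf0 // mulNr.
- move=> _ _ /asboolP[d [F [G [hF hG GI ->]]]] /asboolP[e [F' [G' [hF' hG' GI' ->]]]].
  apply/asboolP; case: (boolP (F' \in I)) => FI'.
    exists d, 0, G; split=> //; first exact: rpred0.
    rewrite /quotient_of_forms.
    have -> : coord I F' = 0 by apply/eqP; rewrite coord_eq0.
    have -> : coord I 0 = 0 by apply/eqP; rewrite coord_eq0 idealr0.
    by rewrite tofrac0 !mul0r invr0 mulr0.
  exists (d + e)%N, (F * G'), (G * F'); split.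
  + exact: dhomogM.
  + exact: dhomogM.
  + by rewrite prime_idealrM negb_or GI.
  + by rewrite /quotient_of_forms !tfM invf_div mulf_div.
Qed.

HB.instance Definition _ :=
  GRing.isDivringClosed.Build {fraction coord_ring I} degree0
    degree0_divring_closed.

(* The function field k(X): the elements of degree 0 in the fraction field of the
   homogeneous coordinate ring. *)
Definition function_field : fieldType := subfield_type degree0.

(* The local ring O_{X,P}, as a subset of k(X): the homogeneous localization at
   P of the homogeneous coordinate ring. *)
Definition local_ring (P : prime_idealr {mpoly k[n.+1]}) (x : function_field) :
  Prop := homog_fraction P (val x).

Definition local_unit (P : prime_idealr {mpoly k[n.+1]}) (x : function_field) :
  Prop := exists y, [/\ local_ring P x, local_ring P y & x * y = 1].

End FunctionField.

Definition sum_of_powers (K : fieldType) (m : nat) (x : K) : Prop :=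
  exists s : seq K, x = \sum_(a <- s) a ^+ m.

Definition nonzero_square (K : fieldType) (x : K) : Prop :=
  exists y : K, y != 0 /\ x = y ^+ 2.

(* f lies in D(X). *)
Definition in_D (k : fieldType) (n : nat) (I : prime_idealr {mpoly k[n.+1]})
    (f : function_field I) : Prop :=
  f != 0 /\
  forall P, scheme_point I P ->
    exists u g : function_field I,
      [/\ local_unit P u, g != 0, sum_of_powers 2 g & f = u * g].

Section RealVarieties.

Variables (R : realType) (n : nat) (I : prime_idealr {mpoly R[n.+1]}).

(* Generators of the ideal of the base change of X to C = R[i]. *)
Definition complexification : {pred {mpoly R[i][n.+1]}} :=
  fun q => `[< exists p, p \in I /\ q = map_mpoly (real_complex R) p >].

Definition absolutely_irreducible : Prop := irreducible_scheme complexification.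

(* X(R) is not empty; real points are given by homogeneous coordinates. *)
Definition has_real_point : Prop :=
  exists v : 'I_n.+1 -> R,
    (exists i, v i != 0) /\ forall p, p \in I -> p.@[v] = 0.

End RealVarieties.

(* Main.v *)
From HB Require Import structures.
From mathcomp Require Import all_boot all_order all_algebra.
From mathcomp Require Import generic_quotient fraction ring_quotient mpoly complex.
From mathcomp Require Import boolp reals classical_sets filter.
From mathcomp Require Import polyorder polyrcf ring lra countalg closed_field.
Require Import Defs.

(* If f^2 is a sum of fourth powers, write f = w / Q^2 with forms such that
   w^2 = \sum A_i^4 modulo I. Along a smooth real arc w^2 has order divisible by 4, so w has even
   order and does not change sign. By compactness of the sphere the sets w > 0 and w < 0 of real
   points stay away from each other, so some form U of even degree 2k has the sign of w at the
   real points with w <> 0, and U can be chosen nonzero at a given point P. By Artin-Lang, U w is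
   a sum of squares in K, and f = (X_i^2k / U) * (f U / X_i^2k) is the required factorization
   at P.

   Conversely, if f is locally a unit times a sum of squares, the forms H of even degree with f H
   a sum of squares have no common zero on X, so some power of sigma = \sum X_l^2 is a
   combination of them. Hence the sum eps of the corresponding H / sigma^d has the sign of f in
   every ordering and eps, 1/eps are bounded. Such an eps^2 is a sum of fourth powers, as is the
   square of the sum of squares f / eps. *)

Set Implicit Arguments.
Unset Strict Implicit.
Unset Printing Implicit Defensive.
Import Order.TTheory GRing.Theory Num.Theory.
Local Open Scope ring_scope.

(** * Orderings of fields *)

(** The arc in the sign argument is obtained pointwise from Newton's method, without analyticity, so
    its order at a parameter cannot be read off a power series. It is compared with polynomial arcs
    of any prescribed precision, which decide the sign only if [w] is not flat along the arc.
    Flatness is excluded algebraically: at an infinitesimal parameter e of an ultrapower of [R] the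
    implicit functions are algebraic over R(e), and a nonzero algebraic element is never smaller
    than all powers of e. This and Artin-Lang rest on the same transfer of sign conditions between
    real closed fields, proved with ultrapowers in place of quantifier elimination.

    In the converse the passage from bounds to fourth powers is explicit. A Gaussian fourth moment
    shows that 3 q^2 - 2 b^4 is a sum of fourth powers if q - b^2 is a sum of squares, and third
    differences of x^4 then give x + 17 for x between -1 and 1 in all orderings. An element between
    a constant c > 0 and 1 is first driven close to 1, where this suffices. *)

Lemma Zorn_above (T : Type) (good : set (set T)) (A0 : set T) :
  good A0 ->
  (forall F : set (set T), (exists A, F A) -> (forall A, F A -> good A) ->
     total_on F subset -> good (\bigcup_(X in F) X)%classic) ->
  exists A, [/\ good A, (A0 `<=` A)%classic &
    forall B, good B -> (A `<=` B)%classic -> (B `<=` A)%classic].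
Proof.
move=> gA0 chain.
(* [Zorn_bigcup] also requires the union of the empty chain to be admissible; this union is empty,
   hence the first disjunct. *)
pose P (A : set T) := A = set0 \/ (good A /\ (A0 `<=` A)%classic).
have [F FP Ftot|A [PA maxA]] := @Zorn_bigcup T P.
  have [[A [FA nA0]]|noA] := pselect (exists A, F A /\ A <> set0); last first.
    left; apply/seteqP; split=> // x [A FA Ax]; apply: noA.
    by exists A; split=> // A0E; rewrite A0E in Ax.
  pose F' := [set B | F B /\ B <> set0]%classic.
  have E : (\bigcup_(X in F) X = \bigcup_(X in F') X)%classic.
    apply/seteqP; split=> x [B FB Bx]; last by exists B => //; case: FB.
    by exists B => //; split=> // B0; rewrite B0 in Bx.
  have gF' B : F' B -> good B /\ (A0 `<=` B)%classic.
    by move=> [FB nB0]; case: (FP B FB).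
  right; rewrite E; split.
    apply: chain; first by exists A.
      by move=> B /gF'[].
    by move=> B C [FB _] [FC _]; exact: Ftot.
  have [_ A0A] := gF' A (conj FA nA0).
  by move=> x /A0A Ax; exists A.
have A0A : good A /\ (A0 `<=` A)%classic.
  case: PA => // A_0; have [A0_0|nA0] := pselect (A0 = set0).
    by rewrite A_0 -A0_0; split.
  exfalso; apply: (maxA A0); last by right; split.
  by rewrite A_0; split; [by []|rewrite subset0].
case: A0A => gA sA; exists A; split=> // B gB AB.
apply: contrapT => nBA; apply: (maxA B); first by split.
by right; split=> // x /sA /AB.
Qed.

Definition subfield_set (F : fieldType) (P : set F) :=
  [/\ P 1, forall x y, P x -> P y -> P (x - y) &
      forall x y, P x -> P y -> P (x / y)].

(** Subfields occur as sets, to which Zorn's lemma applies; this turns such a set into a field type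
    between which ring morphisms can be built. *)
Lemma subfield_embedding (F : fieldType) (P : set F) : subfield_set P ->
  exists (E : fieldType) (i : {rmorphism E -> F}),
    forall x, P x <-> exists a, x = i a.
Proof.
move=> [P1 PB Pd].
pose S : {pred F} := fun x => `[< P x >].
have Sc : divring_closed S.
  split; first exact/asboolP.
  - by move=> x y /asboolP Px /asboolP Py; apply/asboolP/PB.
  - by move=> x y /asboolP Px /asboolP Py; apply/asboolP/Pd.
pose Sd : divringClosed F := HB.pack S (GRing.isDivringClosed.Build F S Sc).
exists (subfield_type Sd).
pose v : subfield_type Sd -> F := val.
pose vm : {rmorphism subfield_type Sd -> F} := val.
exists vm => x; split=> [Px|[a ->]].
  have Sx : x \in Sd by apply/asboolP.
  by exists (SubfieldElt Sx).
by case: a => a aS; apply/asboolP; exact: aS.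
Qed.

Definition field_ordering (E : fieldType) (P : set E) :=
  [/\ forall a b, P a -> P b -> P (a + b), forall a b, P a -> P b -> P (a * b),
      forall a, P a -> P (- a) -> a = 0 & forall a, P a \/ P (- a)].

(** [L] is [E] with the order of [P] added, and [f] and [g] are both the identity; they are kept as
    maps because the new structure is hidden behind an existential. *)
Lemma ordered_realField (E : fieldType) (P : set E) : field_ordering P ->
  exists (L : realFieldType) (f : {rmorphism E -> L}) (g : L -> E),
   [/\ cancel f g, cancel g f & forall a, P a <-> 0 <= f a].
Proof.
move=> [PD PM Panti Ptot].
pose le (x y : E) := `[< P (y - x) >].
pose lt (x y : E) := (y != x) && le x y.
pose nrm (x : E) := if `[< P x >] then x else - x.
have PN x : ~ P x -> P (- x) by move=> nP; case: (Ptot x).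
have P0 : P 0 by case: (Ptot 0); rewrite ?oppr0.
have h1 x y : le 0 x -> le 0 y -> le 0 (x + y).
  by rewrite /le !subr0 => /asboolP a /asboolP b; apply/asboolP/PD.
have h2 x y : le 0 x -> le 0 y -> le 0 (x * y).
  by rewrite /le !subr0 => /asboolP a /asboolP b; apply/asboolP/PM.
have h3 x : le 0 x -> le x 0 -> x = 0.
  by rewrite /le subr0 sub0r => /asboolP a /asboolP b; exact: Panti.
have h4 x y : le 0 (y - x) = le x y by rewrite /le subr0.
have h5 x : le 0 x || le x 0.
  by rewrite /le subr0 sub0r; case: (Ptot x) => /asboolP ->; rewrite ?orbT.
have h6 x : nrm (- x) = nrm x.
  rewrite /nrm; case: asboolP => a; case: asboolP => b //; rewrite ?opprK //.
    by rewrite (Panti _ b a) oppr0.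
  by case: (Ptot x).
have h7 x : le 0 x -> nrm x = x by rewrite /le /nrm subr0 => ->.
have h8 x y : lt x y = (y != x) && le x y by [].
pose L : realFieldType := HB.pack (E : Type) (GRing.Field.on E)
  (Num.IntegralDomain_isLeReal.Build E h1 h2 h3 h4 h5 h6 h7 h8).
exists L, (idfun : {rmorphism E -> E}), idfun; split=> // a.
rewrite -[0 <= _]/(le 0 a) /le subr0.
by split=> /asboolP.
Qed.

Lemma real_field_ivt_rcf (L : realFieldType) : Num.real_closed_axiom L ->
  exists (M : rcfType) (f : {rmorphism L -> M}) (g : M -> L),
   [/\ cancel f g, cancel g f & forall a, (0 <= f a) = (0 <= a)].
Proof.
move=> ivt.
pose M : rcfType := HB.pack (L : Type) (Num.RealField.on L)
  (Num.RealField_isClosed.Build L ivt).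
by exists M, (idfun : {rmorphism L -> L}), idfun.
Qed.

(** * Ultrapowers *)

Section Ultrapower.
Local Open Scope quotient_scope.
Variables (L : rcfType) (J : Type) (U : set_system J) (U_ultra : UltraFilter U).

Let UP : ProperFilter U. Proof. exact: ultra_proper. Qed.
Existing Instance UP.

Lemma ultra_eq_equiv :
  equiv_class_of (fun f g : {classic J -> L} => `[< U [set j | f j = g j]%classic >]).
Proof.
split=> [f|f g|g f h].
- by apply/asboolP; apply: filterS filterT.
- apply/asboolP/asboolP; apply: filterS => j /= ->//.
- by move=> /asboolP fg /asboolP gh; apply/asboolP;
    apply: filterS2 fg gh => j /= -> ->.
Qed.

Canonical ultra_eq := EquivRelPack ultra_eq_equiv.
Definition ultrapower := {eq_quot ultra_eq}.
HB.instance Definition _ := Choice.on ultrapower.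

Definition ucls (f : J -> L) : ultrapower := \pi_ultrapower%qT (f : {classic J -> L}).
Definition urep (x : ultrapower) : J -> L := repr x.

Lemma uclsP f g : ucls f = ucls g <-> U [set j | f j = g j]%classic.
Proof.
split=> [E|E]; last by apply/eqquotP/asboolP.
by have /eqquotP/asboolP := E.
Qed.

Lemma urepK x : ucls (urep x) = x.
Proof. by rewrite /ucls /urep reprK. Qed.

Lemma urep_cls f : U [set j | urep (ucls f) j = f j]%classic.
Proof. by apply/uclsP; rewrite urepK. Qed.

(** Operations act on chosen representatives; [uclsD] and its companions show that any other
    representative gives the same class. *)
Definition uadd x y := ucls (fun j => urep x j + urep y j).
Definition umul x y := ucls (fun j => urep x j * urep y j).
Definition uopp x := ucls (fun j => - urep x j).
Definition uinv x := ucls (fun j => (urep x j)^-1).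

Lemma uclsD f g : uadd (ucls f) (ucls g) = ucls (fun j => f j + g j).
Proof.
by apply/uclsP; apply: filterS2 (urep_cls f) (urep_cls g) => j /= -> ->.
Qed.
Lemma uclsM f g : umul (ucls f) (ucls g) = ucls (fun j => f j * g j).
Proof.
by apply/uclsP; apply: filterS2 (urep_cls f) (urep_cls g) => j /= -> ->.
Qed.
Lemma uclsN f : uopp (ucls f) = ucls (fun j => - f j).
Proof. by apply/uclsP; apply: filterS (urep_cls f) => j /= ->. Qed.
Lemma uclsV f : uinv (ucls f) = ucls (fun j => (f j)^-1).
Proof. by apply/uclsP; apply: filterS (urep_cls f) => j /= ->. Qed.

Lemma uclsW (P : ultrapower -> Prop) : (forall f, P (ucls f)) -> forall x, P x.
Proof. by move=> Pf x; rewrite -(urepK x). Qed.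

Let uE := (uclsD, uclsM, uclsN, uclsV).

Lemma uaddA : associative uadd.
Proof.
elim/uclsW=> f; elim/uclsW=> g; elim/uclsW=> h; rewrite !uE.
by congr ucls; apply/funext=> j; rewrite addrA.
Qed.
Lemma uaddC : commutative uadd.
Proof.
elim/uclsW=> f; elim/uclsW=> g; rewrite !uE.
by congr ucls; apply/funext=> j; rewrite addrC.
Qed.
Lemma uadd0 : left_id (ucls (fun=> 0)) uadd.
Proof.
elim/uclsW=> f; rewrite !uE.
by congr ucls; apply/funext=> j; rewrite add0r.
Qed.
Lemma uaddN : left_inverse (ucls (fun=> 0)) uopp uadd.
Proof.
elim/uclsW=> f; rewrite !uE.
by congr ucls; apply/funext=> j; rewrite addNr.
Qed.
HB.instance Definition _ := GRing.isZmodule.Build ultrapower uaddA uaddC uadd0 uaddN.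
Lemma umulA : associative umul.
Proof.
elim/uclsW=> f; elim/uclsW=> g; elim/uclsW=> h; rewrite !uE.
by congr ucls; apply/funext=> j; rewrite mulrA.
Qed.
Lemma umulC : commutative umul.
Proof.
elim/uclsW=> f; elim/uclsW=> g; rewrite !uE.
by congr ucls; apply/funext=> j; rewrite mulrC.
Qed.
Lemma umul1 : left_id (ucls (fun=> 1)) umul.
Proof.
elim/uclsW=> f; rewrite !uE.
by congr ucls; apply/funext=> j; rewrite mul1r.
Qed.
Lemma umulD : left_distributive umul uadd.
Proof.
elim/uclsW=> f; elim/uclsW=> g; elim/uclsW=> h; rewrite !uE.
by congr ucls; apply/funext=> j; rewrite mulrDl.
Qed.
Lemma uoneq0 : ucls (fun=> 1) != 0.
Proof.
apply/eqP => /uclsP U0; apply: (filter_not_empty U).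
by apply: filterS U0 => j /= /eqP; rewrite oner_eq0.
Qed.
HB.instance Definition _ :=
  GRing.Zmodule_isComNzRing.Build ultrapower umulA umulC umul1 umulD uoneq0.
Lemma umulV x : x != 0 -> uinv x * x = 1.
Proof.
elim/uclsW: x => f f0; rewrite /GRing.mul /= !uE; apply/uclsP.
have [fz|] := in_ultra_setVsetC [set j | f j = 0]%classic U_ultra.
  by case/eqP: f0; apply/uclsP.
by apply: filterS => j /= /eqP fj; rewrite mulVf.
Qed.
Lemma uinv0 : uinv 0 = 0.
Proof. by rewrite /GRing.zero /= uE invr0. Qed.
HB.instance Definition _ := GRing.ComNzRing_isField.Build ultrapower umulV uinv0.

Definition upos (x : ultrapower) := U [set j | 0 <= urep x j]%classic.

Lemma uclspos f : upos (ucls f) <-> U [set j | 0 <= f j]%classic.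
Proof.
by split; apply: filterS2 (urep_cls f) => j /= ->.
Qed.

Lemma upos_ordering : field_ordering upos.
Proof.
split.
- elim/uclsW=> f; elim/uclsW=> g; rewrite [ucls f + _]uclsD !uclspos.
  by apply: filterS2 => j /=; exact: addr_ge0.
- elim/uclsW=> f; elim/uclsW=> g; rewrite [ucls f * _]uclsM !uclspos.
  by apply: filterS2 => j /=; exact: mulr_ge0.
- elim/uclsW=> f; rewrite [- ucls f]uclsN !uclspos => h1 h2; apply/uclsP.
  apply: filterS2 h1 h2 => j /= h1 h2; apply/eqP.
  by rewrite eq_le h1 andbT -oppr_ge0.
- elim/uclsW=> f; rewrite [- ucls f]uclsN !uclspos.
  have [|] := in_ultra_setVsetC [set j | 0 <= f j]%classic U_ultra; first by left.
  right; apply: filterS b => j /= /negP; rewrite -ltNge oppr_ge0; exact: ltW.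
Qed.

End Ultrapower.

(** Interface of the ultrapower: [c] sends a family to its class. Later proofs use these five
    properties and never the quotient; the ultrafilter enters only through [ultra_ge0]. *)
Record ultrapower_map (L M : realFieldType) (J : Type) (U : set_system J)
    (c : (J -> L) -> M) : Prop := UltrapowerMap {
  ultra_surj : forall x, exists f, x = c f;
  ultra_add : forall f g, c (fun j => f j + g j) = c f + c g;
  ultra_mul : forall f g, c (fun j => f j * g j) = c f * c g;
  ultra_one : c (fun=> 1) = 1;
  ultra_ge0 : forall f, 0 <= c f <-> U [set j | 0 <= f j]%classic }.

Section UltrapowerMap.
Variables (L M : realFieldType) (J : Type) (U : set_system J).
Hypothesis U_ultra : UltraFilter U.
Variable c : (J -> L) -> M.
Hypothesis cU : ultrapower_map U c.

Lemma ultra0 : c (fun=> 0) = 0.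
Proof.
apply: (addrI (c (fun=> 0))); rewrite addr0 -(ultra_add cU).
by congr c; apply/funext=> j; rewrite addr0.
Qed.

Lemma ultra_opp f : c (fun j => - f j) = - c f.
Proof.
apply: (addrI (c f)); rewrite -(ultra_add cU) subrr -ultra0.
by congr c; apply/funext=> j; rewrite subrr.
Qed.

Lemma ultra_sub f g : c (fun j => f j - g j) = c f - c g.
Proof. by rewrite (ultra_add cU f (fun j => - g j)) ultra_opp. Qed.

Lemma ultra_le f g : c f <= c g <-> U [set j | f j <= g j]%classic.
Proof.
rewrite -subr_ge0 -ultra_sub (ultra_ge0 cU).
by split; apply: filterS => j /=; rewrite subr_ge0.
Qed.

Lemma ultra_lt f g : c f < c g <-> U [set j | f j < g j]%classic.
Proof.
rewrite ltNge; split=> [/negP nle|Ul]; last first.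
  apply/negP => /ultra_le Ug; apply: (filter_not_empty U).
  by apply: filterS2 Ul Ug => j /= lt; rewrite leNgt lt.
have [|] := in_ultra_setVsetC [set j | g j <= f j]%classic U_ultra.
  by move/ultra_le.
by apply: filterS => j /= /negP; rewrite -ltNge.
Qed.

Lemma ultra_eq_iff f g : c f = c g <-> U [set j | f j = g j]%classic.
Proof.
split=> [E|E].
  have /ultra_le A : c f <= c g by rewrite E.
  have /ultra_le B : c g <= c f by rewrite E.
  by apply: filterS2 A B => j /= a b; apply/eqP; rewrite eq_le a.
by apply/eqP; rewrite eq_le; apply/andP; split; apply/ultra_le;
   apply: filterS E => j /= ->.
Qed.

Lemma ultra_sum n (F : 'I_n -> J -> L) :
  c (fun j => \sum_(i < n) F i j) = \sum_(i < n) c (F i).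
Proof.
elim: n F => [|n IH] F.
  by rewrite big_ord0 -ultra0; congr c; apply/funext=> j; rewrite big_ord0.
rewrite big_ord_recr /= -IH -(ultra_add cU).
by congr c; apply/funext=> j; rewrite big_ord_recr.
Qed.

Lemma ultra_exp f n : c (fun j => f j ^+ n) = c f ^+ n.
Proof.
elim: n => [|n IH]; first by rewrite expr0 -(ultra_one cU).
rewrite exprS -IH -(ultra_mul cU).
by congr c; apply/funext=> j; rewrite exprS.
Qed.

Definition ultra_cst (x : L) := c (fun=> x).

Lemma ultra_cst_zmod : zmod_morphism ultra_cst.
Proof. by move=> x y; rewrite -ultra_sub. Qed.
Lemma ultra_cst_monoid : monoid_morphism ultra_cst.
Proof. by split=> [|x y]; [exact: ultra_one cU|rewrite -(ultra_mul cU)]. Qed.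

(** A polynomial over the ultrapower is the class of a family of polynomials of bounded size.
    [insub] and [odflt] only feed coefficients indexed by ['I_n] to [\poly], which takes them from
    [nat]. *)
Lemma ultra_horner n (a : 'I_n -> J -> L) x :
  (\poly_(i < n) c (odflt (fun=> 0) (omap a (insub i)))).[c x] =
  c (fun j => (\poly_(i < n) odflt 0 (omap (a^~ j) (insub i))).[x j]).
Proof.
rewrite horner_poly.
transitivity (\sum_(i < n) c (fun j => a i j * x j ^+ i)).
  by apply: eq_bigr => i _; rewrite valK /= (ultra_mul cU) ultra_exp.
rewrite -ultra_sum; congr c; apply/funext=> j.
by rewrite horner_poly; apply: eq_bigr => i _; rewrite valK.
Qed.

End UltrapowerMap.

(** The theorem of Los for the intermediate value property: representatives of the coefficients of
    [p] define a polynomial [q j] over [L] for each index, and a simultaneous choice of the roots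
    that exist for almost all [j] represents a root of [p]. *)
Lemma ultrapower_ivt (L : rcfType) (M : realFieldType) J (U : set_system J)
    (c : (J -> L) -> M) : UltraFilter U -> ultrapower_map U c ->
  Num.real_closed_axiom M.
Proof.
move=> UU cU p x y xy /andP[px py].
have [f fE] := choice (ultra_surj cU).
have pE : p = \poly_(i < size p)
    c (odflt (fun=> 0) (omap (fun i : 'I_(size p) => f p`_i) (insub i))).
  rewrite -[LHS]coefK; apply/polyP => i; rewrite !coef_poly.
  by case: ifP => // lt; rewrite insubT /= -fE.
pose q j := \poly_(i < size p)
    odflt 0 (omap (fun i : 'I_(size p) => f p`_i j) (insub i)).
have hE z : p.[z] = c (fun j => (q j).[f z j]).
  by rewrite {1}pE [in LHS](fE z) (ultra_horner cU).
have U1 : U [set j | f x j <= f y j]%classic.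
  by apply/(ultra_le UU cU); rewrite -!fE.
have U2 : U [set j | (q j).[f x j] <= 0]%classic.
  by apply/(ultra_le UU cU _ (fun=> 0)); rewrite -hE (ultra0 cU).
have U3 : U [set j | 0 <= (q j).[f y j]]%classic.
  by apply/(ultra_le UU cU (fun=> 0)); rewrite -hE (ultra0 cU).
have H j : exists r, f x j <= f y j -> (q j).[f x j] <= 0 ->
    0 <= (q j).[f y j] -> (f x j <= r <= f y j) && root (q j) r.
  have [[[a b] d]|n] := pselect ((f x j <= f y j /\ (q j).[f x j] <= 0) /\
      0 <= (q j).[f y j]).
    have [|r rI rr] := @Num.Theory.poly_ivt _ (q j) _ _ a; first by rewrite b d.
    by exists r => _ _ _; rewrite rI rr.
  by exists 0 => a b d; case: n.
have [r rP] := choice H.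
have U4 : U [set j | (f x j <= r j <= f y j) && root (q j) (r j)]%classic.
  apply: filterS (filterI U1 (filterI U2 U3)) => j /= [a [b d]].
  exact: rP.
exists (c r); last first.
  apply/rootP; have [f' f'E] := ultra_surj cU (c r).
  rewrite {1}pE (ultra_horner cU); transitivity (c (fun=> 0)); last exact: ultra0 cU.
  apply/(ultra_eq_iff UU cU).
  by apply: filterS U4 => j /andP[_ /rootP].
rewrite [x]fE [y]fE; apply/andP; split; apply/(ultra_le UU cU);
  by apply: filterS U4 => j /andP[/andP[]].
Qed.

Theorem ultrapower_exists (L : rcfType) J (U : set_system J) : UltraFilter U ->
  exists (M : rcfType) (c : (J -> L) -> M), ultrapower_map U c.
Proof.
move=> UU.
have [M0 [f [g [fK gK fpos]]]] := ordered_realField (upos_ordering L UU).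
pose c0 x := f (ucls UU x).
have c0U : ultrapower_map U c0.
  split.
  - by move=> x; exists (urep (g x)); rewrite /c0 urepK gK.
  - by move=> x y; rewrite /c0 -rmorphD /= [_ + _ in RHS]uclsD.
  - by move=> x y; rewrite /c0 -rmorphM /= [_ * _ in RHS]uclsM.
  - by rewrite /c0 -[RHS](rmorph1 f).
  - by move=> x; rewrite /c0 -fpos uclspos.
have [M [f1 [g1 [f1K g1K f1pos]]]] := real_field_ivt_rcf (ultrapower_ivt UU c0U).
exists M, (f1 \o c0); case: c0U => cs cD cM c1 cle; split => /=.
- by move=> x; have [y yE] := cs (g1 x); exists y; rewrite -yE g1K.
- by move=> x y; rewrite cD rmorphD.
- by move=> x y; rewrite cM rmorphM.
- by rewrite c1 rmorph1.
- by move=> x; rewrite f1pos cle.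
Qed.

(** * Transfer between real closed fields *)

(** By the mean value theorem on both sides of [z], p(a) = p'(c) (a - z) and p(b) = p'(d) (b - z),
    and p' has the same sign at c and d. *)
Lemma deriv_noroot_sign (L : rcfType) (p : {poly L}) (a b z : L) :
  a < z < b -> root p z -> (forall x, a < x < b -> ~~ root p^`() x) ->
  p.[a] * p.[b] < 0.
Proof.
move=> /andP[az zb] /rootP pz nr.
have [c cI pa] := mvt p az; have [d dI pb] := mvt p zb.
move: cI dI; rewrite !in_itv /= => /andP[ac cz] /andP[zd db].
have cab : c \in `]a, b[ by rewrite in_itv /= ac (lt_trans cz).
have dab : d \in `]a, b[ by rewrite in_itv /= db (lt_trans az).
have nr' : {in `]a, b[, forall x, ~~ root p^`() x}.
  by move=> x; rewrite in_itv; exact: nr.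
have sg := polyrN0_itv nr' cab dab.
have nc : p^`().[c] != 0 by exact: nr'.
have -> : p.[a] = - (p^`().[c] * (z - a)) by rewrite -pa pz sub0r opprK.
have -> : p.[b] = p^`().[d] * (b - z) by rewrite -pb pz subr0.
rewrite mulNr oppr_lt0 mulrACA mulr_gt0 //; last first.
  by rewrite mulr_gt0 // subr_gt0.
have nd : p^`().[d] != 0 by exact: nr'.
by rewrite -sgr_gt0 sgrM sg -expr2 sqr_sg ?nd ?nc ltr01.
Qed.

Lemma deriv_neq0 (F : realDomainType) (p : {poly F}) : (1 < size p)%N -> p^`() != 0.
Proof.
move=> p1; rewrite -size_poly_gt0; have := size_deriv p.
by move=> ->; case: (size p) p1 => [|[|]].
Qed.

(** * Comparison of two ordered embeddings of a field *)

Section Embeddings.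
Variables (L M : rcfType) (E : fieldType).
Variables (i : {rmorphism E -> L}) (j : {rmorphism E -> M}).
Hypothesis ij_pos : forall a, (0 < i a) = (0 < j a).

Lemma emb_lt a b : (i a < i b) = (j a < j b).
Proof. by rewrite -subr_gt0 -rmorphB ij_pos rmorphB subr_gt0. Qed.

Lemma emb_le a b : (i a <= i b) = (j a <= j b).
Proof. by rewrite !leNgt emb_lt. Qed.

Lemma emb_neg a : (i a < 0) = (j a < 0).
Proof. by have := emb_lt a 0; rewrite !rmorph0. Qed.

(** Being below [xi] is read in [M] and maximality in [L]; on elements of [E] the two orders
    agree. *)
Lemma pick_below (es : seq E) (a : E) (xi : M) : j a < xi ->
  exists2 d, d \in a :: es & j d < xi /\
    forall e, e \in es -> j e < xi -> i e <= i d.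
Proof.
move=> ax; elim: es => [|e es [d dI [dx dmax]]].
  by exists a; rewrite ?mem_head.
have dI' : d \in [:: a, e & es].
  by move: dI; rewrite !inE => /orP[->|->]; rewrite ?orbT.
have [ex|nex] := boolP (j e < xi); last first.
  exists d => //; split=> // e'; rewrite inE => /orP[/eqP ->|]; last exact: dmax.
  by rewrite (negPf nex).
have [ed|de] := leP (i e) (i d).
  exists d => //; split=> // e'; rewrite inE => /orP[/eqP ->//|]; exact: dmax.
exists e; first by rewrite !inE eqxx orbT.
split=> // e'; rewrite inE => /orP[/eqP ->//|e's e'x].
exact: le_trans (dmax _ e's e'x) (ltW de).
Qed.

Lemma pick_above (es : seq E) (b : E) (xi : M) : xi < j b ->
  exists2 d, d \in b :: es & xi < j d /\
    forall e, e \in es -> xi < j e -> i d <= i e.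
Proof.
move=> ax; elim: es => [|e es [d dI [dx dmax]]].
  by exists b; rewrite ?mem_head.
have dI' : d \in [:: b, e & es].
  by move: dI; rewrite !inE => /orP[->|->]; rewrite ?orbT.
have [ex|nex] := boolP (xi < j e); last first.
  exists d => //; split=> // e'; rewrite inE => /orP[/eqP ->|]; last exact: dmax.
  by rewrite (negPf nex).
have [ed|de] := leP (i d) (i e).
  exists d => //; split=> // e'; rewrite inE => /orP[/eqP ->//|]; exact: dmax.
exists e; first by rewrite !inE eqxx orbT.
split=> // e'; rewrite inE => /orP[/eqP ->//|e's e'x].
exact: le_trans (ltW de) (dmax _ e's e'x).
Qed.

Variable n : nat.
Hypothesis roots_in_E : forall q : {poly E}, q != 0 -> (size q < n)%N ->
  forall x, root (map_poly i q) x -> exists e, x = i e.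

Lemma roots_list (q : {poly E}) (a b : L) : q != 0 -> (size q < n)%N ->
  exists es : seq E, map i es = roots (map_poly i q) a b.
Proof.
move=> q0 qn.
have : forall x, x \in roots (map_poly i q) a b -> exists e, x = i e.
  by move=> x /root_roots; exact: roots_in_E.
elim: (roots _ _ _) => [|x s IH] H; first by exists [::].
have [|es esE] := IH; first by move=> y ys; apply: H; rewrite inE ys orbT.
have [e eE] := H x (mem_head _ _).
by exists (e :: es); rewrite /= esE eE.
Qed.

Lemma root_emb (q : {poly E}) e : root (map_poly j q) (j e) ->
  root (map_poly i q) (i e).
Proof. by rewrite !rootE !horner_map !fmorph_eq0. Qed.

Lemma deriv_emb (q : {poly E}) : (1 < size q)%N -> q^`() != 0.
Proof.
move=> q1; rewrite -(map_poly_eq0 i) -deriv_map; apply: deriv_neq0.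
by rewrite size_map_poly.
Qed.

(** Induction on the size. If q had a root xi in [M], the roots of q' in [L], which come from [E],
    would isolate xi in an interval with ends in [E] where q' has no root in [M] by induction. Then
    q changes sign between these ends, in [M] and hence in [L], where it would have a root. *)
Lemma noroot_transfer (q : {poly E}) a b : q != 0 -> (size q < n)%N ->
  (forall x, i a < x < i b -> ~~ root (map_poly i q) x) ->
  forall y, j a < y < j b -> ~~ root (map_poly j q) y.
Proof.
have [k kE] := ubnP (size q); elim: k q kE a b => // k IH q qk a b q0 qn nr xi.
move=> /andP[axi xib]; apply/negP => rxi.
have q1 : (1 < size q)%N.
  rewrite ltnNge; apply/negP => q1.
  move: q0 rxi; rewrite (size1_polyC q1) map_polyC polyC_eq0 rootE hornerC.
  by rewrite fmorph_eq0 => /negPf ->.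
have dq0 : q^`() != 0 by exact: deriv_emb.
have sd : (size q^`() < size q)%N by exact: lt_size_deriv.
have [es esE] := roots_list (i a) (i b) dq0 (ltn_trans sd qn).
have es_in e : e \in es -> i a < i e < i b.
  move=> ees; have : i e \in roots (map_poly i q^`()) (i a) (i b).
    by rewrite -esE map_f.
  by move/roots_in; rewrite in_itv.
have nxi e : e \in es -> j e != xi.
  move=> ees; apply/eqP => jxi; have := nr _ (es_in _ ees).
  by move/negP; apply; apply: root_emb; rewrite jxi.
have [d dI [dxi dmax]] := pick_below es axi.
have [e eI [xie emin]] := pick_above es xib.
have ad : i a <= i d.
  move: dI; rewrite inE => /orP[/eqP ->//|/es_in/andP[/ltW]//].
have eb : i e <= i b.
  move: eI; rewrite inE => /orP[/eqP ->//|/es_in/andP[_ /ltW]//].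
have nrd x : i d < x < i e -> ~~ root (map_poly i q^`()) x.
  move=> /andP[dx xe]; apply/negP => rx.
  have : x \in roots (map_poly i q^`()) (i a) (i b).
    rewrite in_roots rx map_poly_eq0 dq0 in_itv /=.
    by rewrite (le_lt_trans ad dx) (lt_le_trans xe eb).
  rewrite -esE => /mapP[f fes xE].
  have := nxi f fes; rewrite neq_lt => /orP[] fx.
    by have := dmax f fes fx; rewrite -xE leNgt dx.
  by have := emin f fes fx; rewrite -xE leNgt xe.
have nrM x : j d < x < j e -> ~~ root (map_poly j q)^`() x.
  rewrite deriv_map; apply: (IH _ _ d e dq0 (ltn_trans sd qn) nrd).
  exact: leq_trans sd _.
have dxe : j d < xi < j e by rewrite dxi xie.
have sg := deriv_noroot_sign dxe rxi nrM.
have sgi : (map_poly i q).[i d] * (map_poly i q).[i e] < 0.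
  by rewrite !horner_map -rmorphM emb_neg rmorphM -!horner_map.
have de : i d < i e by rewrite emb_lt (lt_trans dxi).
have [z zI rz] := poly_ivtoo (ltW de) sgi.
have := nr z; rewrite rz => /(_ _)/negP; apply => //.
by move: zI; rewrite in_itv /= => /andP[dz ze];
  rewrite (le_lt_trans ad dz) (lt_le_trans ze eb).
Qed.

(** The Cauchy bound is an expression in the absolute values of the coefficients, so it comes from
    [E]. *)
Lemma emb_bound (q : {poly E}) th : q != 0 -> root (map_poly i q) th ->
  exists B, - i B < th < i B.
Proof.
move=> q0 rth.
have H a : exists b, `|i a| = i b.
  by have [?|?] := leP 0 (i a); [exists a; rewrite ger0_norm|exists (- a); rewrite rmorphN ltr0_norm].
suff [B BE] : exists B, cauchy_bound (map_poly i q) = i B.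
  exists B; have q0i : map_poly i q != 0 by rewrite map_poly_eq0.
  by have := root_in_cauchy_bound q0i rth; rewrite in_itv /= BE.
rewrite /cauchy_bound lead_coef_map.
have [g gE] := choice (fun k => H q`_k).
have eE : \sum_(k < size (map_poly i q)) `|(map_poly i q)`_k| =
    i (\sum_(k < size (map_poly i q)) g k).
  by rewrite rmorph_sum; apply: eq_bigr => k _; rewrite coef_map gE.
have [l lE] := H (lead_coef q).
by eexists; rewrite eE lE -fmorphV -rmorphM -(rmorph1 i) -rmorphD.
Qed.

End Embeddings.

(* Choose th with q of least degree: the roots of all polynomials of smaller degree, in
   particular of q', then come from E, so th is isolated in an interval with ends in E on which
   q is monotone and the other polynomials have constant sign. *)
Lemma algebraic_step (L M : rcfType) (E : fieldType)
    (i : {rmorphism E -> L}) (j : {rmorphism E -> M}) (q : {poly E}) (th : L) :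
  (forall a, (0 < i a) = (0 < j a)) ->
  q != 0 -> root (map_poly i q) th -> ~ (exists e, th = i e) ->
  exists (t : L) (t' : M), ~ (exists e, t = i e) /\
    forall h, (0 < (map_poly i h).[t]) = (0 < (map_poly j h).[t']).
Proof.
move=> ij q0 rq nth.
pose bad n := `[< exists (q : {poly E}) (x : L), [/\ q != 0, size q = n,
  root (map_poly i q) x & ~ exists e, x = i e] >].
have exbad : exists n, bad n by exists (size q); apply/asboolP; exists q, th.
case: (ex_minnP exbad) => n /asboolP[r [t [r0 rn rt nt]]] minn {q th q0 rq nth exbad}.
have inEr (q : {poly E}) : q != 0 -> (size q < n)%N -> forall x, root (map_poly i q) x ->
    exists e, x = i e.
  move=> q0 qn x rx; apply: contrapT => nx; move: qn; rewrite ltnNge => /negP; apply.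
  by apply: minn; apply/asboolP; exists q, x.
have ji a : (0 < j a) = (0 < i a) by rewrite ij.
have r1 : (1 < size r)%N.
  rewrite ltnNge; apply/negP => r1.
  move: r0 rt; rewrite (size1_polyC r1) map_polyC polyC_eq0 rootE hornerC.
  by rewrite fmorph_eq0 => /negPf ->.
have dr0 : r^`() != 0 by exact: (deriv_emb i r1).
have drn : (size r^`() < n)%N by rewrite -rn lt_size_deriv.
have [B /andP[Bt tB]] := emb_bound r0 rt.
rewrite -rmorphN in Bt.
have sep (h : {poly E}) (a b : E) : h != 0 -> (size h < n)%N -> i a < t < i b ->
  exists d e, [/\ i a <= i d, i e <= i b, i d < t, t < i e &
    forall x, i d < x < i e -> ~~ root (map_poly i h) x].
  move=> h0 hn /andP[at_ tb].
  have [es esE] := roots_list inEr (i a) (i b) h0 hn.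
  have es_in e : e \in es -> i a < i e < i b.
    move=> ees; have : i e \in roots (map_poly i h) (i a) (i b).
      by rewrite -esE map_f.
    by move/roots_in; rewrite in_itv.
  have [d dI [dt dmax]] := pick_below (j := i) i es at_.
  have [e eI [te emin]] := pick_above (j := i) i es tb.
  have ad : i a <= i d.
    by move: dI; rewrite inE => /orP[/eqP ->//|/es_in/andP[/ltW]].
  have eb : i e <= i b.
    by move: eI; rewrite inE => /orP[/eqP ->//|/es_in/andP[_ /ltW]].
  exists d, e; split=> // x /andP[dx xe]; apply/negP => rx.
  have : x \in roots (map_poly i h) (i a) (i b).
    rewrite in_roots rx map_poly_eq0 h0 in_itv /=.
    by rewrite (le_lt_trans ad dx) (lt_le_trans xe eb).
  rewrite -esE => /mapP[f fes xE].
  have tf : i f != t by apply/eqP => ft; apply: nt; exists f.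
  move: tf; rewrite neq_lt => /orP[] fx.
    by have := dmax f fes fx; rewrite -xE leNgt dx.
  by have := emin f fes fx; rewrite -xE leNgt xe.
have [|d [e [_ _ dt te nrd]]] := sep r^`() (- B) B dr0 drn; first by rewrite Bt.
have transfer := noroot_transfer ij inEr.
have nrdM := transfer _ d e dr0 drn nrd.
(* [r] is monotone between [i d] and [i e], so it changes sign at [t]; a change of sign between
   elements of [E] is seen in [M] as well. *)
have locate a b : i d <= i a -> i b <= i e -> i a < t -> t < i b ->
    exists2 y, j a < y < j b & root (map_poly j r) y.
  move=> da be at_ tb.
  have atb : i a < t < i b by rewrite at_.
  have sg : (map_poly i r).[i a] * (map_poly i r).[i b] < 0.
    apply: deriv_noroot_sign atb rt _ => x /andP[ax xb]; rewrite deriv_map.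
    by apply: nrd; rewrite (le_lt_trans da ax) (lt_le_trans xb be).
  have sgj : (map_poly j r).[j a] * (map_poly j r).[j b] < 0.
    by rewrite !horner_map -rmorphM -(emb_neg ij) rmorphM -!horner_map.
  have ab : j a < j b by rewrite -(emb_lt ij) (lt_trans at_).
  by have [z zI rz] := poly_ivtoo (ltW ab) sgj; exists z => //; rewrite in_itv in zI.
have [t' t'I rt'] := locate d e (lexx _) (lexx _) dt te.
have uniq y : j d < y < j e -> root (map_poly j r) y -> y = t'.
  move=> /andP[dy ye] ry; case/andP: t'I => dt' t'e.
  have eqv : (map_poly j r).[y] = (map_poly j r).[t'].
    by move/rootP: ry => ->; move/rootP: rt' => ->.
  apply/eqP; apply: contraT; rewrite neq_lt => /orP[] yt.
    have [c] := rolle yt eqv; rewrite in_itv /= => /andP[yc ct] cE.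
    have := nrdM c; rewrite (lt_trans dy yc) (lt_trans ct t'e) => /(_ isT).
    by rewrite -deriv_map rootE cE eqxx.
  have [c] := rolle yt (esym eqv); rewrite in_itv /= => /andP[yc ct] cE.
  have := nrdM c; rewrite (lt_trans dt' yc) (lt_trans ct ye) => /(_ isT).
  by rewrite -deriv_map rootE cE eqxx.
exists t, t'; split=> // h.
(* Reduced modulo [r], the polynomial [h] has size less than [n], so that [sep] and [transfer] apply
   to it. *)
have -> : (map_poly i h).[t] = (map_poly i (h %% r)).[t].
  rewrite {1}(divp_eq h r) rmorphD rmorphM hornerD hornerM.
  by move/rootP: rt => ->; rewrite mulr0 add0r.
have -> : (map_poly j h).[t'] = (map_poly j (h %% r)).[t'].
  rewrite {1}(divp_eq h r) rmorphD rmorphM hornerD hornerM.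
  by move/rootP: rt' => ->; rewrite mulr0 add0r.
have : (size (h %% r)%R < n)%N by rewrite -rn ltn_modp r0.
move: (h %% r)%R => {}h hn.
have [->|h0] := eqVneq h 0; first by rewrite !(rmorph0, horner0, ltxx).
have dte : i d < t < i e by rewrite dt.
have [c [f [dc fe ct tf nrh]]] := sep h d e h0 hn dte.
have nrhM := transfer _ c f h0 hn nrh.
have [y yI ry] := locate c f dc fe ct tf.
have yt : y = t'.
  apply: uniq ry; case/andP: yI => cy yf.
  by rewrite (le_lt_trans _ cy) ?(lt_le_trans yf) // -(emb_le ij).
rewrite {y ry}yt in yI.
(* A sample point in [E]: [h] has constant sign on both intervals, so its signs at [t] and [t'] are
   those at [m], which agree. *)
pose m := (c + f) / 2.
have cf : i c < i f := lt_trans ct tf.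
have im : i m = (i c + i f) / 2 by rewrite /m rmorphM rmorphD fmorphV rmorph_nat.
have jm : j m = (j c + j f) / 2 by rewrite /m rmorphM rmorphD fmorphV rmorph_nat.
have cfj : j c < j f by rewrite -(emb_lt ij).
have mI : i m \in `]i c, i f[ by rewrite in_itv /= im !midf_lt.
have mJ : j m \in `]j c, j f[ by rewrite in_itv /= jm !midf_lt.
have tI : t \in `]i c, i f[ by rewrite in_itv /= ct.
have t'J : t' \in `]j c, j f[ by rewrite in_itv /= yI.
have nr1 : {in `]i c, i f[, forall x, ~~ root (map_poly i h) x}.
  by move=> x; rewrite in_itv; exact: nrh.
have nr2 : {in `]j c, j f[, forall x, ~~ root (map_poly j h) x}.
  by move=> x; rewrite in_itv; exact: nrhM.
rewrite -sgr_gt0 (polyrN0_itv nr1 mI tI) sgr_gt0.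
rewrite -[RHS]sgr_gt0 (polyrN0_itv nr2 mJ t'J) sgr_gt0.
by rewrite !horner_map ij.
Qed.

(** The graph of an ordered isomorphism between subrings of [L] and [M]; [pe_pos] makes it
    functional and injective. As sets of pairs, such isomorphisms are ordered by inclusion, as
    Zorn's lemma requires. *)
Record partial_emb (L M : rcfType) (G : set (L * M)) : Prop := PartialEmb {
  pe_one : G (1, 1);
  pe_sub : forall a b c d, G (a, b) -> G (c, d) -> G (a - c, b - d);
  pe_mul : forall a b c d, G (a, b) -> G (c, d) -> G (a * c, b * d);
  pe_pos : forall a b, G (a, b) -> (0 < a) = (0 < b) }.

Section PartialEmb.
Variables (L M : rcfType) (G : set (L * M)).
Hypothesis GP : partial_emb G.

Lemma pe_zero : G (0, 0).
Proof. by have := pe_sub GP (pe_one GP) (pe_one GP); rewrite !subrr. Qed.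

Lemma pe_opp a b : G (a, b) -> G (- a, - b).
Proof. by move=> ab; have := pe_sub GP pe_zero ab; rewrite !sub0r. Qed.

Lemma pe_add a b c d : G (a, b) -> G (c, d) -> G (a + c, b + d).
Proof. by move=> ab /pe_opp cd; have := pe_sub GP ab cd; rewrite !opprK. Qed.

Lemma pe_exp a b n : G (a, b) -> G (a ^+ n, b ^+ n).
Proof.
move=> ab; elim: n => [|n IH]; first by rewrite !expr0; exact: pe_one.
by rewrite !exprS; exact: pe_mul.
Qed.

Lemma pe_neg a b : G (a, b) -> (a < 0) = (b < 0).
Proof. by move=> /pe_opp/(pe_pos GP); rewrite !oppr_gt0. Qed.

Lemma pe_eq0 a b : G (a, b) -> (a == 0) = (b == 0).
Proof.
by move=> ab; rewrite !eq_le !leNgt (pe_pos GP ab) (pe_neg ab).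
Qed.

Lemma pe_sgz a b : G (a, b) -> sgz a = sgz b.
Proof.
by move=> ab; rewrite /sgz (pe_neg ab) (pe_eq0 ab).
Qed.

Lemma pe_inj a b b' : G (a, b) -> G (a, b') -> b = b'.
Proof.
move=> ab ab'; have := pe_eq0 (pe_sub GP ab ab').
by rewrite subrr eqxx => /esym; rewrite subr_eq0 => /eqP.
Qed.

Lemma pe_mmap (k : nzRingType) (f : k -> L) (g : k -> M) N (x : 'I_N -> L)
    (y : 'I_N -> M) (p : {mpoly k[N]}) :
  (forall c, G (f c, g c)) -> (forall n, G (x n, y n)) ->
  G (mmap f x p, mmap g y p).
Proof.
move=> fg xy; rewrite /mmap; apply: (big_ind2 (fun a b => G (a, b))).
- exact: pe_zero.
- by move=> a b c d; exact: pe_add.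
- move=> m _; apply: pe_mul => //; rewrite /mmap1.
  apply: (big_ind2 (fun a b => G (a, b))); first exact: pe_one.
    by move=> a b c d; exact: pe_mul.
  by move=> n _; exact: pe_exp.
Qed.

Definition pe_maximal := forall G', partial_emb G' -> (G `<=` G')%classic ->
  (G' `<=` G)%classic.

(** The fractions of pairs of [G] form a partial embedding that contains [G], so maximality puts
    them into [G]. *)
Lemma pe_div : pe_maximal -> forall a b c d, G (a, b) -> G (c, d) ->
  G (a / c, b / d).
Proof.
move=> maxG a b c d ab cd.
pose G' : set (L * M) := [set p | exists a b c d, [/\ G (a, b), G (c, d), c != 0 &
  p = (a / c, b / d)]]%classic.
have [c0|c0] := eqVneq c 0.
  have /esym := pe_eq0 cd; rewrite c0 eqxx => /eqP ->.
  by rewrite !invr0 !mulr0; exact: pe_zero.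
apply: (maxG G'); last by exists a, b, c, d.
  split.
  - by exists 1, 1, 1, 1; rewrite !divr1 oner_neq0; split=> //; exact: pe_one.
  - move=> _ _ _ _ [x [x' [y [y' [xG yG y0 [-> ->]]]]]]
      [z [z' [t [t' [zG tG t0 [-> ->]]]]]].
    have y'0 : y' != 0 by rewrite -(pe_eq0 yG).
    have t'0 : t' != 0 by rewrite -(pe_eq0 tG).
    exists (x * t - z * y), (x' * t' - z' * y'), (y * t), (y' * t').
    split; [|exact: pe_mul|by rewrite mulf_neq0|].
      by apply: (pe_sub GP); exact: pe_mul.
    by rewrite -!mulNr !addf_div.
  - move=> _ _ _ _ [x [x' [y [y' [xG yG y0 [-> ->]]]]]]
      [z [z' [t [t' [zG tG t0 [-> ->]]]]]].
    exists (x * z), (x' * z'), (y * t), (y' * t').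
    split; [exact: pe_mul|exact: pe_mul|by rewrite mulf_neq0|].
    by rewrite !mulf_div.
  - move=> _ _ [x [x' [y [y' [xG yG y0 [-> ->]]]]]].
    have y'0 : y' != 0 by rewrite -(pe_eq0 yG).
    have E (F : rcfType) (s t : F) : t != 0 -> (0 < s / t) = (0 < s * t).
      move=> t0; have -> : s * t = s / t * t ^+ 2 by rewrite expr2 mulrA divfK.
      by rewrite [in RHS]pmulr_lgt0 // lt_def sqr_ge0 sqrf_eq0 t0.
    by rewrite !E //; apply: (pe_pos GP); exact: pe_mul.
move=> [x y] xy; exists x, y, 1, 1; rewrite !divr1 oner_neq0; split=> //.
exact: pe_one.
Qed.

End PartialEmb.

Definition rel_closed (L : fieldType) (P : set L) := subfield_set P /\
  forall q : {poly L}, q != 0 -> (forall n, P q`_n) -> forall x, root q x -> P x.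

Lemma poly_in_range (E L : fieldType) (i : {rmorphism E -> L}) (q : {poly L}) :
  (forall n, exists e, q`_n = i e) -> exists q', q = map_poly i q'.
Proof.
move=> H; have [g gE] := choice H.
exists (\poly_(n < size q) g n); apply/polyP => n; rewrite coef_map coef_poly.
by case: ltnP => h; [exact: gE|rewrite nth_default // raddf0].
Qed.

(** If [x] is algebraic over the domain of a maximal [G] but outside it, [algebraic_step] gives some
    [t], in general other than [x], and [t'] such that the pairs (h(t), h(t')) form a strictly
    larger partial embedding. *)
Lemma pe_maximal_ext (L M : rcfType) (G0 : set (L * M)) : partial_emb G0 ->
  exists G, [/\ partial_emb G, (G0 `<=` G)%classic &
    rel_closed [set a | exists b, G (a, b)]%classic].
Proof.
move=> G0P.
have [|G [GP G0G maxG]] := Zorn_above G0P.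
  move=> F [A0 FA0] Fgood Ftot.
  have chain2 p q : (\bigcup_(X in F) X)%classic p -> (\bigcup_(X in F) X)%classic q ->
      exists A, [/\ F A, A p & A q].
    move=> [A FA Ap] [B FB Bq]; have [AB|BA] := Ftot A B FA FB.
      by exists B; split=> //; exact: AB.
    by exists A; split=> //; exact: BA.
  split.
  - by exists A0 => //; exact: pe_one (Fgood _ FA0).
  - move=> a b c d h1 h2; have [A [FA h3 h4]] := chain2 _ _ h1 h2.
    by exists A => //; exact: pe_sub (Fgood _ FA) _ _ _ _ h3 h4.
  - move=> a b c d h1 h2; have [A [FA h3 h4]] := chain2 _ _ h1 h2.
    by exists A => //; exact: pe_mul (Fgood _ FA) _ _ _ _ h3 h4.
  - by move=> a b [A FA h]; exact: pe_pos (Fgood _ FA) _ _ h.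
exists G; split=> //.
have sfD : subfield_set [set a | exists b, G (a, b)]%classic.
  split; first by exists 1; exact: pe_one.
    by move=> x y [x' xx] [y' yy]; exists (x' - y'); exact: pe_sub.
  by move=> x y [x' xx] [y' yy]; exists (x' / y'); exact: pe_div.
split=> // q q0 qD x rx.
have [E [i iE]] := subfield_embedding sfD.
have [|q' q'E] := @poly_in_range E L i q; first by move=> n; apply/iE/qD.
have ex e : exists b, G (i e, b) by apply/iE; exists e.
have [j jE] := choice ex.
have jB : zmod_morphism j.
  move=> a b; apply: (pe_inj GP (jE _)); rewrite rmorphB.
  exact: pe_sub GP _ _ _ _ (jE a) (jE b).
have jM : monoid_morphism j.
  split=> [|a b]; apply: (pe_inj GP (jE _)); rewrite ?rmorph1 ?rmorphM.
    exact: pe_one.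
  exact: pe_mul GP _ _ _ _ (jE a) (jE b).
pose jr : {rmorphism E -> M} :=
  HB.pack j (GRing.isZmodMorphism.Build E M j jB)
    (GRing.isMonoidMorphism.Build E M j jM).
have ij a : (0 < i a) = (0 < jr a) by exact: pe_pos GP _ _ (jE a).
apply: contrapT => nx.
have q'0 : q' != 0 by rewrite -(map_poly_eq0 i) -q'E.
rewrite q'E in rx.
have [|t [t' [nt tt']]] := algebraic_step ij q'0 rx.
  by move=> /iE; exact: nx.
pose G' : set (L * M) :=
  [set p | exists h, p = ((map_poly i h).[t], (map_poly jr h).[t'])]%classic.
have G'P : partial_emb G'.
  split.
  - by exists 1; rewrite !rmorph1 !hornerC.
  - by move=> _ _ _ _ [h [-> ->]] [h' [-> ->]]; exists (h - h');
      rewrite !rmorphB !hornerD !hornerN.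
  - by move=> _ _ _ _ [h [-> ->]] [h' [-> ->]]; exists (h * h');
      rewrite !rmorphM !hornerM.
  - by move=> _ _ [h [-> ->]]; exact: tt'.
have GG' : (G `<=` G')%classic.
  move=> [a b] ab; have /iE[e ae] : exists b, G (a, b) by exists b.
  exists e%:P; rewrite !map_polyC !hornerC /=.
  have <- : b = j e by apply: (pe_inj GP ab); rewrite ae; exact: jE.
  by congr (_, _).
apply: nt; apply/iE; exists t'; apply: (maxG G' G'P GG').
by exists 'X; rewrite !map_polyX !hornerX.
Qed.

(** A change of sign of a polynomial over the subfield gives a root in [L], which belongs to the
    subfield by relative closedness. *)
Lemma rel_closed_rcf (L : rcfType) (P : set L) : rel_closed P ->
  exists (F : rcfType) (i : {rmorphism F -> L}),
    (forall x, P x <-> exists a, x = i a) /\ (forall a, (0 <= i a) = (0 <= a)).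
Proof.
move=> [sfP clP]; have [E [i iE]] := subfield_embedding sfP.
pose Q : set E := [set a | 0 <= i a]%classic.
have QO : field_ordering Q.
  split.
  - by move=> a b; rewrite /Q /= rmorphD; exact: addr_ge0.
  - by move=> a b; rewrite /Q /= rmorphM; exact: mulr_ge0.
  - move=> a; rewrite /Q /= rmorphN oppr_ge0 => h1 h2; apply/eqP.
    by rewrite -(fmorph_eq0 i) eq_le h1 h2.
  - by move=> a; rewrite /Q /= rmorphN oppr_ge0; case: (leP 0 (i a)); auto => /ltW; auto.
have [F0 [f [g [fK gK fpos]]]] := ordered_realField QO.
have gpos a : (0 <= i (g a)) = (0 <= a).
  by apply/idP/idP => [/(fpos (g a))|h]; [|apply/(fpos (g a))]; rewrite gK.
have gB : zmod_morphism g.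
  by move=> a b; apply: (can_inj fK); rewrite rmorphB !gK.
have gM : monoid_morphism g.
  split=> [|a b]; apply: (can_inj fK); rewrite ?rmorph1 ?rmorphM !gK //.
pose gr : {rmorphism F0 -> E} :=
  HB.pack g (GRing.isZmodMorphism.Build F0 E g gB)
    (GRing.isMonoidMorphism.Build F0 E g gM).
pose h : {rmorphism F0 -> L} := i \o gr.
have hpos a : (0 <= h a) = (0 <= a) by exact: gpos.
have hle a b : (h a <= h b) = (a <= b).
  by rewrite -subr_ge0 -rmorphB hpos subr_ge0.
have hE x : P x <-> exists a, x = h a.
  split=> [/iE[a ->]|[a ->]]; first by exists (f a); rewrite /= fK.
  by apply/iE; exists (g a).
have ivt : Num.real_closed_axiom F0.
  move=> p a b ab /andP[pa pb].
  have [p0|p0] := eqVneq p 0; first by exists a; rewrite ?lexx ?ab // p0 root0.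
  have hab : h a <= h b by rewrite hle.
  have [|x xI rx] := @Num.Theory.poly_ivt _ (map_poly h p) _ _ hab.
    by rewrite !horner_map -(rmorph0 h) !hle pa pb.
  have /hE[y yE] : P x.
    apply: clP rx => [|n]; first by rewrite map_poly_eq0.
    by rewrite coef_map; apply/hE; exists p`_n.
  exists y; first by move: xI; rewrite yE !hle.
  by move: rx; rewrite yE !rootE horner_map fmorph_eq0.
have [F [f1 [g1 [f1K g1K f1pos]]]] := real_field_ivt_rcf ivt.
have g1B : zmod_morphism g1.
  by move=> a b; apply: (can_inj f1K); rewrite rmorphB !g1K.
have g1M : monoid_morphism g1.
  split=> [|a b]; apply: (can_inj f1K); rewrite ?rmorph1 ?rmorphM !g1K //.
pose g1r : {rmorphism F -> F0} :=
  HB.pack g1 (GRing.isZmodMorphism.Build F F0 g1 g1B)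
    (GRing.isMonoidMorphism.Build F F0 g1 g1M).
exists F, (h \o g1r); split=> [x|a]; last by rewrite /= hpos -f1pos g1K.
split=> [/hE[a ->]|[a ->]]; first by exists (f1 a); rewrite /= f1K.
by apply/hE; exists (g1 a).
Qed.

Lemma seq_has_max (F : realDomainType) (x : F) (s : seq F) :
  exists2 m, m \in x :: s & forall a, a \in x :: s -> a <= m.
Proof.
elim: s x => [|y s IH] x.
  by exists x; rewrite ?mem_head // => a; rewrite inE => /eqP ->.
have [m mI mmax] := IH y; have [mx|xm] := leP m x.
  exists x; rewrite ?mem_head // => a; rewrite inE => /orP[/eqP ->//|/mmax am].
  exact: le_trans mx.
exists m; first by rewrite inE mI orbT.
by move=> a; rewrite inE => /orP[/eqP ->|/mmax//]; exact: ltW.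
Qed.

Lemma seq_has_min (F : realDomainType) (x : F) (s : seq F) :
  exists2 m, m \in x :: s & forall a, a \in x :: s -> m <= a.
Proof.
have [m mI mmax] := seq_has_max (- x) (map -%R s).
rewrite -(map_cons -%R) in mI mmax.
exists (- m); first by rewrite -(mem_map (@oppr_inj F)) opprK.
by move=> a aI; rewrite lerNl; apply: mmax; rewrite mem_map //; exact: oppr_inj.
Qed.

Lemma finite_cut (F : realFieldType) (lo hi : seq F) :
  (forall a b, a \in lo -> b \in hi -> a < b) ->
  exists c, (forall a, a \in lo -> a < c) /\ (forall b, b \in hi -> c < b).
Proof.
case: lo => [|x lo]; case: hi => [|y hi] H.
- by exists 0.
- have [m mI mmin] := seq_has_min y hi.
  by exists (m - 1); split=> // b /mmin; apply: lt_le_trans; rewrite ltrBlDr ltrDl.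
- have [m mI mmax] := seq_has_max x lo.
  by exists (m + 1); split=> // b /mmax /le_lt_trans; apply; rewrite ltrDl.
have [m mI mmax] := seq_has_max x lo.
have [p pI pmin] := seq_has_min y hi.
have mp := H m p mI pI; exists ((m + p) / 2); split=> z.
  by move/mmax/le_lt_trans; apply; rewrite midf_lt.
by move/pmin; apply: lt_le_trans; rewrite midf_lt.
Qed.

Lemma sign_on_roots_side (L : rcfType) (p : {poly L}) (a b : L) :
  (forall r, root p r -> r != b /\ (a < r) = (b < r) /\ (r < a) = (r < b)) ->
  ~~ root p b -> sgz p.[a] = sgz p.[b].
Proof.
move=> H rb; wlog ab : a b H rb / a <= b => [W|].
  have [|ba] := leP a b; first exact: W.
  have ra : ~~ root p a.
    apply/negP => ra; have [_ [_]] := H a ra.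
    by rewrite ltxx ltNge (ltW ba); case: (ltgtP a b) ba (H a ra) => // ? _ [_ []];
       rewrite ltxx => ->.
  apply/esym; apply: W (ltW ba) => // r rr; have [rnb [h1 h2]] := H r rr.
  by rewrite h1 h2; split=> //; apply: contraNneq ra => <-.
have nr : {in `[a, b], forall x, ~~ root p x}.
  move=> x; rewrite in_itv /= => /andP[ax xb]; apply/negP => rx.
  have [xnb [h1 h2]] := H x rx; have xb' : x < b by rewrite lt_neqAle xnb.
  by move: h2; rewrite xb' ltNge ax.
have aI : a \in `[a, b] by rewrite in_itv /= lexx.
have bI : b \in `[a, b] by rewrite in_itv /= lexx ab.
have := polyrN0_itv nr aI bI => E; apply/eqP.
by rewrite -(eqr_int L) -!sgrEz E.
Qed.

(** In the ultrapower of [F] along [U], the class of the identity lies in the same cut of [F] as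
    [u]. Finitely many comparisons with [u] can be met inside [F], which is densely ordered without
    end points. *)
Lemma cut_ultrafilter (L F : rcfType) (i : {rmorphism F -> L}) (u : L) :
  (forall a, (0 <= i a) = (0 <= a)) -> (forall a, u != i a) ->
  exists U : set_system F, UltraFilter U /\
    forall a, U [set c | (a < c) = (i a < u) /\ (c < a) = (u < i a)]%classic.
Proof.
move=> ipos nu.
have ilt a b : (i a < i b) = (a < b).
  by rewrite !ltNge -subr_ge0 -rmorphB ipos subr_ge0.
pose B (s : seq F) := [set c | forall a, a \in s ->
  (a < c) = (i a < u) /\ (c < a) = (u < i a)]%classic.
have FF : Filter (filter_from setT B).
  apply: filter_from_filter; first by exists [::].
  move=> s t _ _; exists (s ++ t) => // c cB.
  by split=> a aI; apply: cB; rewrite mem_cat aI ?orbT.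
have PF : ProperFilter (filter_from setT B).
  apply: filter_from_proper => // s _.
  have [|c [c1 c2]] := @finite_cut F [seq a <- s | i a < u] [seq a <- s | u < i a].
    move=> a b; rewrite !mem_filter => /andP[au _] /andP[ub _].
    by rewrite -ilt (lt_trans au).
  exists c => a aI; have := nu a; rewrite neq_lt => /orP[ua|au].
    have ca : c < a by apply: c2; rewrite mem_filter ua.
    by rewrite ca ua !ltNge (ltW ca) (ltW ua).
  have ac : a < c by apply: c1; rewrite mem_filter au.
  by rewrite ac au !ltNge (ltW ac) (ltW au).
have [U [UU BU]] := ultraFilterLemma PF.
exists U; split=> // a; apply: BU; exists [:: a] => // c cB.
by apply: cB; rewrite mem_head.
Qed.

(** The second conclusion brings the coefficients of a polynomial, or the coordinates of a solution,
    into a single member of the chain. *)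
Lemma rel_closed_bigcup (L : fieldType) (F : set (set L)) :
  (exists A, F A) -> (forall A, F A -> rel_closed A) -> total_on F subset ->
  rel_closed (\bigcup_(X in F) X)%classic /\
  forall n (y : 'I_n -> L), (forall k, (\bigcup_(X in F) X)%classic (y k)) ->
    exists2 A, F A & forall k, A (y k).
Proof.
move=> [A0 FA0] Fgood Ftot.
have fin n (y : 'I_n -> L) : (forall k, (\bigcup_(X in F) X)%classic (y k)) ->
    exists2 A, F A & forall k, A (y k).
  elim: n y => [|n IH] y yU; first by exists A0 => // -[].
  have [A FA yA] := IH (fun k => y (lift ord0 k)) (fun k => yU _).
  have [B FB yB] := yU ord0.
  have [AB|BA] := Ftot A B FA FB.
    by exists B => // k; case: (unliftP ord0 k) => [l ->|->//]; apply/AB/yA.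
  by exists A => // k; case: (unliftP ord0 k) => [l ->|->]; [exact: yA|exact: BA].
split=> //.
have chain2 p q : (\bigcup_(X in F) X)%classic p -> (\bigcup_(X in F) X)%classic q ->
    exists A, [/\ F A, A p & A q].
  move=> [A FA Ap] [B FB Bq]; have [AB|BA] := Ftot A B FA FB.
    by exists B; split=> //; exact: AB.
  by exists A; split=> //; exact: BA.
split.
  split; first by exists A0 => //; case: (Fgood _ FA0) => -[].
  - move=> x y h1 h2; have [A [FA h3 h4]] := chain2 _ _ h1 h2.
    by exists A => //; case: (Fgood _ FA) => -[_ PB _] _; exact: PB.
  - move=> x y h1 h2; have [A [FA h3 h4]] := chain2 _ _ h1 h2.
    by exists A => //; case: (Fgood _ FA) => -[_ _ PD] _; exact: PD.
move=> q q0 qU x rx.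
have [A FA qA] := fin (size q) (fun k => q`_k) (fun k => qU k).
exists A => //; have [sfA] := Fgood _ FA; apply=> //; first exact: q0.
  move=> n; have [nq|nq] := ltnP n (size q); first exact: (qA (Ordinal nq)).
  by rewrite nth_default //; case: sfA => A1 AB _; rewrite -(subrr 1); exact: AB.
exact: rx.
Qed.

(** * Transfer of systems of sign conditions *)

Section ExistentialTransfer.
Variables (k : nzRingType) (N : nat) (ps : seq {mpoly k[N]}).

Lemma ultra_mmap (L M : realFieldType) J (U : set_system J) (c : (J -> L) -> M)
    (h : k -> L) (g : 'I_N -> J -> L) (q : {mpoly k[N]}) :
  ultrapower_map U c ->
  mmap (fun a => c (fun=> h a)) (fun n => c (g n)) q =
  c (fun j => mmap h (g^~ j) q).
Proof.
move=> cU; rewrite /mmap.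
elim: (msupp q) => [|m s IH].
  by rewrite big_nil -(ultra0 cU); congr c; apply/funext=> j; rewrite big_nil.
rewrite big_cons IH; transitivity
  (c (fun j => h q@_m * mmap1 (g^~ j) m + \sum_(m <- s) h q@_m * mmap1 (g^~ j) m)); last first.
  by congr c; apply/funext=> j; rewrite big_cons.
rewrite (ultra_add cU) (ultra_mul cU); congr (_ * _ + _).
rewrite /mmap1; elim: (index_enum _) => [|n t IHt].
  by rewrite big_nil -(ultra_one cU); congr c; apply/funext=> j; rewrite big_nil.
rewrite big_cons IHt -(ultra_exp cU) -(ultra_mul cU).
by congr c; apply/funext=> j; rewrite big_cons.
Qed.

Lemma rmorph_mmap (L M : nzRingType) (f : {rmorphism L -> M}) (h : k -> L) (y : 'I_N -> L)
    (q : {mpoly k[N]}) :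
  mmap (f \o h) (f \o y) q = f (mmap h y q).
Proof.
rewrite /mmap rmorph_sum; apply: eq_bigr => m _; rewrite rmorphM; congr (_ * _).
by rewrite /mmap1 rmorph_prod; apply: eq_bigr => n _; rewrite rmorphXn.
Qed.

Lemma ultra_sgz (L M : realFieldType) J (U : set_system J) (c : (J -> L) -> M) f :
  UltraFilter U -> ultrapower_map U c ->
  U [set j | sgz (f j) = sgz (c f)]%classic.
Proof.
move=> UU cU; have [cf|cf|cf] := ltgtP 0 (c f).
- rewrite (gtr0_sgz cf); move: cf; rewrite -(ultra0 cU) => /(ultra_lt UU cU).
  by apply: filterS => j /= /gtr0_sgz.
- rewrite (ltr0_sgz cf); move: cf; rewrite -(ultra0 cU) => /(ultra_lt UU cU).
  by apply: filterS => j /= /ltr0_sgz.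
- rewrite -cf sgz0; move: cf; rewrite -(ultra0 cU) => /(ultra_eq_iff UU cU).
  by apply: filterS => j /= <-; rewrite sgz0.
Qed.

Lemma filter_all T (F : set_system T) (I : eqType) (s : seq I) (P : I -> set T) :
  Filter F -> (forall q, q \in s -> F (P q)) ->
  F [set t | forall q, q \in s -> P q t]%classic.
Proof.
move=> FF; elim: s => [|q s IH] H; first by apply: filterS filterT => t _ q; rewrite in_nil.
apply: filterS2 (H q (mem_head _ _)) (IH _) => [t Pq Ps r|r rs]; last first.
  by apply: H; rewrite inE rs orbT.
by rewrite inE => /orP[/eqP ->|]; [|exact: Ps].
Qed.

(* If M had no solution, let F be maximal among the relatively algebraically closed subfields
   of L without one, and u outside F. The relative closure of F(u) embeds into an ultrapower of
   F realizing the cut of u, and a solution in the ultrapower descends to F. *)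
Theorem rcf_transfer (L M : rcfType) (iL : {rmorphism k -> L}) (iM : {rmorphism k -> M})
    (x : 'I_N -> L) : (forall a, (0 < iL a) = (0 < iM a)) ->
  exists y : 'I_N -> M,
    forall q, q \in ps -> sgz (mmap iL x q) = sgz (mmap iM y q).
Proof.
move=> iLM.
pose sol (P : set L) := exists y : 'I_N -> L, (forall n, P (y n)) /\
  forall q, q \in ps -> sgz (mmap iL y q) = sgz (mmap iL x q).
pose G0 : set (L * M) := [set p | exists a, p = (iL a, iM a)]%classic.
have G0P : partial_emb G0.
  split.
  - by exists 1; rewrite !rmorph1.
  - by move=> _ _ _ _ [a [-> ->]] [b [-> ->]]; exists (a - b); rewrite !rmorphB.
  - by move=> _ _ _ _ [a [-> ->]] [b [-> ->]]; exists (a * b); rewrite !rmorphM.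
  - by move=> _ _ [a [-> ->]].
have [G [GP G0G Gcl]] := pe_maximal_ext G0P.
(* It is enough to find solutions inside subfields of [L]: the embedding [G] carries one with
   coordinates in its domain to [M]. *)
suff key : forall P, rel_closed P -> (forall a, P (iL a)) -> sol P.
  have [|y [yD ysol]] := key _ Gcl.
    by move=> a; exists (iM a); apply: G0G; exists a.
  have [z zE] := choice yD; exists z => q qps; rewrite -(ysol q qps).
  apply: (pe_sgz GP); apply: (pe_mmap GP) => // a.
  by apply: G0G; exists a.
move=> P0 P0cl P0k; apply: contrapT => nsolP0.
pose good A := rel_closed A /\ ~ sol A.
have [||P [[Pcl nsolP] P0P maxP]] := @Zorn_above _ good P0.
- by [].
- move=> F F0 Fgood Ftot.
  have [cl fin] := rel_closed_bigcup F0 (fun A FA => (Fgood A FA).1) Ftot.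
  split=> // -[y [yU ysol]]; have [A FA yA] := fin _ _ yU.
  by case: (Fgood A FA) => _; apply; exists y.
have [u nPu] : exists u, ~ P u.
  by apply: contrapT => H; apply: nsolP; exists x; split=> // n;
    apply: contrapT => nP; apply: H; exists (x n).
have [F [i [iE ipos]]] := rel_closed_rcf Pcl.
have ilt a b : (i a < i b) = (a < b).
  by rewrite !ltNge -subr_ge0 -rmorphB ipos subr_ge0.
have nu a : u != i a.
  by apply/eqP => ua; apply: nPu; apply/iE; exists a.
have [U [UU Ucut]] := cut_ultrafilter ipos nu.
have [Mu [c cU]] := ultrapower_exists F UU.
have iF a : exists b, iL a = i b by apply/iE/P0P/P0k.
have [iF' iF'E] := choice iF.
(* Evaluation at [u] is matched with evaluation at the class of the identity. *)
pose G1 : set (L * Mu) := [set p | exists q : {poly F},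
  p = ((map_poly i q).[u], c (horner q))]%classic.
have G1P : partial_emb G1.
  split.
  - exists 1; rewrite rmorph1 hornerC -(ultra_one cU); congr (_, c _).
    by apply/funext=> a; rewrite hornerC.
  - move=> _ _ _ _ [p [-> ->]] [q [-> ->]]; exists (p - q).
    rewrite rmorphB !hornerD hornerN -(ultra_sub cU); congr (_, c _).
    by apply/funext=> a; rewrite hornerD hornerN.
  - move=> _ _ _ _ [p [-> ->]] [q [-> ->]]; exists (p * q).
    rewrite rmorphM !hornerM -(ultra_mul cU); congr (_, c _).
    by apply/funext=> a; rewrite hornerM.
  - move=> _ _ [q [-> ->]].
    have [->|q0] := eqVneq q 0.
      rewrite rmorph0 horner0 -(ultra0 cU).
      have -> : horner (0 : {poly F}) = fun=> 0 by apply/funext=> a; rewrite horner0.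
      by rewrite !ltxx.
    have qi0 : map_poly i q != 0 by rewrite map_poly_eq0.
    (* As [P] is relatively closed, all roots of [q] in [L] come from [F]; so the cut of [u] in [F]
       determines the sign of [q] at [u]. *)
    have inP r : root (map_poly i q) r -> P r.
      apply: Pcl.2 => // n; rewrite coef_map; apply/iE; by exists q`_n.
    have nru : ~~ root (map_poly i q) u by apply/negP => /inP.
    pose rts := roots (map_poly i q) (- cauchy_bound (map_poly i q))
       (cauchy_bound (map_poly i q)).
    have rtsP r : root (map_poly i q) r -> r \in rts.
      move=> rr; rewrite in_roots rr qi0 andbT /=.
      exact: root_in_cauchy_bound.
    have UC : U [set a | forall r, r \in rts ->
        (r < i a) = (r < u) /\ (i a < r) = (u < r)]%classic.
      apply: filter_all => r /root_roots/inP/iE[b ->].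
      by apply: filterS (Ucut b) => a /=; rewrite !ilt.
    have US : U [set a | sgz q.[a] = sgz (map_poly i q).[u]]%classic.
      apply: filterS UC => a /= H.
      have <- : sgz (i q.[a]) = sgz q.[a].
        by rewrite /sgz fmorph_eq0 -[in LHS](rmorph0 i) ilt.
      rewrite -horner_map; apply: sign_on_roots_side => // r rr.
      have [h1 h2] := H r (rtsP r rr); split=> //.
      by apply: contraNneq nru => <-.
    rewrite -(sgz_gt0 (c _)) -sgz_gt0.
    have [a []] := @filter_ex _ _ _ _ (filterI US (ultra_sgz (horner q) UU cU)).
    by move=> /= <- <-.
have [G' [G'P G1G' G'cl]] := pe_maximal_ext G1P.
set D := [set a | _]%classic in G'cl.
have PD : (P `<=` D)%classic.
  move=> a /iE[b ->]; exists (c (horner b%:P)); apply: G1G'; exists b%:P.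
  by rewrite map_polyC hornerC.
have Du : D u.
  by exists (c (horner 'X)); apply: G1G'; exists 'X; rewrite map_polyX hornerX.
(* [D] contains [P] and also [u], so by maximality of [P] it cannot be without a solution. *)
have [y [yD ysol]] : sol D.
  by apply: contrapT => nsol; apply: nPu; apply: (maxP D).
have [z zE] := choice yD.
have [g gE] := choice (fun n => ultra_surj cU (z n)).
have zsol q : q \in ps ->
    sgz (c (fun a => mmap iF' (g^~ a) q)) = sgz (mmap iL x q).
  move=> qps; rewrite -(ysol q qps) -(ultra_mmap _ _ _ cU); apply/esym.
  apply: (pe_sgz G'P); apply: (pe_mmap G'P) => [a|n]; last by rewrite -gE.
  rewrite iF'E; apply: G1G'; exists (iF' a)%:P; rewrite map_polyC hornerC.
  by congr (_, c _); apply/funext=> b; rewrite hornerC.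
have Uall : U [set a | forall q, q \in ps ->
    sgz (mmap iF' (g^~ a) q) = sgz (mmap iL x q)]%classic.
  apply: filter_all => q qps; rewrite -(zsol q qps).
  exact: ultra_sgz (fun a => mmap iF' (g^~ a) q) UU cU.
have [a aH] := @filter_ex _ _ _ _ Uall.
apply: nsolP; exists (fun n => i (g n a)); split=> [n|q qps].
  by apply/iE; exists (g n a).
rewrite -(aH q qps).
have -> : mmap iL (fun n => i (g n a)) q = i (mmap iF' (g^~ a) q).
  rewrite -rmorph_mmap; congr (mmap _ _ q).
  by apply/funext => b; rewrite iF'E.
by rewrite /sgz fmorph_eq0 -[in LHS](rmorph0 i) ilt.
Qed.
End ExistentialTransfer.

(** * Real closures *)

(** A proper preordering of the subfield S - S of [F]. The subfield varies with [S], so that Zorn's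
    lemma enlarges it together with its ordering. *)
Record subfield_cone (F : fieldType) (S : set F) : Prop := SubfieldCone {
  cone0 : S 0;
  cone1 : S 1;
  coneD : forall a b, S a -> S b -> S (a + b);
  coneM : forall a b, S a -> S b -> S (a * b);
  coneV : forall a, S a -> S a^-1;
  cone_sqr : forall a b, S a -> S b -> S ((a - b) ^+ 2);
  coneN1 : ~ S (- 1) }.

Definition cone_span (F : fieldType) (S : set F) : set F :=
  [set x | exists a b, [/\ S a, S b & x = a - b]]%classic.

Definition cone_maximal (F : fieldType) (S : set F) :=
  forall S', subfield_cone S' -> (S `<=` S')%classic -> (S' `<=` S)%classic.

Lemma cone_extends (F : fieldType) (S0 : set F) : subfield_cone S0 ->
  exists S, [/\ subfield_cone S, (S0 `<=` S)%classic & cone_maximal S].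
Proof.
move=> S0c; apply: Zorn_above => // C [A0 CA0] Cgood Ctot.
have chain2 p q : (\bigcup_(X in C) X)%classic p -> (\bigcup_(X in C) X)%classic q ->
    exists A, [/\ C A, A p & A q].
  move=> [A FA Ap] [B FB Bq]; have [AB|BA] := Ctot A B FA FB.
    by exists B; split=> //; exact: AB.
  by exists A; split=> //; exact: BA.
split.
- by exists A0 => //; exact: cone0 (Cgood _ CA0).
- by exists A0 => //; exact: cone1 (Cgood _ CA0).
- move=> a b h1 h2; have [A [CA h3 h4]] := chain2 _ _ h1 h2.
  by exists A => //; exact: coneD (Cgood _ CA) _ _ h3 h4.
- move=> a b h1 h2; have [A [CA h3 h4]] := chain2 _ _ h1 h2.
  by exists A => //; exact: coneM (Cgood _ CA) _ _ h3 h4.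
- by move=> a [A CA h]; exists A => //; exact: coneV (Cgood _ CA) _ h.
- move=> a b h1 h2; have [A [CA h3 h4]] := chain2 _ _ h1 h2.
  by exists A => //; exact: cone_sqr (Cgood _ CA) _ _ h3 h4.
- by move=> [A CA]; exact: coneN1 (Cgood _ CA).
Qed.

Section Cone.
Variables (F : fieldType) (S : set F).
Hypothesis Sc : subfield_cone S.

Lemma span_cone a : S a -> cone_span S a.
Proof. by move=> Sa; exists a, 0; rewrite subr0; split=> //; exact: cone0. Qed.

Lemma span_sqr x : cone_span S x -> S (x ^+ 2).
Proof. by move=> [a [b [Sa Sb ->]]]; exact: cone_sqr. Qed.

Lemma span_sub x y : cone_span S x -> cone_span S y -> cone_span S (x - y).
Proof.
move=> [a [b [Sa Sb ->]]] [c [d [Sc' Sd ->]]].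
by exists (a + d), (b + c); split; [exact: coneD|exact: coneD|ring].
Qed.

Lemma span_mul x y : cone_span S x -> cone_span S y -> cone_span S (x * y).
Proof.
move=> [a [b [Sa Sb ->]]] [c [d [Sc' Sd ->]]].
exists (a * c + b * d), (a * d + b * c).
by split; [apply: (coneD Sc); exact: coneM|apply: (coneD Sc); exact: coneM|ring].
Qed.

Lemma inv_sqr (x : F) : x^-1 = x * (x ^+ 2)^-1.
Proof.
have [->|x0] := eqVneq x 0; first by rewrite invr0 mul0r.
by rewrite expr2 invfM mulrA mulfV // mul1r.
Qed.

Lemma span_inv x : cone_span S x -> cone_span S x^-1.
Proof.
move=> Ex; rewrite inv_sqr; apply: span_mul => //.
by apply: span_cone; apply: (coneV Sc); exact: span_sqr.
Qed.

Lemma span_subfield : subfield_set (cone_span S).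
Proof.
split; first by apply: span_cone; exact: cone1.
  by move=> x y; exact: span_sub.
by move=> x y Ex /span_inv; exact: span_mul.
Qed.

(** If the enlarged set contained -1 = a - b x, then b would be nonzero and x = (1 + a) / b would
    lie in [S]. *)
Lemma cone_adjoin x : cone_span S x -> ~ S x ->
  subfield_cone [set z | exists a b, [/\ S a, S b & z = a - b * x]]%classic.
Proof.
move=> Ex nSx.
have Sx2 : S (x ^+ 2) by exact: span_sqr.
have Ez z : (exists a b, [/\ S a, S b & z = a - b * x]) -> cone_span S z.
  move=> [a [b [Sa Sb ->]]]; apply: span_sub; first exact: span_cone.
  by apply: span_mul => //; exact: span_cone.
have emb a : S a -> exists b c, [/\ S b, S c & a = b - c * x].
  by move=> Sa; exists a, 0; rewrite mul0r subr0; split=> //; exact: cone0.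
split.
- by apply: emb; exact: cone0.
- by apply: emb; exact: cone1.
- move=> _ _ [a [b [Sa Sb ->]]] [c [d [Sc' Sd ->]]].
  by exists (a + c), (b + d); split; [exact: coneD|exact: coneD|ring].
- move=> _ _ [a [b [Sa Sb ->]]] [c [d [Sc' Sd ->]]].
  exists (a * c + b * d * x ^+ 2), (a * d + b * c); split; last by ring.
    by apply: (coneD Sc); [|apply: (coneM Sc) => //]; exact: coneM.
  by apply: (coneD Sc); exact: coneM.
- move=> z zS; have Sz : S ((z ^+ 2)^-1).
    by apply: (coneV Sc); apply: span_sqr; exact: Ez.
  rewrite inv_sqr; move: ((z ^+ 2)^-1) Sz => w Sw; case: zS => a [b [Sa Sb ->]].
  by exists (a * w), (b * w); split; [exact: coneM|exact: coneM|ring].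
- move=> z z' /Ez h1 /Ez h2; apply: emb; apply: span_sqr; exact: span_sub.
- move=> [a [b [Sa Sb E]]]; have bx : b * x = 1 + a by apply/eqP; rewrite -subr_eq0; apply/eqP; rewrite -[1]opprK E; ring.
  have [b0|b0] := eqVneq b 0.
    apply: (coneN1 Sc); suff -> : - 1 = a by [].
    by rewrite E b0 mul0r subr0.
  apply: nSx; suff -> : x = (1 + a) * b^-1.
    apply: (coneM Sc); last exact: coneV.
    by apply: (coneD Sc) => //; exact: cone1.
  by rewrite -bx mulrAC mulfV // mul1r.
Qed.

Lemma cone_total : cone_maximal S -> forall x, cone_span S x -> S x \/ S (- x).
Proof.
move=> maxS x Ex; have [Sx|nSx] := pselect (S x); [by left|right].
apply: (maxS _ (cone_adjoin Ex nSx)); last first.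
  by exists 0, 1; rewrite mul1r sub0r; split; [exact: cone0|exact: cone1|].
by move=> a Sa; exists a, 0; rewrite mul0r subr0; split=> //; exact: cone0.
Qed.

Lemma cone_anti x : S x -> S (- x) -> x = 0.
Proof.
move=> Sx SNx; apply/eqP; apply: contraT => x0.
exfalso; apply: (coneN1 Sc); have -> : -1 = - x * x^-1 by rewrite mulNr mulfV.
by apply: (coneM Sc) => //; exact: coneV.
Qed.

Lemma two_neq0 : (2 : F) != 0.
Proof.
apply/eqP => E; apply: (coneN1 Sc); have -> : -1 = 1 :> F; last exact: cone1.
by apply/eqP; rewrite eq_sym -subr_eq0 opprK -E.
Qed.

Lemma halves (x : F) : x = ((x + 1) / 2) ^+ 2 - ((x - 1) / 2) ^+ 2.
Proof. by have := two_neq0 => h; field. Qed.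

End Cone.

(** Sums of a h^2 with a >= 0 in [E]; the bound on the size of h controls the size of a cofactor in
    [cone_ivt]. *)
Inductive poly_cone (E : realFieldType) (n : nat) : {poly E} -> Prop :=
| PolyCone0 : poly_cone n 0
| PolyConeS (a : E) (h W : {poly E}) of 0 <= a & (size h < n)%N & poly_cone n W :
    poly_cone n (a *: h ^+ 2 + W).

Section PolyCone.
Variable (E : realFieldType).

Lemma poly_cone_ge0 n (W : {poly E}) x : poly_cone n W -> 0 <= W.[x].
Proof.
elim=> [|a h V a0 _ _ IH]; first by rewrite horner0.
by rewrite hornerD hornerZ horner_exp addr_ge0 // mulr_ge0 // sqr_ge0.
Qed.

Lemma poly_cone_size n (W : {poly E}) : poly_cone n.+2 W -> (size W <= (n.+1).*2.-1)%N.
Proof.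
elim=> [|a h V a0 hn _ IH]; first by rewrite size_poly0.
apply: leq_trans (size_polyD _ _) _; rewrite geq_max IH andbT.
apply: leq_trans (size_scale_leq _ _) _; rewrite expr2.
apply: leq_trans (size_polyMleq _ _) _.
by rewrite -addnn; move: hn; rewrite ltnS => hn; rewrite -!subn1 leq_sub2r // leq_add.
Qed.

Lemma poly_cone_add n (V W : {poly E}) : poly_cone n V -> poly_cone n W ->
  poly_cone n (V + W).
Proof.
move=> VC WC; elim: VC => [|a h U a0 hn _ IH]; first by rewrite add0r.
by rewrite -addrA; constructor.
Qed.

Lemma poly_cone_mod (p W : {poly E}) n : p != 0 -> poly_cone n W ->
  exists2 W', poly_cone (size p) W' & p %| W - W'.
Proof.
move=> p0; elim=> [|a h V a0 hn _ [V' V'C pV]].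
  by exists 0; [constructor|rewrite subrr dvdp0].
exists (a *: (h %% p) ^+ 2 + V'); first by constructor; rewrite ?ltn_modp.
have -> : a *: h ^+ 2 + V - (a *: (h %% p) ^+ 2 + V') =
   a *: ((h - h %% p) * (h + h %% p)) + (V - V').
  by rewrite -subr_sqr scalerBr opprD addrACA.
apply: dvdp_add => //; rewrite -mul_polyC; apply: dvdp_mull; apply: dvdp_mulr.
by rewrite {1}(divp_eq h p) addrK dvdp_mull.
Qed.

Lemma poly_cone_le n m (W : {poly E}) : (n <= m)%N -> poly_cone n W -> poly_cone m W.
Proof.
move=> nm; elim=> [|a h V a0 hn _ IH]; first by constructor.
by constructor=> //; exact: leq_trans nm.
Qed.

Definition sos_poly (W : {poly E}) := exists n, poly_cone n W.

Lemma sos_polyD V W : sos_poly V -> sos_poly W -> sos_poly (V + W).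
Proof.
move=> [n Vn] [m Wm]; exists (maxn n m).
by apply: poly_cone_add; [apply: poly_cone_le Vn|apply: poly_cone_le Wm];
   rewrite ?leq_maxl ?leq_maxr.
Qed.

Lemma sos_polyS a h : 0 <= a -> sos_poly (a *: h ^+ 2).
Proof.
by move=> a0; exists (size h).+1; rewrite -[_ *: _]addr0; constructor=> //; constructor.
Qed.

Lemma sos_polyM V W : sos_poly V -> sos_poly W -> sos_poly (V * W).
Proof.
move=> [n Vn] [m Wm]; elim: Vn => [|a h U a0 _ _ IH].
  by rewrite mul0r; exists 0%N; constructor.
rewrite mulrDl; apply: sos_polyD => {IH} //.
elim: Wm => [|b g X b0 _ _ IH]; first by rewrite mulr0; exists 0%N; constructor.
rewrite mulrDr; apply: sos_polyD => //.
rewrite -scalerAl -scalerAr scalerA -exprMn; apply: sos_polyS.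
exact: mulr_ge0.
Qed.
End PolyCone.

Lemma irreducible_common_root (E F : fieldType) (i : {rmorphism E -> F})
    (p W : {poly E}) (t : F) : irreducible_poly p ->
  root (map_poly i p) t -> root (map_poly i W) t -> p %| W.
Proof.
move=> [p1 irr] rp rW; have [/eqP cop|ncop] := boolP (size (gcdp p W) == 1%N).
  have : coprimep (map_poly i p) (map_poly i W) by rewrite coprimep_map coprimep_def cop.
  by move/coprimep_root => /(_ _ rp); rewrite -rootE rW.
have /eqp_dvdl <- := irr _ ncop (dvdp_gcdl _ _).
exact: dvdp_gcdr.
Qed.

Lemma irreducible_inverse (E F : fieldType) (i : {rmorphism E -> F})
    (p Z : {poly E}) (t : F) : irreducible_poly p ->
  root (map_poly i p) t -> exists V, (map_poly i V).[t] = (map_poly i Z).[t]^-1.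
Proof.
move=> irr rp; have [rZ|rZ] := boolP (root (map_poly i Z) t).
  by exists 0; rewrite rmorph0 horner0; move/rootP: rZ => ->; rewrite invr0.
have cop : coprimep p Z.
  rewrite coprimep_def; apply: contraT => /(irr.2 _)/(_ (dvdp_gcdl _ _)) /eqp_dvdl E1.
  move: rZ => /negP[]; have : p %| Z by rewrite -E1 dvdp_gcdr.
  by rewrite -(dvdp_map i) => /dvdpP[q ->]; rewrite rootM rp orbT.
have [[u v] /= uv] := Bezout_eq1_coprimepP _ _ cop.
exists v; apply: (mulIf rZ); rewrite mulVf //.
have := congr1 (fun q => (map_poly i q).[t]) uv.
rewrite rmorphD !rmorphM rmorph1 hornerD !hornerM hornerC.
by move/rootP: rp => ->; rewrite mulr0 add0r.
Qed.

Section MaximalConeClosed.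
Variables (F : closedFieldType) (S : set F).
Hypotheses (Sc : subfield_cone S) (maxS : cone_maximal S).
Variables (E : realFieldType) (i : {rmorphism E -> F}).
Hypothesis iE : forall x, S x <-> exists2 a, 0 <= a & x = i a.

(** The values at [t] of sums of a h^2 form a cone, since by hypothesis -1 is not among them. It
    contains [S], hence equals it; so the squares of E[t] lie in [S], and [t] is a difference of two
    of them. *)
Lemma adjoin_root_cone (p : {poly E}) t : irreducible_poly p ->
  root (map_poly i p) t ->
  (forall W, poly_cone (size p) W -> ~~ (p %| 1 + W)) ->
  exists c, t = i c.
Proof.
move=> irr rp nW.
pose S' : set F := [set z | exists2 W, sos_poly W & z = (map_poly i W).[t]]%classic.
have p0 : p != 0 by rewrite -size_poly_gt0 ltnW //; case: irr.
have S'c : subfield_cone S'.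
  split.
  - by exists 0; [exists 0%N; constructor|rewrite rmorph0 horner0].
  - exists 1; last by rewrite rmorph1 hornerC.
    by have := sos_polyS 1 (@ler01 E); rewrite expr1n scale1r.
  - move=> _ _ [V VC ->] [W WC ->]; exists (V + W); first exact: sos_polyD.
    by rewrite rmorphD hornerD.
  - move=> _ _ [V VC ->] [W WC ->]; exists (V * W); first exact: sos_polyM.
    by rewrite rmorphM hornerM.
  - move=> _ [W WC ->]; have [V VE] := irreducible_inverse W irr rp.
    exists (W * V ^+ 2).
      by apply: sos_polyM => //; have := sos_polyS V (@ler01 E); rewrite scale1r.
    by rewrite rmorphM rmorphXn hornerM horner_exp VE exprVn -inv_sqr.
  - move=> _ _ [V _ ->] [W _ ->]; exists ((V - W) ^+ 2).
      by have := sos_polyS (V - W) (@ler01 E); rewrite scale1r.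
    by rewrite rmorphXn rmorphB horner_exp hornerD hornerN.
  (* Reduction modulo [p] brings the squared polynomials below the size of [p], as [nW] requires. *)
  - move=> [W [n WC] E1]; have [V VC pWV] := poly_cone_mod p0 WC.
    move: (nW V VC) => /negP[]; apply: (irreducible_common_root irr rp).
    have pr : root (map_poly i (W - V)) t.
      move: pWV; rewrite -(dvdp_map i) => /dvdpP[q ->]; by rewrite rootM rp orbT.
    apply/rootP; rewrite rmorphD rmorph1 hornerD hornerC.
    move/rootP: pr; rewrite rmorphB hornerD hornerN -E1.
    by move/eqP; rewrite subr_eq0 => /eqP <-; rewrite subrr.
have SS' : (S `<=` S')%classic.
  move=> x /iE[a a0 ->]; exists a%:P; last by rewrite map_polyC hornerC.
  by have := sos_polyS 1 a0; rewrite expr1n alg_polyC.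
have sqS x : S' x -> exists a, x = i a by move/(maxS S'c SS') => /iE[a _ ->]; exists a.
have half (h : {poly E}) : S' ((map_poly i h).[t] ^+ 2).
  exists (h ^+ 2); last by rewrite rmorphXn horner_exp.
  by have := sos_polyS h (@ler01 E); rewrite scale1r.
have [a aE] := sqS _ (half (2^-1 *: ('X + 1))).
have [b bE] := sqS _ (half (2^-1 *: ('X - 1))).
exists (a - b); rewrite rmorphB -aE -bE.
rewrite !map_polyZ rmorphB rmorphD /= !map_polyX !rmorph1 !hornerZ !hornerD hornerN.
rewrite !hornerX !hornerC /= fmorphV rmorph_nat [LHS](halves Sc).
by rewrite !(mulrC 2^-1).
Qed.

(* Otherwise a root of a polynomial of least degree that changes sign could be adjoined to the
   maximal cone. *)
Lemma cone_ivt : Num.real_closed_axiom E.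
Proof.
move=> p; have [n] := ubnP (size p); elim: n p => // n IH p pn a b ab /andP[pa pb].
have [pa0|pa0] := eqVneq p.[a] 0.
  by exists a; rewrite ?lexx ?ab //; apply/rootP.
have [pb0|pb0] := eqVneq p.[b] 0.
  by exists b; rewrite ?lexx ?ab //; apply/rootP.
have {pa pa0} pa : p.[a] < 0 by rewrite lt_neqAle pa0.
have {pb pb0} pb : 0 < p.[b] by rewrite lt_neqAle eq_sym pb0.
have p0 : p != 0 by apply: contraTneq pa => ->; rewrite horner0 ltxx.
have IH' (q : {poly E}) : (size q < size p)%N -> q.[a] * q.[b] <= 0 ->
    exists2 x, a <= x <= b & root q x.
  move=> qp; have qn : (size q < n)%N by apply: leq_trans qp _.
  have [qa|qa] := leP q.[a] 0.
    have [qa0|qa0] := eqVneq q.[a] 0.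
      by exists a; rewrite ?lexx ?ab //; apply/rootP.
    by rewrite nmulr_rle0 ?lt_neqAle ?qa0 // => qb; apply: IH; rewrite ?qa.
  rewrite pmulr_rle0 // => qb.
  have [||x xI rx] := IH (- q) _ a b ab; first by rewrite size_polyN.
    by rewrite !hornerN !oppr_le0 oppr_ge0 (ltW qa).
  by exists x => //; rewrite rootN in rx.
have p1 : (1 < size p)%N.
  rewrite ltnNge; apply/negP => p1; move: pa pb; rewrite (size1_polyC p1) !hornerC.
  by move=> h1 h2; have := lt_trans h1 h2; rewrite ltxx.
(* If [p] is reducible, one of two factors of smaller size vanishes or changes sign on [a, b]. *)
have [irr|nirr] := pselect (irreducible_poly p); last first.
  have [q [q1 qp nqp]] : exists q : {poly E}, [/\ size q != 1%N, q %| p & ~~ (q %= p)].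
    apply: contrapT => H; apply: nirr; split=> // q q1 qp.
    by apply: contrapT => nqp; apply: H; exists q; split=> //; exact/negP.
  have q0 : q != 0 by apply: contraNneq p0 => q0; rewrite -dvd0p -q0.
  have sqp : (size q < size p)%N.
    by rewrite ltn_neqAle dvdp_leq // andbT -(dvdp_size_eqp qp) in nqp *.
  have srp : (size (p %/ q)%R < size p)%N.
    rewrite size_divp // ltn_subrL (ltnW p1) andbT.
    by move: q0 q1; rewrite -size_poly_gt0; case: (size q) => [|[|]].
  have pE := divpK qp.
  have sgn : (p %/ q).[a] * (p %/ q).[b] * (q.[a] * q.[b]) < 0.
    by rewrite mulrACA -!hornerM pE nmulr_rlt0.
  have [sq|sq] := leP (q.[a] * q.[b]) 0.
    have [x xI rx] := IH' q sqp sq; exists x => //.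
    by rewrite -pE rootM rx orbT.
  have [|x xI rx] := IH' (p %/ q) srp; first by move: sgn; rewrite pmulr_llt0 // => /ltW.
  by exists x => //; rewrite -pE rootM rx.
have [t rt] : exists t, root (map_poly i p) t.
  by apply/closed_rootP; rewrite size_map_poly neq_ltn p1 orbT.
have [c tc] : exists c, t = i c.
  apply: (adjoin_root_cone irr rt) => W WC; apply/negP => pW.
  have s2 : exists k, size p = k.+2 by move: p1; case: (size p) => [|[|k]] // _; exists k.
  have [k sk] := s2.
  have W1 x : 1 <= (1 + W).[x].
    by rewrite hornerD hornerC lerDl (poly_cone_ge0 _ WC).
  have W0 : 1 + W != 0 by apply: contraTneq (W1 0) => ->; rewrite horner0 -ltNge ltr01.
  have sW : (size (1 + W)%R <= (k.+1).*2.-1)%N.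
    apply: leq_trans (size_polyD _ _) _; rewrite geq_max size_poly1.
    by rewrite (poly_cone_size (n := k)) -?sk // doubleS.
  (* The cofactor is smaller than [p] and, as 1 + W > 0, changes sign together with [p]. By
     induction it has a root in [E], where 1 + W would vanish. *)
  pose m := (1 + W) %/ p.
  have sm : (size m < size p)%N.
    rewrite size_divp // sk /= ltn_subLR; last first.
      by apply: leq_trans (dvdp_leq W0 pW); rewrite sk.
    apply: leq_ltn_trans sW _; rewrite doubleS /= -addnn.
    by rewrite !addSn !addnS leqnSn.
  have mE := divpK pW.
  have mab : m.[a] * m.[b] <= 0.
    have h : 0 < (m.[a] * m.[b]) * (p.[a] * p.[b]).
      rewrite mulrACA -!hornerM mE mulr_gt0 //; exact: lt_le_trans (W1 _).
    rewrite nmulr_lgt0 in h; [exact: ltW|by rewrite nmulr_rlt0].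
  have [x _ /rootP mx] := IH' m sm mab.
  by have := W1 x; rewrite -mE hornerM mx mul0r leNgt ltr01.
have rc : root p c by move: rt; rewrite tc !rootE horner_map fmorph_eq0.
exists c => //.
have lin : 'X - c%:P %= p by apply: irr.2; rewrite ?size_XsubC // dvdp_XsubCl.
have [q qE] : exists q, p = q * ('X - c%:P) by apply/dvdpP; rewrite dvdp_XsubCl.
have [l lE] : exists l, p = l%:P * ('X - c%:P).
  have : size p = 2%N by rewrite -(eqp_size lin) size_XsubC.
  have q0 : q != 0 by apply: contraNneq p0 => q0; rewrite qE q0 mul0r.
  rewrite {1}qE size_Mmonic ?monicXsubC // size_XsubC addn2 /= => -[q1].
  by exists q`_0; rewrite {1}qE; congr (_ * _); apply: size1_polyC; rewrite q1.
move: pa pb; rewrite lE !hornerM !hornerC !hornerXsubC.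
have [l0|l0|<-] := ltgtP 0 l.
- by rewrite pmulr_rlt0 // pmulr_rgt0 // subr_lt0 subr_gt0 => /ltW -> /ltW.
- rewrite nmulr_rlt0 // nmulr_rgt0 // subr_lt0 subr_gt0 => h1 h2.
  by have := lt_trans h2 h1; rewrite ltNge ab.
- by rewrite mul0r ltxx.
Qed.
End MaximalConeClosed.

(** A maximal cone above the image of [Q] spans a real closed subfield of [F]: the roots exist in
    [F], and maximality brings them into the span. [L] is a real closed extension of the ordered
    field, not necessarily an algebraic one. *)
Theorem real_closure_in_closed (K : fieldType) (F : closedFieldType)
    (f : {rmorphism K -> F}) (Q : set K) : field_ordering Q ->
  exists (L : rcfType) (i : {rmorphism K -> L}), forall a, Q a <-> 0 <= i a.
Proof.
move=> [QD QM Qanti Qtot].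
have Qsqr a : Q (a ^+ 2).
  by case: (Qtot a) => h; [|rewrite -sqrrN]; rewrite expr2; exact: QM.
have Q1 : Q 1 by rewrite -(expr1n _ 2).
have Q0 : Q 0 by have := Qsqr 0; rewrite expr0n.
have S0c : subfield_cone [set x | exists2 a, Q a & x = f a]%classic.
  split.
  - by exists 0; rewrite ?rmorph0.
  - by exists 1; rewrite ?rmorph1.
  - by move=> _ _ [a Qa ->] [b Qb ->]; exists (a + b); rewrite ?rmorphD //; exact: QD.
  - by move=> _ _ [a Qa ->] [b Qb ->]; exists (a * b); rewrite ?rmorphM //; exact: QM.
  - move=> _ [a Qa ->]; exists a^-1; rewrite ?fmorphV // inv_sqr -exprVn.
    exact: QM.
  - by move=> _ _ [a Qa ->] [b Qb ->]; exists ((a - b) ^+ 2); rewrite ?rmorphXn ?rmorphB.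
  - move=> [a Qa E]; have aE : a = -1.
      by apply: (fmorph_inj f); rewrite rmorphN rmorph1.
    by rewrite aE in Qa; have /eqP := Qanti _ Q1 Qa; rewrite oner_eq0.
have [S [Sc S0S maxS]] := cone_extends S0c.
have [E [i iE]] := subfield_embedding (span_subfield Sc).
pose P : set E := [set a | S (i a)]%classic.
have PO : field_ordering P.
  split.
  - by move=> a b; rewrite /P /= rmorphD; exact: coneD.
  - by move=> a b; rewrite /P /= rmorphM; exact: coneM.
  - move=> a; rewrite /P /= rmorphN => h1 h2; apply/eqP; rewrite -(fmorph_eq0 i).
    by apply/eqP; exact: (cone_anti Sc).
  - move=> a; rewrite /P /= rmorphN; apply: (cone_total Sc maxS).
    by apply/iE; exists a.
have [E0 [u [v [uK vK upos]]]] := ordered_realField PO.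
have vB : zmod_morphism v.
  by move=> a b; apply: (can_inj uK); rewrite rmorphB !vK.
have vM : monoid_morphism v.
  by split=> [|a b]; apply: (can_inj uK); rewrite ?rmorph1 ?rmorphM !vK.
pose vr : {rmorphism E0 -> E} :=
  HB.pack v (GRing.isZmodMorphism.Build E0 E v vB)
    (GRing.isMonoidMorphism.Build E0 E v vM).
pose j : {rmorphism E0 -> F} := i \o vr.
have jE x : S x <-> exists2 a, 0 <= a & x = j a.
  split=> [Sx|[a a0 ->]]; last by apply/(upos (v a)); rewrite vK.
  have /iE[b bE] := span_cone Sc Sx.
  exists (u b); last by rewrite /= uK.
  by apply/upos; rewrite /P /= -bE.
have [L [w [w' [wK w'K wpos]]]] := real_field_ivt_rcf (cone_ivt Sc maxS jE).
have ex a : exists b, f a = i b.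
  apply/iE; case: (Qtot a) => Qa; first by apply: (span_cone Sc); apply: S0S; exists a.
  exists 0, (f (- a)); rewrite rmorphN sub0r opprK; split=> //; first exact: cone0.
  by apply: S0S; exists (- a); rewrite ?rmorphN.
have [g gE] := choice ex.
have gB : zmod_morphism g.
  by move=> a b; apply: (fmorph_inj i); rewrite rmorphB -!gE rmorphB.
have gM : monoid_morphism g.
  by split=> [|a b]; apply: (fmorph_inj i); rewrite ?rmorph1 ?rmorphM -!gE ?rmorph1 ?rmorphM.
pose gr : {rmorphism K -> E} :=
  HB.pack g (GRing.isZmodMorphism.Build K E g gB)
    (GRing.isMonoidMorphism.Build K E g gM).
exists L, (w \o (u \o gr)) => a /=; rewrite wpos -upos /P /= -gE.
split=> [Qa|Sfa]; first by apply: S0S; exists a.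
case: (Qtot a) => // QNa; suff -> : a = 0 by [].
apply/eqP; rewrite -(fmorph_eq0 f); apply/eqP; apply: (cone_anti Sc) => //.
by rewrite -rmorphN; apply: S0S; exists (- a).
Qed.

(** * Real closed extensions of finitely generated subfields *)

Section FinitelyGenerated.
Variables (K : fieldType) (N : nat) (x : 'I_N -> K).

(** Terms for the subfield generated by [x]: a binary node 0 is a difference, any other binary node
    a quotient, and ill-formed trees stand for 1. The subfield is countable because trees are. *)
Fixpoint eval_tree (t : GenTree.tree nat) : K :=
  match t with
  | GenTree.Leaf k => if insub k is Some n then x n else 1
  | GenTree.Node 0 [:: a; b] => eval_tree a - eval_tree b
  | GenTree.Node _ [:: a; b] => eval_tree a / eval_tree b
  | _ => 1
  end.

Lemma countable_subfield : exists (E : countFieldType) (v : {rmorphism E -> K}),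
  forall n, exists a, x n = v a.
Proof.
have sf : subfield_set [set y | exists t, y = eval_tree t]%classic.
  split; first by exists (GenTree.Node 0 [::]).
    by move=> _ _ [a ->] [b ->]; exists (GenTree.Node 0 [:: a; b]).
  by move=> _ _ [a ->] [b ->]; exists (GenTree.Node 1 [:: a; b]).
have [E [i iE]] := subfield_embedding sf.
have ex a : exists t, i a = eval_tree t by apply/iE; exists a.
have [h hE] := choice ex.
have [h' h'K] : exists h', pcancel h h'.
  have H t : exists o, forall a, t = h a -> o = Some a.
    have [[a ta]|na] := pselect (exists a, t = h a); last by exists None => a ta; case: na; exists a.
    exists (Some a) => b; rewrite ta => hab; congr Some; apply: (fmorph_inj i).
    by rewrite !hE hab.
  have [h' h'E] := choice H.
  by exists h' => a; exact: h'E.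
pose E' : countFieldType := HB.pack (E : Type) (GRing.Field.on E) (PCanIsCountable h'K).
exists E', (i : {rmorphism E -> K}) => n.
have /iE[a aE] : exists t, x n = eval_tree t.
  by exists (GenTree.Leaf (n : nat)) => /=; rewrite valK.
by exists a.
Qed.

End FinitelyGenerated.

(* E is countable, so that countable_algebraic_closure applies to it. *)
Theorem finite_real_closure (K : fieldType) (Q : set K) (N : nat) (x : 'I_N -> K) :
  field_ordering Q ->
  exists (E : fieldType) (v : {rmorphism E -> K}) (L : rcfType) (i : {rmorphism E -> L}),
    (forall n, exists a, x n = v a) /\ (forall a, Q (v a) <-> 0 <= i a).
Proof.
move=> [QD QM Qanti Qtot].
have [E [v vx]] := countable_subfield x.
have [F [f _]] := countable_algebraic_closure E.
pose P : set E := [set a | Q (v a)]%classic.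
have PO : field_ordering P.
  split.
  - by move=> a b; rewrite /P /= rmorphD; exact: QD.
  - by move=> a b; rewrite /P /= rmorphM; exact: QM.
  - move=> a; rewrite /P /= rmorphN => h1 h2; apply/eqP; rewrite -(fmorph_eq0 v).
    by apply/eqP; exact: Qanti.
  - by move=> a; rewrite /P /= rmorphN; exact: Qtot.
have [L [i iP]] := real_closure_in_closed f PO.
by exists E, v, L, i.
Qed.

(** * Sums of powers and the Artin-Lang theorem *)

Section SumsOfPowers.
Variables (K : fieldType) (m : nat).
Hypothesis m_gt0 : (0 < m)%N.
Local Notation sop := (@sum_of_powers K m).

Lemma sop0 : sop 0.
Proof. by exists [::]; rewrite big_nil. Qed.

Lemma sopX x : sop (x ^+ m).
Proof. by exists [:: x]; rewrite big_seq1. Qed.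

Lemma sop1 : sop 1.
Proof. by rewrite -(expr1n _ m); exact: sopX. Qed.

Lemma sopD x y : sop x -> sop y -> sop (x + y).
Proof. by move=> [s ->] [t ->]; exists (s ++ t); rewrite big_cat. Qed.

Lemma sopM x y : sop x -> sop y -> sop (x * y).
Proof.
move=> [s ->] [t ->]; exists [seq a * b | a <- s, b <- t].
elim: s => [|a s IH]; first by rewrite !big_nil mul0r.
rewrite big_cons mulrDl IH /= big_cat big_map mulr_sumr; congr (_ + _).
by apply: eq_bigr => b _; rewrite exprMn.
Qed.

Lemma sop_sum (I : Type) (s : seq I) (P : pred I) (F : I -> K) :
  (forall i, P i -> sop (F i)) -> sop (\sum_(i <- s | P i) F i).
Proof. by move=> H; apply: big_ind; [exact: sop0|exact: sopD|]. Qed.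

Lemma sopXn x n : sop x -> sop (x ^+ n).
Proof.
move=> Sx; elim: n => [|n IH]; first by rewrite expr0; exact: sop1.
by rewrite exprS; exact: sopM.
Qed.

Lemma sopV x : sop x -> sop x^-1.
Proof.
move=> Sx; have [->|x0] := eqVneq x 0; first by rewrite invr0; exact: sop0.
have -> : x^-1 = x ^+ m.-1 * x^-1 ^+ m.
  rewrite -[in RHS](prednK m_gt0) exprS mulrCA -exprMn mulfV // expr1n mulr1 //.
by apply: sopM; [exact: sopXn|exact: sopX].
Qed.

Lemma sop_div x y : sop x -> sop y -> sop (x / y).
Proof. by move=> Sx /sopV; exact: sopM. Qed.

Lemma sop_nat n : sop n%:R.
Proof.
elim: n => [|n IH]; first exact: sop0.
by rewrite -natr1; apply: sopD => //; exact: sop1.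
Qed.
End SumsOfPowers.

Section SumsOfSquares.
Variable K : fieldType.
Local Notation sos := (@sum_of_powers K 2).

Lemma sos_nonreal : (2 : K) != 0 -> sos (-1) -> forall x, sos x.
Proof.
move=> h N1 x.
have -> : x = ((x + 1) / 2) ^+ 2 + (-1) * ((x - 1) / 2) ^+ 2 by field.
by apply: sopD; [exact: sopX|apply: sopM => //; exact: sopX].
Qed.

(** As [h] is not a sum of squares, -h can be adjoined to the cone of sums of squares. Every element
    is a difference of two squares, so a maximal cone above it orders all of [K]. *)
Lemma sos_ordering (h : K) : (2 : K) != 0 -> ~ sos h ->
  exists Q : set K, [/\ field_ordering Q, forall x, sos x -> Q x & Q (- h)].
Proof.
move=> c2 nh.
have Sc : subfield_cone [set x | sos x]%classic.
  split=> /=.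
  - exact: sop0.
  - exact: sop1.
  - by move=> a b; exact: sopD.
  - by move=> a b; exact: sopM.
  - by move=> a; exact: sopV.
  - by move=> a b _ _; exact: sopX.
  - by move=> N1; apply: nh; exact: sos_nonreal.
have sp x : cone_span [set x | sos x]%classic x.
  by rewrite [x](halves Sc); exists (((x + 1) / 2) ^+ 2), (((x - 1) / 2) ^+ 2);
    split=> //; exact: sopX.
have [S [S1c S1S maxS]] := cone_extends (cone_adjoin Sc (sp h) nh).
have SQ x : sos x -> S x.
  move=> Sx; apply: S1S; exists x, 0; rewrite mul0r subr0; split=> //; exact: sop0.
exists S; split=> //; last first.
  by apply: S1S; exists 0, 1; rewrite mul1r sub0r; split=> //=; [exact: sop0|exact: sop1].
split.
- exact: coneD.
- exact: coneM.
- exact: cone_anti.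
- move=> a; apply: (cone_total S1c maxS).
  have [b [c [Sb Sc' ->]]] := sp a.
  by exists b, c; split=> //; exact: SQ.
Qed.
End SumsOfSquares.

Lemma mmap_map_mpoly (k k' : comNzRingType) (S : comNzRingType) (N : nat)
   (f : {rmorphism k' -> S}) (g : {rmorphism k -> k'}) (z : 'I_N -> S) (q : {mpoly k[N]}) :
  mmap f z (map_mpoly g q) = mmap (f \o g) z q.
Proof.
rewrite {1}[q]mpolyE (raddf_sum (map_mpoly g)) /= (raddf_sum (mmap f z)) /= [RHS]/mmap; apply: eq_bigr => m _.
by rewrite map_mpolyZ mmapZ map_mpolyX mmapX.
Qed.

Lemma mpoly_in_range (k k' : comNzRingType) (g : {rmorphism k -> k'}) (N : nat)
    (p : {mpoly k'[N]}) :
  (forall m, m \in msupp p -> exists c, p@_m = g c) -> exists q, p = map_mpoly g q.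
Proof.
move=> H; have H' m : exists c, m \in msupp p -> p@_m = g c.
  have [mp|mp] := boolP (m \in msupp p); last by exists 0.
  by have [c cE] := H m mp; exists c.
have [c cE] := choice H'.
exists (\sum_(m <- msupp p) c m *: 'X_[m]).
rewrite (raddf_sum (map_mpoly g)) {1}[p]mpolyE; apply: eq_big_seq => m mp.
by rewrite /= map_mpolyZ map_mpolyX -cE.
Qed.

(* Artin-Lang: the ordering making h negative is transferred to R through a real
   closure of the countable subfield generated by the finitely many data. *)
Theorem artin_lang (R : rcfType) (K : fieldType) (iota : {rmorphism R -> K}) (N : nat)
    (z : 'I_N -> K) (ps : seq {mpoly R[N]}) (h : {mpoly R[N]}) :
  (forall p, p \in ps -> mmap iota z p = 0) ->
  ~ sum_of_powers 2 (mmap iota z h) ->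
  exists y : 'I_N -> R, (forall p, p \in ps -> p.@[y] = 0) /\ h.@[y] < 0.
Proof.
move=> ps0 nh.
have c2 : (2 : K) != 0 by rewrite -(rmorph_nat iota) fmorph_eq0 pnatr_eq0.
have [Q [QO Qsos Qh]] := sos_ordering c2 nh.
pose gens : seq K := codom z ++
  flatten [seq [seq iota p@_m | m <- msupp p] | p : {mpoly R[N]} <- h :: ps].
have [E [v [L [i [vgens Qi]]]]] := finite_real_closure (tnth (in_tuple gens)) QO.
have vz n : exists a, z n = v a.
  have zg : z n \in gens by rewrite mem_cat codom_f.
  have [j jE] : exists j, z n = tnth (in_tuple gens) j by apply/tnthP.
  by rewrite jE; exact: vgens.
have vc p m : p \in h :: ps -> m \in msupp p -> exists a, iota p@_m = v a.
  move=> pp mp; have cg : iota p@_m \in gens.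
    by rewrite mem_cat; apply/orP; right; apply/flatten_mapP; exists p => //; exact: map_f.
  have [j jE] : exists j, iota p@_m = tnth (in_tuple gens) j by apply/tnthP.
  by rewrite jE; exact: vgens.
(* The transfer needs one field of constants mapping both to [L] and to [R]. Since only [E] maps to
   [L], these are the elements of [R] whose image in [K] comes from [E]. *)
have sfk : subfield_set [set c | exists a, iota c = v a]%classic.
  split; first by exists 1; rewrite !rmorph1.
    by move=> x y [a ax] [b bx]; exists (a - b); rewrite !rmorphB ax bx.
  by move=> x y [a ax] [b bx]; exists (a / b); rewrite !fmorph_div ax bx.
have [k [j jE]] := subfield_embedding sfk.
have ex c : exists a, iota (j c) = v a by apply/jE; exists c.
have [e eE] := choice ex.
have eB : zmod_morphism e.
  by move=> a b; apply: (fmorph_inj v); rewrite rmorphB -!eE !rmorphB.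
have eM : monoid_morphism e.
  by split=> [|a b]; apply: (fmorph_inj v); rewrite ?rmorph1 ?rmorphM -!eE ?rmorph1 ?rmorphM.
pose er : {rmorphism k -> E} :=
  HB.pack e (GRing.isZmodMorphism.Build k E e eB)
    (GRing.isMonoidMorphism.Build k E e eM).
(* Nonnegative elements of [R] are squares, so [Q] extends the order of [R]. *)
have Qiota c : 0 <= c -> Q (iota c).
  move=> c0; apply: Qsos; rewrite -(sqr_sqrtr c0) rmorphXn; exact: sopX.
have pos0 c : 0 <= j c -> 0 <= i (er c).
  by move=> c0; apply/Qi; rewrite -eE; exact: Qiota.
have pos c : (0 < (i \o er) c) = (0 < j c).
  rewrite /= !lt_def !fmorph_eq0; congr andb.
    by rewrite -(fmorph_eq0 v) -eE !fmorph_eq0.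
  apply/idP/idP => [h1|]; last exact: pos0.
  rewrite leNgt; apply/negP => jc.
  have : 0 <= i (er (- c)) by apply: pos0; rewrite rmorphN oppr_ge0 ltW.
  rewrite rmorphN rmorphN oppr_ge0 => h2.
  have /eqP : i (er c) = 0 by apply/eqP; rewrite eq_le h1 h2.
  rewrite fmorph_eq0 -(fmorph_eq0 v) -eE fmorph_eq0 => /eqP j0.
  by rewrite j0 ltxx in jc.
have lift p : p \in h :: ps -> exists q, p = map_mpoly j q.
  by move=> pp; apply: mpoly_in_range => m mp; apply/jE; exact: vc pp mp.
have [zE zEE] := choice vz.
have lift' p : exists q, p \in h :: ps -> p = map_mpoly j q.
  have [pp|pp] := boolP (p \in h :: ps); last by exists 0.
  by have [q qE] := lift p pp; exists q.
have [l lE] := choice lift'.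
have [y yE] := rcf_transfer [seq l p | p <- h :: ps] (i \o zE) pos.
have key p : p \in h :: ps -> sgz p.@[y] = sgz (i (mmap er zE (l p))) /\
    v (mmap er zE (l p)) = mmap iota z p.
  move=> pp; split.
    rewrite -rmorph_mmap yE ?map_f //; congr sgz.
    rewrite {1}(lE p pp) /meval mmap_map_mpoly.
    by rewrite /mmap; apply: eq_bigr.
  rewrite -rmorph_mmap [in RHS](lE p pp) mmap_map_mpoly /mmap.
  apply: eq_bigr => m _ /=; rewrite eE; congr (_ * _).
  by rewrite /mmap1; apply: eq_bigr => n _ /=; rewrite zEE.
exists y; split=> [p pp|].
  have pp' : p \in h :: ps by rewrite inE pp orbT.
  have [h1 h2] := key p pp'; move: h2; rewrite ps0 // => /eqP; rewrite fmorph_eq0 => /eqP h2.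
  by move: h1; rewrite h2 rmorph0 sgz0 => /eqP; rewrite sgz_eq0 => /eqP.
have [h1 h2] := key h (mem_head _ _).
have : 0 <= i (mmap er zE (l h)) -> False.
  move=> /Qi; rewrite h2 => Qh'.
  case: QO => _ _ Qanti _; have h0 := Qanti _ Qh' Qh.
  by apply: nh; rewrite h0; exact: sop0.
move/negP; rewrite -ltNge => /ltr0_sgz h3.
by rewrite -sgz_lt0 h1 h3.
Qed.

(** * Newton's method *)

Lemma mpoly_ring_ind (R : comNzRingType) N (P : {mpoly R[N]} -> Prop) :
  (forall c, P c%:MP) -> (forall i, P 'X_i) ->
  (forall p q, P p -> P q -> P (p + q)) -> (forall p q, P p -> P q -> P (p * q)) ->
  forall p, P p.
Proof.
move=> Pc PX PD PM; elim/mpolyind => [|c m p _ _ Pp]; first by rewrite -mpolyC0.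
apply: (PD) => //; rewrite -mul_mpolyC; apply: (PM) => //.
rewrite mpolyXE_id; apply: (big_ind P) => [||i _]; [by rewrite -mpolyC1|exact: PM|].
by elim: (m i) => [|k IH]; [rewrite expr0 -mpolyC1|rewrite exprS; exact: PM].
Qed.

Lemma eq_mmap (R S : nzRingType) N (f f' : R -> S) (x x' : 'I_N -> S) (p : {mpoly R[N]}) :
  f =1 f' -> x =1 x' -> mmap f x p = mmap f' x' p.
Proof.
by move=> ff xx; rewrite /mmap; apply: eq_bigr => m _; rewrite ff (mmap1_eq _ xx).
Qed.

Lemma mmap_mmap (R S T : comNzRingType) N N' (f : {rmorphism R -> S})
    (g : {rmorphism S -> T}) (x : 'I_N -> {mpoly S[N']}) (y : 'I_N' -> T) (p : {mpoly R[N]}) :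
  mmap g y (mmap ((@mpolyC N' S) \o f) x p) =
  mmap (g \o f) (fun n => mmap g y (x n)) p.
Proof.
elim/mpoly_ring_ind: p => [c|i|p q Ep Eq|p q Ep Eq].
- by rewrite !mmapC.
- by rewrite !mmapX !mmap1U.
- by rewrite !mmapD Ep Eq.
- by rewrite !rmorphM /= Ep Eq.
Qed.

Definition pairv (T : Type) N (y h : 'I_N -> T) (k : 'I_(N + N)) : T :=
  match split k with inl a => y a | inr b => h b end.

Lemma pairv_l T N (y h : 'I_N -> T) a : pairv y h (lshift N a) = y a.
Proof. by rewrite /pairv -[lshift N a]/(unsplit (inl a)) unsplitK. Qed.
Lemma pairv_r T N (y h : 'I_N -> T) a : pairv y h (rshift N a) = h a.
Proof. by rewrite /pairv -[rshift N a]/(unsplit (inr a)) unsplitK. Qed.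

(** The difference quotients of a polynomial are polynomials in the point and the increment, by
    induction over sums and products. The identity holds over every [S] because it is used both for
    real points and for polynomial arcs. *)
Lemma hadamard (R : comNzRingType) N (g : {mpoly R[N]}) :
  exists D : 'I_N -> {mpoly R[N + N]},
    (forall (S : comNzRingType) (f : {rmorphism R -> S}) (y h : 'I_N -> S),
      mmap f (fun n => y n + h n) g - mmap f y g =
      \sum_n h n * mmap f (pairv y h) (D n)) /\
    (forall n (y : 'I_N -> R), (D n).@[pairv y (fun=> 0)] = (g^`M(n)).@[y]).
Proof.
elim/mpoly_ring_ind: g => [c|i|p q|p q].
- exists (fun=> 0); split=> [S f y h|n y]; last by rewrite mderivC !meval0.
  by rewrite !mmapC subrr big1 // => n _ /=; rewrite rmorph0 mulr0.
- exists (fun n => (n == i)%:R); split=> [S f y h|n y].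
    rewrite !mmapX !mmap1U addrC addKr (bigD1 i) //= eqxx rmorph1 mulr1 big1 ?addr0 //.
    by move=> n /negPf ->; rewrite rmorph0 mulr0.
  rewrite mderivX mnm1E (eq_sym i n); case: (eqVneq n i) => [->|_]; last by rewrite scale0r !meval0.
  have -> : (U_(i) - U_(i) = 0)%MM by apply/mnmP => j; rewrite mnmBE subnn mnm0E.
  by rewrite mpolyX0 scale1r !rmorph1.
- move=> [D [D1 D2]] [D' [D'1 D'2]]; exists (fun n => D n + D' n); split=> [S f y h|n y].
    rewrite !mmapD opprD addrACA D1 D'1 -big_split; apply: eq_bigr => n _.
    by rewrite mmapD mulrDr.
  by rewrite mderivD !mevalD D2 D'2.
- move=> [D [D1 D2]] [D' [D'1 D'2]].
  (* [sh u] is u(y + h) and [st u] is u(y), as polynomials in the pair (y, h). *)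
  pose sh (u : {mpoly R[N]}) : {mpoly R[N + N]} :=
    mmap (@mpolyC (N + N) R \o idfun) (fun n => 'X_(lshift N n) + 'X_(rshift N n)) u.
  pose st (u : {mpoly R[N]}) : {mpoly R[N + N]} :=
    mmap (@mpolyC (N + N) R \o idfun) (fun n => 'X_(lshift N n)) u.
  have shE (S : comNzRingType) (f : {rmorphism R -> S}) (y h : 'I_N -> S) u :
      mmap f (pairv y h) (sh u) = mmap f (fun n => y n + h n) u.
    rewrite mmap_mmap; apply: eq_mmap => n //.
    by rewrite mmapD !mmapX !mmap1U pairv_l pairv_r.
  have stE (S : comNzRingType) (f : {rmorphism R -> S}) (y h : 'I_N -> S) u :
      mmap f (pairv y h) (st u) = mmap f y u.
    rewrite mmap_mmap; apply: eq_mmap => n //.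
    by rewrite !mmapX !mmap1U pairv_l.
  exists (fun n => sh p * D' n + D n * st q); split=> [S f y h|n y].
    rewrite !rmorphM /=.
    have -> : forall a b a' b' : S, a * b - a' * b' = a * (b - b') + (a - a') * b'.
      by move=> *; ring.
    rewrite D1 D'1 mulr_sumr mulr_suml -big_split; apply: eq_bigr => n _.
    by rewrite /= mmapD !rmorphM /= shE stE; ring.
  rewrite mderivM !mevalD !mevalM D2 D'2 /meval shE stE addrC; congr (_ * _ + _ * _).
  by apply: eq_mmap => k //; rewrite addr0.
Qed.

(** * Bounds for polynomial functions and limits along ultrafilters *)

Section Bounds.
Variables (R : realFieldType) (N : nat).
Implicit Types (p q : {mpoly R[N]}) (y z : 'I_N -> R).

Lemma meval_bound B p : exists2 C, 0 <= C &
  forall y, (forall n, `|y n| <= B) -> `|p.@[y]| <= C.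
Proof.
elim/mpoly_ring_ind: p => [c|i|p q [C C0 HC] [D D0 HD]|p q [C C0 HC] [D D0 HD]].
- by exists `|c| => // y _; rewrite mevalC.
- exists `|B| => // y yB; rewrite mevalXU; exact: le_trans (yB i) (ler_norm _).
- exists (C + D); rewrite ?addr_ge0 // => y yB; rewrite mevalD.
  by apply: le_trans (ler_normD _ _) _; rewrite lerD ?HC ?HD.
- exists (C * D); rewrite ?mulr_ge0 // => y yB.
  by rewrite mevalM normrM ler_pM ?HC ?HD.
Qed.

Lemma meval_lipschitz B p : exists2 C, 0 <= C &
  forall y z d, (forall n, `|y n| <= B) -> (forall n, `|z n| <= B) ->
    (forall n, `|y n - z n| <= d) -> 0 <= d -> `|p.@[y] - p.@[z]| <= C * d.
Proof.
elim/mpoly_ring_ind: p => [c|i|p q [C C0 HC] [D D0 HD]|p q [C C0 HC] [D D0 HD]].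
- by exists 0 => // y z d _ _ _ _; rewrite !mevalC subrr normr0 mul0r.
- by exists 1 => // y z d _ _ H _; rewrite !mevalXU mul1r.
- exists (C + D); rewrite ?addr_ge0 // => y z d yB zB yz d0.
  rewrite !mevalD opprD addrACA mulrDl.
  by apply: le_trans (ler_normD _ _) _; rewrite lerD ?HC ?HD.
- have [Bp Bp0 HBp] := meval_bound B p; have [Bq Bq0 HBq] := meval_bound B q.
  exists (C * Bq + Bp * D); rewrite ?addr_ge0 ?mulr_ge0 // => y z d yB zB yz d0.
  rewrite !mevalM.
  have -> : p.@[y] * q.@[y] - p.@[z] * q.@[z] =
    (p.@[y] - p.@[z]) * q.@[y] + p.@[z] * (q.@[y] - q.@[z]) by ring.
  apply: le_trans (ler_normD _ _) _; rewrite [leRHS]mulrDl !normrM lerD //.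
    by rewrite mulrAC ler_pM // ?HC // HBq.
  by rewrite -mulrA ler_pM // ?HBp // HD.
Qed.

Lemma meval_continuous p y e : 0 < e -> exists2 d, 0 < d &
  forall z, (forall n, `|z n - y n| <= d) -> `|p.@[z] - p.@[y]| <= e.
Proof.
move=> e0; pose B := 1 + \sum_n `|y n|.
have yB n : `|y n| <= B - 1.
  by rewrite addrAC subrr add0r (bigD1 n) //= lerDl sumr_ge0.
have [C C0 HC] := meval_lipschitz B p.
have C1 : 0 < C + 1 by rewrite ltr_wpDl.
pose d := Num.min 1 (e / (C + 1)).
have d0 : 0 < d by rewrite lt_min ltr01 divr_gt0.
exists d => // z zy; have zy' n : `|z n - y n| <= d by exact: zy.
apply: le_trans (_ : C * d <= e).
  apply: HC => // [n|n|]; last exact: ltW.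
    rewrite -[z n](subrK (y n)); apply: le_trans (ler_normD _ _) _.
    rewrite -[B](subrK 1) addrC lerD ?yB //; apply: le_trans (zy n) _.
    by rewrite ge_min lexx.
  by apply: le_trans (yB n) _; rewrite lerBlDr lerDl.
apply: le_trans (_ : (C + 1) * d <= e).
  by rewrite ler_wpM2r ?lerDl // ltW.
by rewrite mulrC -ler_pdivlMr // ge_min lexx orbT.
Qed.
End Bounds.

(** The limit is the supremum of the a with a <= x_j for almost all j. Limits along an ultrafilter
    take the place of convergent subsequences. *)
Lemma ultra_lim (R : realType) J (U : set_system J) (x : J -> R) B :
  UltraFilter U -> (forall j, `|x j| <= B) ->
  exists l, forall e, 0 < e -> U [set j | `|x j - l| <= e]%classic.
Proof.
move=> UU xB.
pose S : set R := [set a | U [set j | a <= x j]]%classic.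
have SB : S (- B).
  by apply: filterS filterT => j _ /=; have := xB j; rewrite ler_norml => /andP[].
have Sub : ubound S B.
  move=> a Sa; have [j /= aj] := filter_ex Sa.
  by apply: le_trans aj _; have := xB j; rewrite ler_norml => /andP[].
have hS : has_sup S by split; [exists (- B)|exists B].
exists (sup S) => e e0.
have [a Sa ale] := sup_adherent e0 hS.
have nS : ~ S (sup S + e).
  by move=> /(ub_le_sup hS.2); rewrite gerDl leNgt e0.
have [//|h] := in_ultra_setVsetC [set j | sup S + e <= x j]%classic UU.
apply: filterS2 Sa h => j /= aj /negP; rewrite -ltNge => je.
rewrite ler_norml lerBlDl lerBrDr (ltW je) andbT addrC.
exact: le_trans (ltW ale) aj.
Qed.

Lemma ultra_lim_vec (R : realType) J (U : set_system J) N (x : J -> 'I_N -> R) B :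
  UltraFilter U -> (forall j n, `|x j n| <= B) ->
  exists l : 'I_N -> R, forall e, 0 < e ->
    U [set j | forall n, `|x j n - l n| <= e]%classic.
Proof.
move=> UU xB; have [l lE] := choice (fun n => ultra_lim UU (fun j => xB j n)).
exists l => e e0.
apply: (@filterS _ _ _ [set j | forall n, n \in index_enum 'I_N ->
   `|x j n - l n| <= e]%classic) => [j H n|]; first exact: H (mem_index_enum n).
by apply: filter_all => n _; exact: lE.
Qed.

(** An index is a finite list with a number, both eventually as large as wanted. With [T] the type
    of polynomials, a limit of points can satisfy infinitely many equations; with [T] = unit the
    families are in effect sequences. *)
Lemma tail_ultrafilter (T : eqType) : exists U : set_system (seq T * nat),
  UltraFilter U /\
  forall (s : seq T) (n : nat), U [set j : seq T * nat | {subset s <= j.1} /\ (n <= j.2)%N]%classic.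
Proof.
pose B (i : seq T * nat) := [set j : seq T * nat | {subset i.1 <= j.1} /\ (i.2 <= j.2)%N]%classic.
have FF : Filter (filter_from setT B).
  apply: filter_from_filter; first by exists ([::], 0%N).
  move=> [s n] [t m] _ _; exists (s ++ t, maxn n m) => // -[u k] [/= su nu].
  split; split=> /=.
  - by move=> x xs; apply: su; rewrite mem_cat xs.
  - exact: leq_trans (leq_maxl _ _) nu.
  - by move=> x xs; apply: su; rewrite mem_cat xs orbT.
  - exact: leq_trans (leq_maxr _ _) nu.
have PF : ProperFilter (filter_from setT B).
  by apply: filter_from_proper => // i _; exists i; split.
have [U [UU BU]] := ultraFilterLemma PF.
by exists U; split=> // s n; apply: BU; exists (s, n).
Qed.

Lemma small_inv (R : realType) (e : R) : 0 < e -> exists n : nat, (n.+1%:R)^-1 < e.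
Proof.
move=> e0; exists (Num.truncn e^-1).
rewrite invf_plt ?posrE ?ltr0n //.
by have := truncnS_gt e^-1.
Qed.

(** * Implicit functions near a regular zero *)

Section FixedPoint.
Variables (R : realType) (N c : nat) (g : 'I_c -> {mpoly R[N]}) (s : 'I_c -> 'I_N).
Variable (D : 'I_c -> 'I_N -> {mpoly R[N + N]}).
Hypothesis D1 : forall l (S : comNzRingType) (f : {rmorphism R -> S}) (y h : 'I_N -> S),
      mmap f (fun n => y n + h n) (g l) - mmap f y (g l) =
      \sum_n h n * mmap f (pairv y h) (D l n).
Hypothesis D2 : forall l n (y : 'I_N -> R),
  (D l n).@[pairv y (fun=> 0)] = ((g l)^`M(n)).@[y].

(** The increment [h] placed in the coordinates [s]; values sent to the same coordinate are
    added. *)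
Definition embv (S : nmodType) (h : 'I_c -> S) (n : 'I_N) : S :=
  \sum_m h m *+ (n == s m).

Definition jac (y : 'I_N -> R) : 'M[R]_c := \matrix_(l, m) ((g l)^`M(s m)).@[y].

Definition slope (S : comNzRingType) (f : {rmorphism R -> S}) (y : 'I_N -> S)
    (h : 'I_c -> S) : 'M[S]_c :=
  \matrix_(l, m) mmap f (pairv y (embv h)) (D l (s m)).

Definition gval (S : comNzRingType) (f : {rmorphism R -> S}) (y : 'I_N -> S) : 'cV[S]_c :=
  \col_l mmap f y (g l).

Lemma embv0 (S : nmodType) n : embv (fun=> 0 : S) n = 0.
Proof. by rewrite /embv big1 // => m _; rewrite mul0rn. Qed.

Lemma embvB (S : zmodType) (h h' : 'I_c -> S) n :
  embv (fun m => h m - h' m) n = embv h n - embv h' n.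
Proof. by rewrite /embv -sumrB; apply: eq_bigr => m _; rewrite mulrnBl. Qed.

Lemma slopeP (S : comNzRingType) (f : {rmorphism R -> S}) (y : 'I_N -> S) (h h' : 'I_c -> S) :
  gval f (fun n => y n + embv h' n) - gval f (fun n => y n + embv h n) =
  slope f (fun n => y n + embv h n) (fun m => h' m - h m) *m \col_m (h' m - h m).
Proof.
apply/colP => l; rewrite !mxE.
have := D1 l f (fun n => y n + embv h n) (embv (fun m => h' m - h m)).
have E : (fun n => y n + embv h n + embv (fun m => h' m - h m) n) =1
    (fun n => y n + embv h' n) by move=> n; rewrite embvB addrA addrAC addrK.
rewrite (eq_mmap _ (fun=> erefl) E) => ->.
rewrite /embv; under eq_bigr do rewrite mulr_suml.
rewrite exchange_big; apply: eq_bigr => m _; rewrite !mxE (bigD1 (s m)) //= eqxx mulr1n.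
rewrite big1 => [|n /negPf ->]; last by rewrite mulr0n mul0r.
by rewrite addr0; exact: mulrC.
Qed.

Lemma slope_jac y : slope idfun y (fun=> 0) = jac y.
Proof.
apply/matrixP => l m; rewrite !mxE -D2; apply: eq_mmap => // k.
rewrite /pairv; case: split => // a; exact: embv0.
Qed.

Variable v : 'I_N -> R.
Hypothesis jv : jac v \in unitmx.

Definition cball r (h : 'I_c -> R) := forall m, `|h m| <= r.
Definition nball r (y : 'I_N -> R) := forall n, `|y n - v n| <= r.

Lemma embv_bound r (h : 'I_c -> R) : cball r h -> forall n, `|embv h n| <= c%:R * r.
Proof.
move=> hr n; apply: le_trans (ler_norm_sum _ _ _) _.
apply: le_trans (_ : \sum_(m < c) r <= _); last by rewrite sumr_const card_ord mulr_natl.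
apply: ler_sum => m _; case: (n == s m); rewrite ?mulr1n ?mulr0n ?normr0 //.
exact: le_trans (normr_ge0 (h m)) _.
Qed.

Lemma slope_near e : 0 < e -> exists2 r, 0 < r & forall y h, nball r y -> cball r h ->
  forall l m, `|slope idfun y h l m - jac v l m| <= e.
Proof.
move=> e0.
have H (lm : 'I_c * 'I_c) : exists2 r, 0 < r & forall y h, nball r y -> cball r h ->
    `|slope idfun y h lm.1 lm.2 - jac v lm.1 lm.2| <= e.
  case: lm => l m /=.
  have [d d0 dH] := meval_continuous (D l (s m)) (pairv v (fun=> 0)) e0.
  (* With [c.+1] both r and c r are at most d, also when c = 0. *)
  pose r := d / (c.+1)%:R.
  have r0 : 0 < r by rewrite divr_gt0 // ltr0n.
  have rd : c%:R * r <= d.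
    by rewrite mulrCA ger_pMr // ler_pdivrMr ?ltr0n // mul1r ler_nat.
  have rd' : r <= d by rewrite ler_pdivrMr ?ltr0n // ler_pMr // ler1n.
  exists r => // y h yr hr; rewrite !mxE -D2.
  apply: dH => k; rewrite /pairv; case: split => a.
    exact: le_trans (yr a) rd'.
  by rewrite subr0; exact: le_trans (embv_bound hr a) rd.
have [rf rfP] := choice (fun lm => let: ex_intro2 r a b := H lm in ex_intro _ r (conj a b)).
pose r := \big[Num.min/1]_(lm : 'I_c * 'I_c) rf lm.
exists r.
  rewrite /r; apply: (big_ind (fun x => 0 < x)) => //.
    by move=> a b a0 b0; rewrite lt_min a0.
  by move=> lm _; case: (rfP lm).
move=> y h yr hr l m; have [_ K] := rfP (l, m).
have rle : r <= rf (l, m) by rewrite /r; apply: bigmin_le_cond.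
by apply: K => k; [exact: le_trans (yr k) rle|exact: le_trans (hr k) rle].
Qed.

(* Newton's map h - J^-1 (G (y + h)) is a contraction of ratio 1/2 near (v, 0). *)
Lemma newton_contracts : exists2 r, 0 < r & forall y h h', nball r y -> cball r h ->
  cball r h' -> forall d, 0 <= d -> (forall m, `|h' m - h m| <= d) ->
  forall m, `|(h' m - h m) - (invmx (jac v) *m
    (gval idfun (fun n => y n + embv h' n) - gval idfun (fun n => y n + embv h n))) m 0|
    <= d / 2.
Proof.
pose K := 1 + \sum_a \sum_b `|invmx (jac v) a b|.
have K0 : 0 < K by rewrite ltr_wpDr // sumr_ge0 // => a _; rewrite sumr_ge0.
have KP a b : `|invmx (jac v) a b| <= K.
  rewrite /K (bigD1 a) //= (bigD1 b) //=; apply: ler_wpDl => //; apply: ler_wpDr.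
    by apply: sumr_ge0 => a' _; exact: sumr_ge0.
  by apply: ler_wpDr => //; exact: sumr_ge0.

(* The entries of J^-1 are at most K and those of J - M at most e, so the error is at most c^2 K e d
   <= d / 2; [c.+1] avoids a division by zero. *)
pose e := (2 * c.+1%:R * c.+1%:R * K)^-1.
have e0 : 0 < e by rewrite invr_gt0 !mulr_gt0 // ltr0n.
have [r r0 rP] := slope_near e0.
(* Small enough to keep both the point y + h within r of [v] and the increment h' - h within r of
   0. *)
pose r' := r / (2 * c.+1%:R).
have r'0 : 0 < r' by rewrite divr_gt0 // mulr_gt0 // ltr0n.
have n1 : 1 <= c.+1%:R :> R by rewrite ler1n.
have cE : c%:R = c.+1%:R - 1 :> R by rewrite -natr1 addrK.
have rE : r = 2 * c.+1%:R * r'.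
  by rewrite /r' mulrC divfK // mulf_neq0 ?pnatr_eq0.
have nr : r' <= c.+1%:R * r' by rewrite ler_peMl // ltW.
have rc : r' + c%:R * r' <= r by rewrite cE rE; lra.
have r2 : r' + r' <= r by rewrite rE; lra.
exists r' => // y h h' yr hr h'r d d0 dP m.
rewrite slopeP; set M := slope _ _ _; set x := \col_m _.
have -> : h' m - h m = (invmx (jac v) *m (jac v *m x)) m 0 by rewrite mulKmx // mxE.
rewrite -[X in `|X|]/((invmx (jac v) *m (jac v *m x)) m 0 - _).
have -> : (invmx (jac v) *m (jac v *m x)) m 0 - (invmx (jac v) *m (M *m x)) m 0 =
  (invmx (jac v) *m ((jac v - M) *m x)) m 0 by rewrite mulmxBl mulmxBr !mxE.
have Me l m' : `|(jac v - M) l m'| <= e.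
  rewrite mxE [X in _ + X]mxE distrC; apply: rP => k.
    rewrite addrAC; apply: le_trans (ler_normD _ _) _.
    by apply: le_trans rc; rewrite lerD ?yr ?embv_bound.
  apply: le_trans (ler_normB _ _) _; apply: le_trans r2.
  by rewrite lerD.
rewrite mxE; apply: le_trans (ler_norm_sum _ _ _) _.
have B1 l : `|((jac v - M) *m x) l 0| <= c%:R * (e * d).
  rewrite mxE; apply: le_trans (ler_norm_sum _ _ _) _.
  rewrite mulr_natl -[X in _ *+ X](card_ord c) -sumr_const; apply: ler_sum => k _.
  by rewrite normrM ler_pM // [x _ _]mxE.
apply: le_trans (_ : \sum_(l < c) K * (c%:R * (e * d)) <= _).
  by apply: ler_sum => l _; rewrite normrM ler_pM.
rewrite sumr_const card_ord -[_ *+ c]mulr_natl.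
have -> : c%:R * (K * (c%:R * (e * d))) = (c%:R * c%:R * K * e) * d by ring.
rewrite [leRHS]mulrC ler_wpM2r //.
have cc : c%:R <= c.+1%:R :> R by rewrite ler_nat.
rewrite /e ler_pdivrMr ?mulr_gt0 ?ltr0n //.
have -> : 2^-1 * (2 * c.+1%:R * c.+1%:R * K) = c.+1%:R * c.+1%:R * K by field.
by apply: ler_wpM2r; [exact: ltW|exact: ler_pM].
Qed.
End FixedPoint.

Lemma half_pow_small (R : realType) (C e : R) : 0 < e ->
  exists n : nat, forall k, (n <= k)%N -> C / 2 ^+ k <= e.
Proof.
move=> e0; have [C0|C0] := leP C 0.
  exists 0%N => k _; apply: le_trans (ltW e0).
  by rewrite pmulr_lle0 // invr_gt0 exprn_gt0.
have [n nP] := small_inv (divr_gt0 e0 C0).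
exists n.+1 => k nk; rewrite mulrC -ler_pdivlMr //; apply: le_trans (ltW nP).
rewrite lef_pV2 ?posrE ?exprn_gt0 ?ltr0n // -natrX ler_nat.
exact: leq_trans nk (ltnW (ltn_expl k _)).
Qed.

Lemma mulmx_col_bound (R : realFieldType) c (A : 'M[R]_c) : exists2 K, 0 < K &
  forall (x : 'cV[R]_c) d, (forall m, `|x m 0| <= d) -> 0 <= d ->
    forall m, `|(A *m x) m 0| <= K * d.
Proof.
pose K := 1 + \sum_a \sum_b `|A a b|; exists K.
  by rewrite ltr_wpDr // sumr_ge0 // => a _; rewrite sumr_ge0.
move=> x d xd d0 m; rewrite mxE; apply: le_trans (ler_norm_sum _ _ _) _.
apply: le_trans (_ : \sum_b `|A m b| * d <= _).
  by apply: ler_sum => b _; rewrite normrM ler_wpM2l.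
rewrite -mulr_suml ler_wpM2r // /K [X in _ + X](bigD1 m) //= addrCA lerDl addr_ge0 //.
by rewrite sumr_ge0 // => a _; rewrite sumr_ge0.
Qed.

Section Newton.
Variables (R : realType) (N c : nat) (g : 'I_c -> {mpoly R[N]}) (s : 'I_c -> 'I_N).
Variable v : 'I_N -> R.
Hypothesis jv : jac g s v \in unitmx.
Local Notation zero_at y := (forall l, (g l).@[y] = 0).

Let contraction : exists2 r, 0 < r & forall y h h', nball v r y -> cball r h ->
  cball r h' -> forall d, 0 <= d -> (forall m, `|h' m - h m| <= d) ->
  forall m, `|(h' m - h m) - (invmx (jac g s v) *m
    (gval g idfun (fun n => y n + embv s h' n) - gval g idfun (fun n => y n + embv s h n))) m 0|
    <= d / 2.
Proof.
have ex l := hadamard (g l).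
have [D DP] := choice ex.
apply: (newton_contracts (D := D)) => //.
- by move=> l; case: (DP l).
- by move=> l; case: (DP l).
Qed.

Lemma max_norm (x : 'I_c -> R) : exists2 d, 0 <= d &
  (forall m, `|x m| <= d) /\ (0 < d -> exists m, `|x m| = d).
Proof.
have [m mI mmax] := seq_has_max 0 (codom (fun m => `|x m|)).
exists m; first by apply: mmax; rewrite mem_head.
split=> [k|m0]; first by apply: mmax; rewrite inE codom_f orbT.
move: mI; rewrite inE => /orP[/eqP m00|/codomP[k kE]]; first by rewrite m00 ltxx in m0.
by exists k.
Qed.

(** The contraction gives |x| <= |x| / 2 + K d for the increment x = h' - h, where d bounds the
    change of the equations. For d = 0 this is the uniqueness of the implicit functions. *)
Lemma newton_lipschitz : exists2 r, 0 < r & exists2 C, 0 < C &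
  forall y h h' d, nball v r y -> cball r h -> cball r h' -> 0 <= d ->
    (forall l, `|(g l).@[fun n => y n + embv s h' n] - (g l).@[fun n => y n + embv s h n]| <= d) ->
    forall m, `|h' m - h m| <= C * d.
Proof.
have [r r0 rP] := contraction.
have [K K0 KP] := mulmx_col_bound (invmx (jac g s v)).
exists r => //; exists (2 * K); first by rewrite mulr_gt0.
move=> y h h' d yr hr h'r d0 dP.
have [e e0 [eP emax]] := max_norm (fun m => h' m - h m).
suff ed : e <= 2 * K * d by move=> m; exact: le_trans (eP m) ed.
have [e00|e_gt0] := leP e 0.
  by apply: le_trans e00 _; rewrite !mulr_ge0 // ltW.
have [m mE] := emax e_gt0.
have h1 := rP y h h' yr hr h'r e e0 eP m.
set X := (_ *m _) m 0 in h1.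
have h2 : `|X| <= K * d.
  by apply: KP => // l; rewrite !mxE; exact: dP.
have : `|h' m - h m| <= e / 2 + K * d.
  by rewrite -[h' m - h m](subrK X); apply: le_trans (ler_normD _ _) _; rewrite lerD.
by rewrite mE => h3; lra.
Qed.

(** Newton's iteration with the fixed matrix J^-1. The first step is at most d = r' / 4 and the
    bound halves at each step, so the iterates stay within 2 d and their limit within 3 d <= r'. The
    values of the equations are -J times the steps, hence tend to 0. *)
Lemma newton_solution r : 0 < r -> zero_at v -> exists2 r1, 0 < r1 &
  forall y, nball v r1 y -> exists2 h, cball r h & zero_at (fun n => y n + embv s h n).
Proof.
move=> r0' gv; have [ra ra0 raP] := contraction.
pose r' := Num.min r ra.
have r'0 : 0 < r' by rewrite lt_min r0'.
have r'r : r' <= r by rewrite ge_min lexx.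
have r'ra : r' <= ra by rewrite ge_min lexx orbT.
pose Ji := invmx (jac g s v).
have [K K0 KP] := mulmx_col_bound Ji.
have [K2 K20 K2P] := mulmx_col_bound (jac g s v).
pose d := r' / 4.
have d_gt0 : 0 < d by rewrite divr_gt0.
have gam0 : 0 < d / K by rewrite divr_gt0.
have ex l : exists2 e, 0 < e & forall y, nball v e y -> `|(g l).@[y] - (g l).@[v]| <= d / K.
  exact: meval_continuous.
have [rf rfP] := choice (fun l => let: ex_intro2 a b f := ex l in ex_intro _ a (conj b f)).
pose r1 := \big[Num.min/ra]_l rf l.
have r10 : 0 < r1.
  rewrite /r1; apply: (big_ind (fun x => 0 < x)) => //.
    by move=> a b a0 b0; rewrite lt_min a0.
  by move=> l _; case: (rfP l).
exists r1 => // y yr1.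
have yra : nball v ra y.
  move=> n; apply: le_trans (yr1 n) _; rewrite /r1; elim/big_rec: _ => // l x _ xa.
  by rewrite ge_min xa orbT.
have gy l : `|(g l).@[y]| <= d / K.
  have [_ f] := rfP l; have := f y; rewrite gv subr0; apply=> n.
  by apply: le_trans (yr1 n) _; rewrite /r1; apply: bigmin_le_cond.
pose G h := gval g idfun (fun n => y n + embv s h n).
pose step (h : 'I_c -> R) m := h m - (Ji *m G h) m 0.
pose H k := iter k step (fun=> 0).
have SE n m : H n.+1 m - H n m = - (Ji *m G (H n)) m 0.
  by rewrite -[H n.+1 m]/(H n m - (Ji *m G (H n)) m 0) addrAC subrr add0r.
have inv k : (forall m, `|H k m| <= 2 * d * (1 - (2 ^+ k)^-1)) /\
    (forall m, `|H k.+1 m - H k m| <= d / 2 ^+ k).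
  have bnd j : 2 * d * (1 - (2 ^+ j)^-1) <= ra.
    apply: le_trans r'ra; apply: le_trans (_ : 2 * d * 1 <= _); last by rewrite /d; lra.
    by apply: ler_wpM2l; [rewrite mulr_ge0 // ltW|rewrite lerBlDr lerDl invr_ge0 exprn_ge0].
  elim: k => [|k [IH1 IH2]].
    split=> m; rewrite /H /= ?normr0 ?expr0 ?invr1 ?subrr ?mulr0 ?divr1 //.
    rewrite /step sub0r subr0 normrN.
    apply: le_trans (KP _ (d / K) _ (ltW gam0) m) _; last first.
      by rewrite ?expr0 ?divr1 mulrCA mulfV ?mulr1 // gt_eqF.
    move=> l; rewrite mxE; have <- : (g l).@[y] = mmap idfun (fun n => y n + embv s (fun=> 0) n) (g l).
      by apply: eq_mmap => // n; rewrite embv0 addr0.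
    exact: gy.
  have E1 m : `|H k.+1 m| <= 2 * d * (1 - (2 ^+ k.+1)^-1).
    rewrite -[H k.+1 m](subrK (H k m)) addrC.
    apply: le_trans (ler_normD _ _) _; apply: le_trans (lerD (IH1 m) (IH2 m)) _.
    rewrite exprS invfM; set x := (2 ^+ k)^-1; by rewrite le_eqVlt; apply/orP; left; apply/eqP; field.
  split=> // m.
  have dk : 0 <= d / 2 ^+ k by rewrite divr_ge0 ?exprn_ge0 // ltW.
  have b1 : cball ra (H k) by move=> m'; exact: le_trans (IH1 m') (bnd _).
  have b2 : cball ra (H k.+1) by move=> m'; exact: le_trans (E1 m') (bnd _).
  have h3 := raP y (H k) (H k.+1) yra b1 b2 _ dk IH2 m.
  have -> : d / 2 ^+ k.+1 = d / 2 ^+ k / 2 by rewrite exprS invfM; ring.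
  apply: le_trans h3.
  have XE (A B : 'cV[R]_c) : (Ji *m (A - B)) m 0 = (Ji *m A) m 0 - (Ji *m B) m 0.
    by rewrite mulmxBr !mxE.
  by rewrite -/Ji -/(G (H k.+1)) -/(G (H k)) XE !SE opprB addKr.
have Hb k m : `|H k m| <= 2 * d.
  case: (inv k) => h _; apply: le_trans (h m) _; rewrite -[leRHS]mulr1.
  by apply: ler_wpM2l; [rewrite mulr_ge0 // ltW|rewrite lerBlDr lerDl invr_ge0 exprn_ge0].
have [U [UU Utail]] := tail_ultrafilter unit.
have [l lP] := ultra_lim_vec UU (fun j : seq unit * nat => Hb j.2).
exists l.
  move=> m; have := lP _ d_gt0 => /filter_ex[j /= /(_ m) jm].
  rewrite -[l m](subrK (H j.2 m)); apply: le_trans (ler_normD _ _) _.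
  rewrite distrC; apply: le_trans (lerD jm (Hb j.2 m)) _.
  by apply: le_trans r'r; rewrite /d; lra.
move=> a; apply/eqP; rewrite -normr_le0; apply/ler_addgt0Pl => e e0; rewrite addr0.
have e2 : 0 < e / 2 by rewrite divr_gt0.
have [dl dl0 dlP] := meval_continuous (g a) (fun n => y n + embv s l n) e2.
have [n nP] := half_pow_small (K2 * d) e2.
have dlc : 0 < dl / c.+1%:R by rewrite divr_gt0 // ltr0n.
have [j [/= [_ nj] jl]] := filter_ex (filterI (Utail [::] n) (lP _ dlc)).
have h1 : `|(g a).@[fun n => y n + embv s (H j.2) n]| <= e / 2.
  apply: le_trans (nP _ nj); rewrite -mulrA.
  have -> : (g a).@[fun n => y n + embv s (H j.2) n] = (jac g s v *m (Ji *m G (H j.2))) a 0.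
    by rewrite mulKVmx // mxE.
  apply: K2P; last by rewrite divr_ge0 ?exprn_ge0 // ltW.
  by move=> m; case: (inv j.2) => _ /(_ m); rewrite SE normrN.
have h2 : `|(g a).@[fun n => y n + embv s (H j.2) n] - (g a).@[fun n => y n + embv s l n]| <= e / 2.
  apply: dlP => k; rewrite opprD addrACA subrr add0r -embvB.
  apply: le_trans (embv_bound s jl k) _.
  by rewrite mulrCA ger_pMr // ler_pdivrMr ?ltr0n // mul1r ler_nat.
have -> : (g a).@[fun n => y n + embv s l n] = (g a).@[fun n => y n + embv s (H j.2) n] -
   ((g a).@[fun n => y n + embv s (H j.2) n] - (g a).@[fun n => y n + embv s l n]) by ring.
apply: le_trans (ler_normB _ _) _; apply: le_trans (lerD h1 h2) _.
by rewrite -splitr.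
Qed.
End Newton.

(** * Signs along a real curve *)

Lemma horner_mmap (R : comNzRingType) N (z : 'I_N -> {poly R}) (q : {mpoly R[N]}) t :
  (mmap polyC z q).[t] = q.@[fun n => (z n).[t]].
Proof.
rewrite /meval /mmap horner_sum; apply: eq_bigr => m _.
rewrite hornerM hornerC /mmap1 horner_prod; congr (_ * _).
by apply: eq_bigr => n _; rewrite horner_exp.
Qed.

Section PolyOrder.
Variable R : realFieldType.
Implicit Types (p q : {poly R}).

Lemma poly_bound p : exists2 C, 0 <= C & forall t, `|t| <= 1 -> `|p.[t]| <= C.
Proof.
exists (\sum_(i < size p) `|p`_i|); first by rewrite sumr_ge0.
move=> t t1; rewrite horner_coef; apply: le_trans (ler_norm_sum _ _ _) _.
apply: ler_sum => i _; rewrite normrM normrX ler_piMr // exprn_ile1 //.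
Qed.

Lemma polyXn_bound p n : 'X^n %| p ->
  exists2 C, 0 <= C & forall t, `|t| <= 1 -> `|p.[t]| <= C * `|t| ^+ n.
Proof.
move=> /dvdpP[q ->]; have [C C0 HC] := poly_bound q; exists C => // t t1.
by rewrite hornerM hornerXn normrM normrX ler_wpM2r ?exprn_ge0 ?HC.
Qed.

Lemma poly_lip0 p : exists2 C, 0 <= C & forall t, `|t| <= 1 -> `|p.[t] - p.[0]| <= C * `|t|.
Proof.
have : 'X^1 %| p - (p.[0])%:P.
  by rewrite expr1 -['X]subr0 -polyC0 dvdp_XsubCl rootE hornerD hornerN hornerC subrr.
case/polyXn_bound=> C C0 HC; exists C => // t t1.
by have := HC t t1; rewrite hornerD hornerN hornerC expr1.
Qed.

Lemma poly_val0 p : p != 0 -> exists mu p1, p = 'X^mu * p1 /\ p1.[0] != 0.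
Proof.
have [n] := ubnP (size p); elim: n p => // n IH p pn p0.
have [r0|r0] := eqVneq p.[0] 0; last by exists 0%N, p; rewrite expr0 mul1r.
have : 'X - 0%:P %| p by rewrite dvdp_XsubCl; apply/rootP.
rewrite subr0 => /dvdpP[q qE].
have q0 : q != 0 by apply: contraNneq p0 => q0; rewrite qE q0 mul0r.
have [|mu [p1 [p1E p10]]] := IH q _ q0.
  by move: pn; rewrite qE size_mulX.
by exists mu.+1, p1; rewrite qE p1E exprSr mulrAC.
Qed.

Lemma lt_near_pos p : 0 < p.[0] -> exists2 e, 0 < e & forall t, `|t| < e -> p.[0] / 2 < p.[t].
Proof.
move=> p0; have [C C0 HC] := poly_lip0 p.
pose e := Num.min 1 (p.[0] / (2 * (C + 1))).
have C1 : 0 < C + 1 by rewrite ltr_wpDl.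
have e0 : 0 < e by rewrite lt_min ltr01 divr_gt0 // mulr_gt0.
exists e => // t; rewrite lt_min => /andP[t1 t2].
have h := HC t (ltW t1).
have h2 : C * `|t| < p.[0] / 2.
  apply: le_lt_trans (_ : (C + 1) * `|t| < _); first by rewrite ler_wpM2r // lerDl.
  rewrite mulrC -ltr_pdivlMr //; apply: lt_le_trans t2 _.
  by rewrite -mulrA -invfM.
by move: h; rewrite ler_norml => /andP[h1 _]; lra.
Qed.

(** Write p = X^mu p1 with p1(0) nonzero. If mu < n, then |p(t)| is at least a positive multiple of
    t^mu near 0 and exceeds C t^n. *)
Lemma Xn_dvd_bound p n : (exists C e, 0 < e /\ forall t, 0 < t < e -> `|p.[t]| <= C * t ^+ n) ->
  'X^n %| p.
Proof.
move=> [C [e [e0 H]]]; have [->|p0] := eqVneq p 0; first exact: dvdp0.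
have [mu [p1 [pE p10]]] := poly_val0 p0.
have [nm|mn] := leqP n mu; first by rewrite pE dvdp_mulr // dvdp_exp2l.
exfalso; have [q] : exists q : {poly R}, [/\ 0 < q.[0] & forall t, `|q.[t]| = `|p1.[t]|].
  have [p1p|p1n|p1z] := ltgtP 0 p1.[0]; last by rewrite -p1z eqxx in p10.
    by exists p1.
  by exists (- p1); split=> [|t]; rewrite hornerN ?oppr_gt0 ?normrN.
move=> [q0 qp]; have [e1 e10 e1P] := lt_near_pos q0.
pose C' := Num.max C 1; pose a := q.[0] / 2.
have C'0 : 0 < C' by rewrite lt_max ltr01 orbT.
have a0 : 0 < a by rewrite divr_gt0.
pose t := Num.min (Num.min 1 (e / 2)) (Num.min (e1 / 2) (a / C')).
have t0 : 0 < t by rewrite !lt_min ltr01 !divr_gt0.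
have t1 : t <= 1 by rewrite !ge_min lexx.
have te : t < e by rewrite !gt_min; apply/orP; left; apply/orP; right; lra.
have te1 : t < e1 by rewrite !gt_min; apply/orP; right; apply/orP; left; lra.
have ta : t <= a / C' by rewrite !ge_min lexx !orbT.
have h1 := H t; rewrite t0 te in h1; have {}h1 := h1 isT.
have h2 := e1P t; rewrite gtr0_norm // in h2; have {}h2 := h2 te1.
have : t ^+ mu * a < t ^+ mu * (C' * t).
  rewrite pE hornerM hornerXn normrM normrX gtr0_norm // -qp in h1.
  apply: lt_le_trans (_ : t ^+ mu * `|q.[t]| <= _).
    rewrite ltr_pM2l ?exprn_gt0 //; exact: lt_le_trans h2 (ler_norm _).
  apply: le_trans h1 _; rewrite mulrCA -exprSr.
  apply: le_trans (_ : C' * t ^+ n <= _).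
    by apply: ler_wpM2r; [rewrite exprn_ge0 // ltW|rewrite le_max lexx].
  by apply: ler_wpM2l; [exact: ltW|apply: ler_wiXn2l => //; exact: ltW].
rewrite ltr_pM2l ?exprn_gt0 //; move: ta; rewrite ler_pdivlMr // mulrC => ta.
by rewrite ltNge ta.
Qed.

(** The lowest coefficients of fourth powers are positive and cannot cancel, so the sum has order 4
    k, where k is the least order of the [q]. The order 2 mu of p^2 is below the precision n, hence
    2 mu = 4 k. *)
Lemma parity p (qs : seq {poly R}) n mu p1 : 'X^n %| p ^+ 2 - \sum_(q <- qs) q ^+ 4 ->
  p = 'X^mu * p1 -> p1.[0] != 0 -> (mu.*2 < n)%N -> ~~ odd mu.
Proof.
move=> H pE p10 mun.
pose bad k := all (fun q => 'X^k %| q) qs.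
have Xdvd (k : nat) (q : {poly R}) : ('X^(k.+1) %| ('X^k * q)%R)%R = (q.[0] == 0).
  rewrite exprSr dvdp_mul2l -?size_poly_gt0 ?size_polyXn //.
  by rewrite -['X]subr0 -polyC0 dvdp_XsubCl.
have XndvdX (k j : nat) (q : {poly R}) : q.[0] != 0 -> ('X^j %| ('X^k * q)%R)%R -> (j <= k)%N.
  move=> q0 d; rewrite leqNgt; apply/negP => kj; move: q0; rewrite -(Xdvd k).
  by rewrite (dvdp_trans _ d) // dvdp_exp2l.
have Ep : p ^+ 2 = 'X^(mu.*2) * p1 ^+ 2 by rewrite pE exprMn -exprM muln2.
have p120 : (p1 ^+ 2).[0] != 0 by rewrite horner_exp sqrf_eq0.
(* If there is no such [k], every [q] is divisible by all powers of X, and X^n divides p^2, against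
   2 mu < n. *)
have [[k [bk nbk]]|nob] := pselect (exists k, bad k /\ ~~ bad k.+1); last first.
  have ball k : bad k.
    elim: k => [|k IH]; first by apply/allP => q _; rewrite expr0 dvd1p.
    by apply: contraT => nb; case: nob; exists k.
  have : 'X^n %| p ^+ 2.
    rewrite -(dvdp_addl _ (_ : 'X^n %| - \sum_(q <- qs) q ^+ 4)) //.
    rewrite dvdpNr big_seq; apply: (big_ind (fun x => 'X^n %| x)) => [|a b|q qq]; first exact: dvdp0.
      exact: dvdp_add.
    by rewrite exprS dvdp_mulr //; have /allP := ball n; apply.
  by rewrite Ep => /(XndvdX _ _ _ p120); rewrite leqNgt mun.
have [Q [QE Q0]] : exists Q, \sum_(q <- qs) q ^+ 4 = 'X^(4 * k) * Q /\ Q.[0] != 0.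
  have H1 : forall s : seq {poly R}, all (fun q => 'X^k %| q) s ->
      exists Q, [/\ \sum_(q <- s) q ^+ 4 = 'X^(4 * k) * Q, 0 <= Q.[0] &
        ~~ all (fun q => 'X^(k.+1) %| q) s -> Q.[0] != 0].
    elim=> [|q s IH] /=; first by exists 0; rewrite big_nil mulr0 horner0 lexx.
    move=> /andP[/dvdpP[q1 q1E] /IH[Q [QE Q0 Qn]]].
    exists (q1 ^+ 4 + Q); split.
    - by rewrite big_cons QE q1E exprMn -exprM mulrDr mulnC; congr (_ + _); rewrite mulrC.
    - by rewrite hornerD horner_exp addr_ge0 // exprn_even_ge0.
    - rewrite negb_and q1E mulrC Xdvd hornerD horner_exp => nz.
      rewrite gt_eqF // lt_neqAle eq_sym addr_ge0 ?exprn_even_ge0 // andbT.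
      rewrite paddr_eq0 ?exprn_even_ge0 // expf_eq0 /= negb_and.
      by case/orP: nz => [->//|/Qn ->]; rewrite orbT.
  by have [Q [Q1 Q2 Q3]] := H1 qs bk; exists Q; split=> //; exact: Q3.
rewrite Ep QE in H.
suff E : mu.*2 = (4 * k)%N.
  by move: E; rewrite -muln2 mulnC (_ : 4 = 2 * 2)%N // -mulnA => /eqP;
    rewrite eqn_mul2l /= => /eqP ->; rewrite oddM.
apply/eqP; rewrite eqn_leq; apply/andP; split.
- rewrite leqNgt; apply/negP => lt.
  have d1 : 'X^((4 * k).+1) %| ('X^(4 * k) * Q)%R.
    have : 'X^((4 * k).+1) %| ('X^(mu.*2) * p1 ^+ 2 - 'X^(4 * k) * Q)%R.
      apply: dvdp_trans H; apply: dvdp_exp2l; exact: leq_trans lt (ltnW mun).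
    by rewrite dvdp_subr // dvdp_mulr // dvdp_exp2l.
  by move: (XndvdX _ _ _ Q0 d1); rewrite ltnn.
- rewrite leqNgt; apply/negP => lt.
  have d1 : 'X^((mu.*2).+1) %| ('X^(mu.*2) * p1 ^+ 2)%R.
    have : 'X^((mu.*2).+1) %| ('X^(mu.*2) * p1 ^+ 2 - 'X^(4 * k) * Q)%R.
      by apply: dvdp_trans H; apply: dvdp_exp2l.
    by rewrite dvdp_subl // dvdp_mulr // dvdp_exp2l.
  by move: (XndvdX _ _ _ p120 d1); rewrite ltnn.
Qed.
End PolyOrder.

Lemma Xdvd_horner0 (R : fieldType) (p : {poly R}) : ('X %| p) = (p.[0] == 0).
Proof. by rewrite -['X]subr0 -polyC0 dvdp_XsubCl. Qed.

(** * Polynomial approximation of an implicit curve *)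

Section Curve.
Variables (R : realType) (N c : nat) (g : 'I_c -> {mpoly R[N]}) (s : 'I_c -> 'I_N).
Variables (v : 'I_N -> R) (r C : R).
Hypotheses (r_gt0 : 0 < r) (C_gt0 : 0 < C).
Hypothesis lip : forall y h h' d, nball v r y -> cball r h -> cball r h' -> 0 <= d ->
    (forall l, `|(g l).@[fun n => y n + embv s h' n] - (g l).@[fun n => y n + embv s h n]| <= d) ->
    forall m, `|h' m - h m| <= C * d.
Variables (b d : 'I_N -> R) (h : R -> 'I_c -> R) (e0 : R).
Hypothesis e0_gt0 : 0 < e0.
Hypothesis b_near : forall t, `|t| <= e0 -> nball v r (fun n => b n + t * d n).
Hypothesis h_near : forall t, `|t| <= e0 -> cball (r / 2) (h t).

(** The line b + t d lifted by the implicit functions. [h] is known only through the equations; its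
    regularity in t is derived from [lip]. *)
Definition curve t n := b n + t * d n + embv s (h t) n.
Hypothesis on_curve : forall t, `|t| <= e0 -> forall l, (g l).@[curve t] = 0.
Hypothesis jac0 : jac g s (curve 0) \in unitmx.

Definition base_poly n : {poly R} := (b n)%:P + d n *: 'X.
Definition formal_curve (H : 'I_c -> {poly R}) n := base_poly n + embv s H n.

Lemma embv_horner (H : 'I_c -> {poly R}) n t :
  (embv s H n).[t] = embv s (fun m => (H m).[t]) n.
Proof. by rewrite /embv horner_sum; apply: eq_bigr => m _; rewrite hornerMn. Qed.

Lemma formal_curve_horner H n t :
  (formal_curve H n).[t] = b n + t * d n + embv s (fun m => (H m).[t]) n.
Proof.
by rewrite /formal_curve /base_poly !hornerD hornerC hornerZ hornerX embv_horner [d n * t]mulrC.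
Qed.

Lemma zero_in : `|0 : R| <= e0. Proof. by rewrite normr0 ltW. Qed.

(** Newton's step over [{poly R}]: the equations take the new value (1 - S J^-1) V, and S reduces to
    J at t = 0, so each step gains a power of X. *)
Lemma formal_solution k : exists H : 'I_c -> {poly R},
  (forall m, (H m).[0] = h 0 m) /\
  forall l, 'X^(k.+1) %| mmap polyC (formal_curve H) (g l).
Proof.
have at0 H l : (forall m, (H m).[0] = h 0 m) ->
    (mmap polyC (formal_curve H) (g l)).[0] = 0.
  move=> H0; rewrite horner_mmap -[RHS](on_curve zero_in l).
  apply: eq_mmap => // n; rewrite formal_curve_horner /curve; congr (_ + _).
  by rewrite /embv; apply: eq_bigr => m _; rewrite H0.
elim: k => [|k [H [H0 HX]]].
  exists (fun m => (h 0 m)%:P); split=> [m|l]; first by rewrite hornerC.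
  by rewrite expr1 Xdvd_horner0 at0 // => m; rewrite hornerC.
pose Ji := invmx (jac g s (curve 0)).
pose V := gval g polyC (formal_curve H).
pose H' m := H m - \sum_b (Ji m b)%:P * V b 0.
have V0 l : (V l 0).[0] = 0 by rewrite mxE at0.
have H'0 m : (H' m).[0] = h 0 m.
  rewrite /H' hornerD hornerN H0 horner_sum big1 ?subr0 // => a _.
  by rewrite hornerM V0 mulr0.
exists H'; split=> // l.
have [D DP] := choice (fun l => hadamard (g l)).
have D1 l' := (DP l').1; have D2 l' := (DP l').2.
have E := slopeP s D1 polyC base_poly H H'.
set S := slope _ _ _ _ _ in E.
have xE : \col_m (H' m - H m) = - (map_mx polyC Ji *m V).
  apply/colP => m; rewrite mxE [RHS]mxE [in RHS]mxE /H' addrAC subrr add0r; congr (- _).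
  by apply: eq_bigr => a _; congr (_ * _); rewrite mxE.
have GE : gval g polyC (formal_curve H') = (1%:M - S *m map_mx polyC Ji) *m V.
  by rewrite mulmxBl mul1mx -mulmxA -mulmxN -xE -E addrC subrK.
have S0 : map_mx (fun p : {poly R} => p.[0]) S = jac g s (curve 0).
  rewrite -(slope_jac s D2); apply/matrixP => a m; rewrite !mxE horner_mmap.
  apply: eq_mmap => // n; rewrite /pairv; case: split => x.
    rewrite -/(formal_curve H x) formal_curve_horner /curve; congr (_ + _).
    by rewrite /embv; apply: eq_bigr => m' _; rewrite H0.
  rewrite embv_horner /embv; apply: eq_bigr => m' _.
  by rewrite hornerD hornerN H0 H'0 subrr.
have -> : mmap polyC (formal_curve H') (g l) = gval g polyC (formal_curve H') l 0 by rewrite mxE.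
rewrite GE mxE; apply: (big_ind (fun p => 'X^(k.+2) %| p)) => [|p q|a _].
- exact: dvdp0.
- exact: dvdp_add.
rewrite exprS; apply: dvdp_mul; last by rewrite mxE.
rewrite Xdvd_horner0 !mxE hornerD hornerN hornerMn hornerC horner_sum.
have : (jac g s (curve 0) *m Ji) l a = (1%:M : 'M[R]_c) l a by rewrite mulmxV.
rewrite -S0 !mxE => F; rewrite -F subr_eq0; apply/eqP; apply: eq_bigr => m _.
by rewrite !mxE hornerM hornerC.
Qed.

(** At the polynomial arc the equations are O(t^(k+1)), so by [lip] the arc is O(t^(k+1)) away from
    the curve. A single arc serves all [q], in particular both [w] and w^2 - \sum a^4. *)
Lemma formal_approx k : exists H : 'I_c -> {poly R}, forall q : {mpoly R[N]},
  exists2 K, 0 <= K & exists2 e, 0 < e & forall t, `|t| < e ->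
    `|q.@[curve t] - (mmap polyC (formal_curve H) q).[t]| <= K * `|t| ^+ k.+1.
Proof.
have [H [H0 HX]] := formal_solution k; exists H.
have [K1 K10 K1P] : exists2 K, 0 <= K & forall t l, `|t| <= 1 ->
    `|(mmap polyC (formal_curve H) (g l)).[t]| <= K * `|t| ^+ k.+1.
  have ex l := polyXn_bound (HX l).
  have [f fP] := choice (fun l => let: ex_intro2 a x y := ex l in ex_intro _ a (conj x y)).
  exists (\sum_l f l); first by rewrite sumr_ge0 // => l _; case: (fP l).
  move=> t l t1; have [_ F] := fP l; apply: le_trans (F t t1) _.
  rewrite ler_wpM2r ?exprn_ge0 // (bigD1 l) //= lerDl sumr_ge0 // => a _.
  by case: (fP a).
have [K2 K20 K2P] : exists2 K, 0 <= K & forall t m, `|t| <= 1 ->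
    `|(H m).[t] - h 0 m| <= K * `|t|.
  have ex m := poly_lip0 (H m).
  have [f fP] := choice (fun l => let: ex_intro2 a x y := ex l in ex_intro _ a (conj x y)).
  exists (\sum_l f l); first by rewrite sumr_ge0 // => l _; case: (fP l).
  move=> t l t1; have [_ F] := fP l; rewrite -H0; apply: le_trans (F t t1) _.
  rewrite ler_wpM2r // (bigD1 l) //= lerDl sumr_ge0 // => a _.
  by case: (fP a).
pose e := Num.min (Num.min 1 e0) (r / (2 * (K2 + 1))).
have K21 : 0 < K2 + 1 by rewrite ltr_wpDl.
have e_gt0 : 0 < e by rewrite !lt_min ltr01 e0_gt0 divr_gt0 // mulr_gt0.
have near t : `|t| < e -> [/\ `|t| <= 1, `|t| <= e0, cball r (fun m => (H m).[t]) & cball r (h t)].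
  rewrite !lt_min => /andP[/andP[t1 t2] t3].
  have t1' := ltW t1; have t2' := ltW t2; split=> // m; last first.
    apply: le_trans (h_near t2' m) _. have := r_gt0. lra.
  have h1 := K2P t m t1'; have h2 := h_near zero_in m.
  rewrite -[X in `|X|](subrK (h 0 m)); apply: le_trans (ler_normD _ _) _.
  apply: le_trans (lerD h1 h2) _.
  have : K2 * `|t| <= (K2 + 1) * `|t| by rewrite ler_wpM2r // lerDl.
  have : (K2 + 1) * `|t| <= r / 2.
    rewrite mulrC -ler_pdivlMr //; apply: le_trans (ltW t3) _.
    by rewrite -mulrA -invfM.
  lra.
have close t : `|t| < e -> forall m, `|h t m - (H m).[t]| <= C * (K1 * `|t| ^+ k.+1).
  move=> te m; have [t1 t2 H3 H4] := near t te.
  apply: (lip (b_near t2) H3 H4); first by rewrite mulr_ge0 // exprn_ge0.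
  move=> l; have := on_curve t2 l; rewrite /curve => ->.
  rewrite sub0r normrN; apply: le_trans (K1P t l t1).
  rewrite horner_mmap le_eqVlt; apply/orP; left; apply/eqP; congr `|_|.
  by apply: eq_mmap => // n; rewrite formal_curve_horner.
move=> q.
pose B := (\sum_n `|v n|) + r + c%:R * r.
have vB n : `|v n| <= \sum_n `|v n| by rewrite (bigD1 n) //= lerDl sumr_ge0.
have bB t n : `|t| < e -> `|b n + t * d n| <= (\sum_n `|v n|) + r.
  move=> /near[_ t2 _ _]; rewrite -[X in `|X|](subrK (v n)) addrC.
  apply: le_trans (ler_normD _ _) _; rewrite lerD //; exact: (b_near t2).
have [L L0 LP] := meval_lipschitz B q.
exists (L * (c%:R * (C * K1))); first by rewrite !mulr_ge0 // ltW.
exists e => // t te; have [t1 t2 H3 H4] := near t te.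
rewrite horner_mmap -!mulrA; apply: LP => [n|n|n|].
- by rewrite /curve; apply: le_trans (ler_normD _ _) _; rewrite lerD ?bB ?embv_bound.
- rewrite formal_curve_horner; apply: le_trans (ler_normD _ _) _.
  by rewrite lerD ?bB ?embv_bound.
- rewrite formal_curve_horner /curve opprD addrACA subrr add0r -embvB.
  by apply: embv_bound => m; exact: close.
- by rewrite !mulr_ge0 ?exprn_ge0 // ltW.
Qed.

Variables (w : {mpoly R[N]}) (A : seq {mpoly R[N]}).
Local Notation W t := (w.@[curve t]).
Hypothesis wA : forall t, `|t| <= e0 -> W t ^+ 2 = \sum_(a <- A) a.@[curve t] ^+ 4.
Hypothesis finite_order : exists m e, 0 < e /\ forall t, `|t| < e -> W t = 0 \/ `|t| ^+ m <= `|W t|.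

(* Along the curve w agrees to high order with a polynomial, whose order at 0 is even because
   w^2 is a sum of fourth powers. *)
Lemma curve_sign : exists2 e, 0 < e &
  [\/ forall t, `|t| < e -> W t = 0,
      forall t, 0 < `|t| < e -> 0 < W t |
      forall t, 0 < `|t| < e -> W t < 0].
Proof.
have [m [e1 [e10 ordW]]] := finite_order.
have [[e [e_gt0 We]]|nz] := pselect (exists e, 0 < e /\ forall t, `|t| < e -> W t = 0).
  by exists e => //; constructor 1.
(* The order mu of [w] along the arc will be at most m, so the precision 2 m + 1 exceeds 2 mu, as
   [parity] requires. *)
have [H HP] := formal_approx m.*2.
pose P q := mmap polyC (formal_curve H) q.
have [K K0 [e2 e20 wP]] := HP w.
have small (K' : R) : exists2 e, 0 < e & forall t, 0 < t < e -> K' * t < 1.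
  exists (`|K'| + 1)^-1; first by rewrite invr_gt0 ltr_wpDl.
  move=> t /andP[t0 te]; apply: le_lt_trans (_ : `|K'| * t < 1).
    by apply: ler_wpM2r; [exact: ltW|exact: ler_norm].
  apply: le_lt_trans (_ : (`|K'| + 1) * t < 1); first by apply: ler_wpM2r; [exact: ltW|rewrite lerDl].
  by rewrite mulrC -ltr_pdivlMr ?ltr_wpDl // mul1r.
(* Otherwise W t = O(t^(m+1)), which is below |t|^m for small nonzero t, and finite order makes W
   vanish near 0. *)
have nX : ~~ ('X^(m.+1) %| P w).
  apply/negP => /polyXn_bound[K' K'0 K'P].
  have [e3 e30 e3P] := small (K + K').
  apply: nz; pose e := Num.min (Num.min e1 e2) (Num.min 1 e3).
  exists e; split; first by rewrite !lt_min e10 e20 ltr01.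
  move=> t; rewrite !lt_min => /andP[/andP[te1 te2] /andP[t1 te3]].
  have [//|ge] := ordW t te1; apply/eqP; rewrite -normr_le0 leNgt; apply/negP => Wt.
  have [t0|t0] := eqVneq t 0.
    rewrite t0 in Wt te2 t1; have := wP 0 te2; have := K'P 0 (ltW t1).
    rewrite normr0 !expr0n /= !mulr0 normr_le0 => /eqP ->.
    by rewrite subr0 leNgt Wt.
  have tp : 0 < `|t| by rewrite normr_gt0.
  have := wP t te2; have h2 := K'P t (ltW t1) => h1.
  have : `|W t| <= (K + K') * `|t| ^+ m.+1.
    rewrite -[W t](subrK (P w).[t]) mulrDl; apply: le_trans (ler_normD _ _) _.
    rewrite lerD //; apply: le_trans h1 _; rewrite ler_wpM2l //.
    by apply: ler_wiXn2l; rewrite ?ltW // ltnS -addnn leq_addr.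
  rewrite exprSr mulrA mulrAC leNgt => /negP; apply.
  apply: lt_le_trans ge; rewrite -[ltRHS]mul1r ltr_pM2r ?exprn_gt0 //.
  by apply: e3P; rewrite tp.
have Pw0 : P w != 0 by apply: contraNneq nX => ->; exact: dvdp0.
have [mu [p1 [pE p10]]] := poly_val0 Pw0.
have mum : (mu <= m)%N.
  by rewrite leqNgt; apply: contra nX => mmu; rewrite pE dvdp_mulr // dvdp_exp2l.
have div : 'X^((m.*2).+1) %| P w ^+ 2 - \sum_(q <- map P A) q ^+ 4.
  have Pwh t : (P w ^+ 2 - \sum_(q <- map P A) q ^+ 4).[t] =
      (P (w ^+ 2 - \sum_(a <- A) a ^+ 4)).[t].
    rewrite /P rmorphB rmorphXn rmorph_sum big_map /=.
    by congr (_ - _).[t]; apply: eq_bigr => a _; rewrite rmorphXn.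
  have [K' K'0 [e3 e30 e3P]] := HP (w ^+ 2 - \sum_(a <- A) a ^+ 4).
  apply: Xn_dvd_bound; exists K', (Num.min e3 e0); split; first by rewrite lt_min e30.
  move=> t /andP[t0]; rewrite lt_min => /andP[te3 te0].
  have := e3P t; rewrite gtr0_norm // => /(_ te3).
  have -> : (w ^+ 2 - \sum_(a <- A) a ^+ 4).@[curve t] = 0.
    rewrite rmorphB rmorphXn rmorph_sum /= wA ?gtr0_norm ?ltW //.
    by apply/eqP; rewrite subr_eq0; apply/eqP; apply: eq_bigr => a _; rewrite rmorphXn.
  by rewrite sub0r normrN -Pwh.
have evmu : ~~ odd mu by apply: (parity div pE p10); rewrite ltnS leq_double.
have [q [sg [sg2 q0 qE]]] : exists q sg, [/\ sg ^+ 2 = 1, 0 < q.[0] & p1 = sg *: q].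
  have [p1p|p1n|p1z] := ltgtP 0 p1.[0]; last by rewrite -p1z eqxx in p10.
    by exists p1, 1; rewrite expr1n scale1r.
  exists (- p1), (-1); rewrite sqrrN expr1n hornerN oppr_gt0 scaleN1r opprK //.
have [e4 e40 e4P] := lt_near_pos q0.
have [e5 e50 e5P] := small (K / (q.[0] / 2)).
have key t : 0 < `|t| < Num.min (Num.min e2 1) (Num.min e4 e5) -> 0 < sg * W t.
  rewrite !lt_min => /andP[t0 /andP[/andP[te2 t1] /andP[te4 te5]]].
  have h1 := wP t te2; have h2 := e4P t te4; have h3 := e5P `|t|; rewrite t0 te5 in h3.
  have {}h3 := h3 isT.
  have sW : `|sg * W t - t ^+ mu * q.[t]| <= K * `|t| ^+ (m.*2).+1.
    have -> : sg * W t - t ^+ mu * q.[t] = sg * (W t - (P w).[t]).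
      by rewrite pE qE hornerM hornerXn hornerZ mulrBr; congr (_ - _); rewrite -[LHS]mul1r -sg2; ring.
    rewrite normrM (_ : `|sg| = 1) ?mul1r //.
    by apply/eqP; rewrite -(@eqrXn2 _ 2) // -normrX sg2 normr1 expr1n.
  have tmu : t ^+ mu = `|t| ^+ mu.
    by rewrite -normrX ger0_norm // exprn_even_ge0.
  have tmu0 : 0 < `|t| ^+ mu by rewrite exprn_gt0.
  have h4 : K * `|t| ^+ (m.*2).+1 < `|t| ^+ mu * (q.[0] / 2).
    apply: le_lt_trans (_ : K * `|t| * `|t| ^+ mu < _).
      rewrite -mulrA -exprS ler_wpM2l //; apply: ler_wiXn2l; rewrite ?ltW //.
      by rewrite ltnS (leq_trans mum) // -addnn leq_addr.
    rewrite mulrC ltr_pM2l // -[ltRHS]mul1r -ltr_pdivrMr ?divr_gt0 //.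
    by rewrite mulrAC.
  have h5 : `|t| ^+ mu * (q.[0] / 2) < `|t| ^+ mu * q.[t] by rewrite ltr_pM2l.
  move: sW; rewrite tmu ler_norml => /andP[h6 _].
  by move: h4 h5 h6; move: (K * _) (_ * (_ / 2)) (`|t| ^+ mu * q.[t]) (sg * W t) => x y z u; lra.
exists (Num.min (Num.min e2 1) (Num.min e4 e5)).
  by rewrite !lt_min e20 ltr01 e40 e50.
have : (sg == 1) || (sg == -1) by rewrite -eqf_sqr sg2 expr1n.
case/orP => /eqP sgE.
  by constructor 2 => t /key; rewrite sgE mul1r.
by constructor 3 => t /key; rewrite sgE mulN1r oppr_gt0.
Qed.

End Curve.

(** * Algebraic elements over an infinitesimal and finite order *)

Lemma algebraic_rel_closed (E L : fieldType) (i : {rmorphism E -> L}) :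
  rel_closed [set y | algebraicOver i y]%classic.
Proof.
split.
  split=> /=; first exact: algebraic1.
    by move=> x y; exact: algebraic_sub.
  by move=> x y; exact: algebraic_div.
move=> q q0 qP x rx; apply/integral_algebraic.
pose q' := (lead_coef q)^-1 *: q.
have l0 : lead_coef q != 0 by rewrite lead_coef_eq0.
apply: (@integral_root_monic _ _ _ _ q').
- by rewrite monicE lead_coefZ mulVf.
- by rewrite rootE hornerZ; move/rootP: rx => ->; rewrite mulr0.
- move=> y /(nthP 0)[n _ <-]; rewrite coefZ; apply/integral_algebraic.
  by apply: algebraic_mul; [apply: algebraic_inv; exact: qP|exact: qP].
Qed.

Section Infinitesimal.
Variables (R M : rcfType) (k : {rmorphism R -> M}) (e : M).
Hypothesis e_inf : forall x, 0 < x -> `|e| <= k x.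
Hypothesis e0 : e != 0.

(** At most a negative power of the infinitesimal |e|. A nonzero element with moderate inverse is at
    least some power of |e|, which is finite order in terms of germs. *)
Definition moderate (y : M) := exists m, `|y| * `|e| ^+ m <= 1.

Let e_small : `|e| <= 2^-1.
Proof. by have := e_inf (_ : 0 < 2^-1); rewrite fmorphV rmorph_nat; apply; rewrite invr_gt0. Qed.

Let e_le1 : `|e| <= 1. Proof. by apply: le_trans e_small _; lra. Qed.

Lemma moderate_le (y : M) m m' : (m <= m')%N -> `|y| * `|e| ^+ m <= 1 -> `|y| * `|e| ^+ m' <= 1.
Proof.
move=> mm; apply: le_trans; rewrite ler_wpM2l //.
exact: ler_wiXn2l.
Qed.

Lemma moderateD (x y : M) : moderate x -> moderate y -> moderate (x + y).
Proof.
move=> [m xm] [n yn]; exists (maxn m n).+1.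
have h1 := moderate_le (leq_maxl m n) xm; have h2 := moderate_le (leq_maxr m n) yn.
rewrite exprSr mulrA; apply: le_trans (_ : 2 * `|e| <= 1); last by have := e_small; lra.
rewrite ler_wpM2r //; apply: le_trans (_ : (`|x| + `|y|) * `|e| ^+ (maxn m n) <= _).
  by rewrite ler_wpM2r ?exprn_ge0 // ler_normD.
by rewrite mulrDl; apply: le_trans (lerD h1 h2) _; lra.
Qed.

Lemma moderateM (x y : M) : moderate x -> moderate y -> moderate (x * y).
Proof.
move=> [m xm] [n yn]; exists (m + n)%N.
by rewrite normrM exprD mulrACA mulr_ile1 // mulr_ge0 // exprn_ge0.
Qed.

Lemma moderate_norm (x : M) : moderate x -> moderate `|x|.
Proof. by move=> [m xm]; exists m; rewrite normr_id. Qed.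

Lemma rcf_rmorph_ge0 a : 0 <= a -> 0 <= k a.
Proof. by move=> a0; rewrite -(sqr_sqrtr a0) rmorphXn sqr_ge0. Qed.

Lemma rcf_rmorph_norm a : `|k a| = k `|a|.
Proof.
have [a0|a0] := leP 0 a; first by rewrite !ger0_norm // rcf_rmorph_ge0.
by rewrite (ltr0_norm a0) rmorphN ler0_norm // -oppr_ge0 -rmorphN rcf_rmorph_ge0 // oppr_ge0 ltW.
Qed.

Lemma moderate_cst a : moderate (k a).
Proof.
exists 1%N; have [->|a0] := eqVneq a 0; first by rewrite rmorph0 normr0 mul0r ler01.
have ka0 : 0 < `|k a| by rewrite normr_gt0 fmorph_eq0.
rewrite expr1 mulrC -ler_pdivlMr // div1r rcf_rmorph_norm -fmorphV.
by apply: e_inf; rewrite invr_gt0 normr_gt0.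
Qed.

Lemma moderate_e : moderate e.
Proof. by exists 0%N; rewrite expr0 mulr1. Qed.

Lemma moderate_eV : moderate e^-1.
Proof. by exists 1%N; rewrite expr1 normfV mulVf ?normr_eq0. Qed.

Lemma moderateX x n : moderate x -> moderate (x ^+ n).
Proof.
move=> mx; elim: n => [|n IH]; last by rewrite exprS; exact: moderateM.
by rewrite expr0 -(rmorph1 k); exact: moderate_cst.
Qed.

Lemma moderate_poly (p : {poly R}) : moderate (map_poly k p).[e].
Proof.
elim/poly_ind: p => [|p c IH].
  by rewrite rmorph0 horner0 -(rmorph0 k); exact: moderate_cst.
rewrite rmorphD rmorphM /= map_polyX map_polyC hornerMXaddC.
by apply: moderateD; [apply: moderateM => //; exact: moderate_e|exact: moderate_cst].
Qed.

(** p(e) = e^mu p1(e) with p1(0) nonzero, and |p1(e)| >= |p1(0)| / 2 because e is infinitesimal. *)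
Lemma moderate_polyV (p : {poly R}) : moderate (map_poly k p).[e]^-1.
Proof.
have [->|p0] := eqVneq p 0.
  by rewrite rmorph0 horner0 invr0 -(rmorph0 k); exact: moderate_cst.
have [mu [p1 [-> p10]]] := poly_val0 p0.
rewrite rmorphM /= map_polyXn hornerM hornerXn invfM.
apply: moderateM; first by rewrite -exprVn; apply: moderateX; exact: moderate_eV.
have p1q : p1 = (p1.[0])%:P + ((p1 - (p1.[0])%:P) %/ 'X) * 'X.
  rewrite divpK; first by rewrite addrC subrK.
  by rewrite Xdvd_horner0 hornerD hornerN hornerC subrr.
set q := _ %/ 'X in p1q.
have [m qm] := moderate_poly q.
pose a := `|p1.[0]| / 2.
have a0 : 0 < a by rewrite divr_gt0 ?normr_gt0.
have [C C0 HC] : exists2 C, 0 < C & `|(map_poly k q).[e]| <= k C.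
  exists (\sum_(i < size q) `|q`_i| + 1); first by rewrite ltr_wpDl // sumr_ge0.
  rewrite horner_coef size_map_poly; apply: le_trans (ler_norm_sum _ _ _) _.
  rewrite rmorphD rmorph1 rmorph_sum; apply: ler_wpDr => //; apply: ler_sum => i _.
  by rewrite normrM normrX coef_map rcf_rmorph_norm ler_piMr ?rcf_rmorph_ge0 // exprn_ile1.
have low : k a <= `|(map_poly k p1).[e]|.
  have -> : (map_poly k p1).[e] = k p1.[0] + (map_poly k q).[e] * e.
    by rewrite [in LHS]p1q rmorphD rmorphM /= map_polyX map_polyC hornerD hornerC hornerMX.
  have : `|(map_poly k q).[e] * e| <= k a.
    rewrite normrM; apply: le_trans (_ : k C * k (a / C) <= _).
      by rewrite ler_pM // e_inf // divr_gt0.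
    by rewrite -rmorphM mulrC divfK // gt_eqF.
  have : `|k p1.[0]| = k a + k a by rewrite -rmorphD /a -splitr rcf_rmorph_norm.
  have := ler_normB (k p1.[0] + (map_poly k q).[e] * e) ((map_poly k q).[e] * e).
  rewrite addrK; lra.
have ka : 0 < k a by rewrite lt_neqAle rcf_rmorph_ge0 ?(ltW a0) // eq_sym fmorph_eq0 gt_eqF.
have [n nP] := moderate_cst a^-1; exists n; apply: le_trans nP.
have -> : `|k a^-1| = (k a)^-1 by rewrite fmorphV normfV gtr0_norm.
by rewrite ler_wpM2r ?exprn_ge0 // normfV lef_pV2 ?posrE // (lt_le_trans ka).
Qed.

(** Roots are below the Cauchy bound, which is moderate because coefficients in R(e) and the inverse
    of the leading one are. *)
Lemma moderate_root (E : fieldType) (i : {rmorphism E -> M}) y :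
  (forall c, exists p q : {poly R}, i c = (map_poly k p).[e] / (map_poly k q).[e]) ->
  algebraicOver i y -> moderate y.
Proof.
move=> iE [p p0 /rootP ry].
have mi c : moderate (i c).
  by have [a [b ->]] := iE c; apply: moderateM; [exact: moderate_poly|exact: moderate_polyV].
have [m mP] : moderate (cauchy_bound (map_poly i p)); last first.
  exists m; apply: le_trans mP; rewrite ler_wpM2r ?exprn_ge0 //.
  apply: le_trans (ler_norm _); apply: ltW; apply: cauchy_boundP => //.
  by rewrite map_poly_eq0.
apply: moderateD; first by rewrite -(rmorph1 k); exact: moderate_cst.
apply: moderateM; first by rewrite lead_coef_map -normfV -fmorphV; apply: moderate_norm; exact: mi.
apply: (big_ind moderate) => [|a b|n _]; first by rewrite -(rmorph0 k); exact: moderate_cst.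
  exact: moderateD.
by rewrite coef_map; apply: moderate_norm; exact: mi.
Qed.
End Infinitesimal.

Section FiniteOrder.
Variables (R : realType) (N c : nat) (g : 'I_c -> {mpoly R[N]}) (s : 'I_c -> 'I_N).
Variables (v : 'I_N -> R) (r C : R).
Hypotheses (r_gt0 : 0 < r).
Hypothesis lip : forall y h h' d, nball v r y -> cball r h -> cball r h' -> 0 <= d ->
    (forall l, `|(g l).@[fun n => y n + embv s h' n] - (g l).@[fun n => y n + embv s h n]| <= d) ->
    forall m, `|h' m - h m| <= C * d.
Variables (b d : 'I_N -> R) (h : R -> 'I_c -> R) (e0 : R).
Hypothesis e0_gt0 : 0 < e0.
Hypothesis b_near : forall t, `|t| <= e0 -> nball v r (fun n => b n + t * d n).
Hypothesis h_near : forall t, `|t| <= e0 -> cball (r / 2) (h t).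
Hypothesis on_curve : forall t, `|t| <= e0 -> forall l, (g l).@[curve s b d h t] = 0.
Variable w : {mpoly R[N]}.
Local Notation W t := (w.@[curve s b d h t]).

(* If w were nonzero but flat at 0, its germ along an ultrapower would be a nonzero
   infinitesimal smaller than every power of the parameter e; by transfer the implicit
   functions h, hence w, are algebraic over R(e), which is impossible. *)
Lemma finite_order : exists m e, 0 < e /\ forall t, `|t| < e -> W t = 0 \/ `|t| ^+ m <= `|W t|.
Proof.
apply: contrapT => nfo.
(* A counterexample to order m for each m, within 1 / (m + 1) of 0; the class of these parameters is
   the infinitesimal [e]. *)
have ex m : exists t, [/\ `|t| <= e0, `|t| < (m.+1%:R)^-1, W t != 0 & `|W t| < `|t| ^+ m].
  apply: contrapT => nt; apply: nfo; exists m, (Num.min e0 (m.+1%:R)^-1); split.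
    by rewrite lt_min e0_gt0 invr_gt0 ltr0n.
  move=> t; rewrite lt_min => /andP[te0 tm].
  have [W0|W0] := eqVneq (W t) 0; [by left|right].
  rewrite leNgt; apply/negP => lt; apply: nt; exists t; split=> //; exact: ltW.
have [tau0 tau0P] := choice ex.
have [U [UU Utail0]] := tail_ultrafilter unit.
have Utail n : U [set j : seq unit * nat | (n <= j.2)%N]%classic.
  by apply: filterS (Utail0 [::] n) => j [].
pose tau (j : seq unit * nat) := tau0 j.2.
have tauP j : [/\ `|tau j| <= e0, `|tau j| < (j.2.+1%:R)^-1, W (tau j) != 0 &
    `|W (tau j)| < `|tau j| ^+ j.2] by exact: tau0P.
have [M [cl clU]] := ultrapower_exists R UU.
have [k kE] : exists k : {rmorphism R -> M}, forall a, k a = cl (fun=> a).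
  pose k : {rmorphism R -> M} :=
    HB.pack (ultra_cst cl) (GRing.isZmodMorphism.Build R M _ (ultra_cst_zmod clU))
      (GRing.isMonoidMorphism.Build R M _ (ultra_cst_monoid clU)).
  by exists k.
have cl_norm f : `|cl f| = cl (fun j => `|f j|).
  have [f0|f0] := leP 0 (cl f).
    rewrite ger0_norm //; apply/(ultra_eq_iff UU clU).
    by move/(ultra_ge0 clU): f0; apply: filterS => j /= ?; rewrite ger0_norm.
  rewrite ltr0_norm // -(ultra_opp clU); apply/(ultra_eq_iff UU clU).
  move: f0; rewrite -(ultra0 clU) => /(ultra_lt UU clU).
  by apply: filterS => j /= ?; rewrite ltr0_norm.
pose e := cl tau.
have e_inf x : 0 < x -> `|e| <= k x.
  move=> /small_inv[n nx]; rewrite cl_norm kE; apply/(ultra_le UU clU).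
  apply: filterS (Utail n) => j /= nj; have [_ h1 _ _] := tauP j.
  apply: le_trans (ltW h1) _; apply: le_trans (ltW nx).
  by rewrite lef_pV2 ?posrE ?ltr0n // ler_nat.
have e_neq0 : e != 0.
  apply/eqP => E; have : cl tau = cl (fun=> 0) by rewrite (ultra0 clU).
  move/(ultra_eq_iff UU clU) => U0.
  have [j [/= t0 j1]] := filter_ex (filterI U0 (Utail 1%N)).
  have [_ _ _] := tauP j; rewrite t0 normr0 expr0n.
  by case: (j.2) j1 => // n _; rewrite /= ltNge normr_ge0.
pose Hm m := cl (fun j => h (tau j) m).
pose Z n := cl (fun j => curve s b d h (tau j) n).
have embv_cl (f : 'I_c -> (seq unit * nat) -> R) n :
    cl (fun j => embv s (fun m => f m j) n) = embv s (fun m => cl (f m)) n.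
  rewrite /embv.
  rewrite (_ : (fun j => _) = fun j => \sum_(m < c) (fun j => f m j *+ (n == s m)) j) //.
  rewrite (ultra_sum clU (fun m j => f m j *+ (n == s m))); apply: eq_bigr => m _.
  by case: (n == s m); rewrite ?mulr1n ?mulr0n //= (ultra0 clU).
have ZE n : Z n = k (b n) + e * k (d n) + embv s Hm n.
  rewrite /Z -embv_cl /curve (ultra_add clU (fun j => b n + tau j * d n)).
  by rewrite (ultra_add clU (fun=> b n)) (ultra_mul clU tau) -!kE.
have cl_mpoly (x : 'I_N -> (seq unit * nat) -> R) q :
    mmap k (fun n => cl (x n)) q = cl (fun j => q.@[x^~ j]).
  rewrite -(_ : mmap (fun a => cl (fun=> a)) (fun n => cl (x n)) q = cl (fun j => q.@[x^~ j])).
    exact: eq_mmap.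
  by rewrite (ultra_mmap idfun x q clU).
have sfE : subfield_set [set y | exists p q : {poly R},
    y = (map_poly k p).[e] / (map_poly k q).[e]]%classic.
  split=> /=.
  - by exists 1, 1; rewrite rmorph1 hornerC divr1.
  - move=> _ _ [p [q ->]] [p' [q' ->]].
    have [q0|q0] := eqVneq (map_poly k q).[e] 0.
      by exists (- p'), q'; rewrite q0 invr0 mulr0 sub0r rmorphN hornerN mulNr.
    have [q'0|q'0] := eqVneq (map_poly k q').[e] 0.
      by exists p, q; rewrite q'0 invr0 mulr0 subr0.
    exists (p * q' - p' * q), (q * q').
    by rewrite rmorphB !rmorphM hornerD hornerN !hornerM -mulNr addf_div // mulNr.
  - move=> _ _ [p [q ->]] [p' [q' ->]]; exists (p * q'), (q * p').
    by rewrite !rmorphM !hornerM invf_div mulf_div.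
have [E [i iE]] := subfield_embedding sfE.
(* The elements of [M] algebraic over R(e), to which [moderate_root] applies. The goal is to show
   that the germ of W is one of them. *)
pose P := [set y | algebraicOver i y]%classic.
have Pcl : rel_closed P by exact: algebraic_rel_closed.
have PE p : P (map_poly k p).[e].
  have /iE[a ->] : exists p1 q1 : {poly R}, (map_poly k p).[e] = (map_poly k p1).[e] / (map_poly k q1).[e].
    by exists p, 1; rewrite rmorph1 hornerC divr1.
  exact: algebraic_id.
have Pk a : P (k a) by have := PE a%:P; rewrite map_polyC hornerC.
have Pe : P e by have := PE 'X; rewrite map_polyX hornerX.
have [F [j [jP jpos]]] := rel_closed_rcf Pcl.
have exk a : exists x, k a = j x by apply/jP.
have [kF kFE] := choice exk.
have kFB : zmod_morphism kF.
  by move=> x y; apply: (fmorph_inj j); rewrite rmorphB -!kFE rmorphB.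
have kFM : monoid_morphism kF.
  by split=> [|x y]; apply: (fmorph_inj j); rewrite ?rmorph1 ?rmorphM -!kFE ?rmorph1 ?rmorphM.
have [kf kfE] : exists kf : {rmorphism R -> F}, kf =1 kF.
  pose kf : {rmorphism R -> F} :=
    HB.pack kF (GRing.isZmodMorphism.Build R F kF kFB)
      (GRing.isMonoidMorphism.Build R F kF kFM).
  by exists kf.
have /jP[eF eFE] := Pe.
(* The equations of the implicit functions at the parameter e, over [F]; the signs of [lo] and [hi]
   express |h| < r. *)
pose zF n : {mpoly F[c]} := (kF (b n) + eF * kF (d n))%:MP + embv s (fun m => 'X_m) n.
pose eqn l : {mpoly F[c]} := mmap (@mpolyC c F \o kf) zF (g l).
pose lo m : {mpoly F[c]} := (kF r)%:MP + 'X_m.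
pose hi m : {mpoly F[c]} := (kF r)%:MP - 'X_m.
have zFE (S : comNzRingType) (f : {rmorphism F -> S}) (y : 'I_c -> S) n :
    mmap f y (zF n) = f (kF (b n)) + f eF * f (kF (d n)) + embv s y n.
  rewrite /zF mmapD mmapC /= rmorphD rmorphM; congr (_ + _).
  rewrite /embv raddf_sum; apply: eq_bigr => m _ /=.
  by rewrite raddfMn /= mmapX mmap1U.
have eqnE (S : comNzRingType) (f : {rmorphism F -> S}) (y : 'I_c -> S) l :
    mmap f y (eqn l) = mmap (f \o kf) (fun n => f (kF (b n)) + f eF * f (kF (d n)) + embv s y n) (g l).
  by rewrite /eqn mmap_mmap; apply: eq_mmap => // n; exact: zFE.
have jpos' a : (0 < j a) = (0 < (idfun : {rmorphism F -> F}) a).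
  by rewrite !lt_def fmorph_eq0 jpos.
have [y yP] := rcf_transfer (codom eqn ++ codom lo ++ codom hi) Hm jpos'.
have Hm0 l : mmap j Hm (eqn l) = 0.
  rewrite eqnE -[RHS](ultra0 clU).
  transitivity (mmap k Z (g l)).
    by apply: eq_mmap => [a|n] /=; rewrite ?kfE ?ZE -!kFE -?eFE.
  rewrite cl_mpoly; congr cl; apply/funext => t /=.
  by have [h1 _ _ _] := tauP t; exact: on_curve.
have Hmr m : k (r / 2) + Hm m >= 0 /\ k (r / 2) - Hm m >= 0.
  rewrite kE -(ultra_add clU) -(ultra_sub clU).
  by split; apply/(ultra_ge0 clU); apply: filterS filterT => t _ /=;
    have [h1 _ _ _] := tauP t; have := h_near h1 m; rewrite ler_norml => /andP[]; lra.
have kr : k r = k (r / 2) + k (r / 2) by rewrite -rmorphD -splitr.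
have kr0 : 0 < k (r / 2).
  by rewrite lt_neqAle eq_sym fmorph_eq0 gt_eqF ?divr_gt0 //= rcf_rmorph_ge0 // ltW ?divr_gt0.
have y0 l : mmap idfun y (eqn l) = 0.
  have : sgz (mmap j Hm (eqn l)) = sgz (mmap idfun y (eqn l)).
    by apply: yP; rewrite !mem_cat codom_f.
  by rewrite Hm0 sgz0 => /esym/eqP; rewrite sgz_eq0 => /eqP.
have ylo m : 0 < kF r + y m.
  have : sgz (mmap j Hm (lo m)) = sgz (mmap idfun y (lo m)).
    by apply: yP; rewrite !mem_cat codom_f orbT.
  rewrite /lo !mmapD !mmapC !mmapX !mmap1U /= -kFE => Es.
  have : 0 < k r + Hm m by have [? _] := Hmr m; rewrite kr; lra.
  by move/gtr0_sgz; rewrite Es => h1; rewrite -sgz_gt0 h1.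
have yhi m : 0 < kF r - y m.
  have : sgz (mmap j Hm (hi m)) = sgz (mmap idfun y (hi m)).
    by apply: yP; rewrite !mem_cat codom_f !orbT.
  rewrite /hi !mmapB !mmapC !mmapX !mmap1U /= -kFE => Es.
  have : 0 < k r - Hm m by have [_ ?] := Hmr m; rewrite kr; lra.
  by move/gtr0_sgz; rewrite Es => h1; rewrite -sgz_gt0 h1.
have [h' h'E] := choice (fun m => ultra_surj clU (j (y m))).
have jgt0 x : 0 < x -> 0 < j x by move=> x0; rewrite jpos'.
have Uh' m : U [set t | `|h' m t| <= r]%classic.
  have h1 : 0 < k r + cl (h' m) by rewrite -h'E kFE -rmorphD; exact: jgt0.
  have h2 : 0 < k r - cl (h' m) by rewrite -h'E kFE -rmorphB; exact: jgt0.
  move: h1 h2; rewrite kE -(ultra_add clU) -(ultra_sub clU) -(ultra0 clU).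
  move=> /(ultra_lt UU clU) h1 /(ultra_lt UU clU) h2.
  by apply: filterS2 h1 h2 => t /= h1 h2; rewrite ler_norml; lra.
have Ug l : U [set t | (g l).@[fun n => b n + tau t * d n + embv s (h'^~ t) n] = 0]%classic.
  have : j (mmap idfun y (eqn l)) = 0 by rewrite y0 rmorph0.
  rewrite -rmorph_mmap eqnE -(ultra0 clU) => Eg; apply/(ultra_eq_iff UU clU (fun t => _) (fun=> 0)).
  rewrite -Eg -(cl_mpoly (fun n t => b n + tau t * d n + embv s (h'^~ t) n)).
  apply: eq_mmap => [a|n] /=; first by rewrite kfE -kFE.
  rewrite (ultra_add clU (fun t => b n + tau t * d n)) (ultra_add clU (fun=> b n)).
  rewrite (ultra_mul clU tau) -!kE !kFE -eFE embv_cl; congr (_ + _).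
  by rewrite /embv; apply: eq_bigr => m _; rewrite -h'E.
(* The transferred solution and h lie in the ball where [lip] gives uniqueness, so they agree at
   almost all indices, and h is algebraic at e. *)
have hE m : Hm m = j (y m).
  rewrite h'E; apply/(ultra_eq_iff UU clU).
  have UA : U [set t | forall l, l \in enum 'I_c ->
      (g l).@[fun n => b n + tau t * d n + embv s (h'^~ t) n] = 0]%classic.
    by apply: filter_all => l _; exact: Ug.
  have UB : U [set t | forall m, m \in enum 'I_c -> `|h' m t| <= r]%classic.
    by apply: filter_all => l _; exact: Uh'.
  apply: filterS2 UA UB => t /= tA tB; have [h1 _ _ _] := tauP t.
  have hb : cball r (h (tau t)) by move=> m'; apply: le_trans (h_near h1 m') _; have := r_gt0; lra.
  have h'b : cball r (h'^~ t) by move=> m'; apply: tB; rewrite mem_enum.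
  apply/eqP; rewrite -subr_eq0 -normr_le0 -(mulr0 C).
  apply: (lip (b_near h1) h'b hb) => // l.
  by rewrite tA ?mem_enum // (on_curve h1 l) subrr normr0.
have PW : P (cl (fun t => W (tau t))).
  rewrite -(cl_mpoly (fun n t => curve s b d h (tau t) n)); apply/jP.
  exists (mmap kf (fun n => kF (b n) + eF * kF (d n) + embv s y n) w).
  rewrite -rmorph_mmap; apply: eq_mmap => [a|n] /=; first by rewrite kfE -kFE.
  rewrite -/(Z n) ZE !rmorphD rmorphM -!kFE -eFE; congr (_ + _).
  by rewrite /embv rmorph_sum; apply: eq_bigr => m _; rewrite rmorphMn hE.
pose Ws := cl (fun t => W (tau t)).
have Ws0 : Ws != 0.
  apply/eqP => Ws0; have : Ws = cl (fun=> 0) by rewrite (ultra0 clU).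
  move/(ultra_eq_iff UU clU) => /filter_ex[t /= t0].
  by have [_ _ /eqP] := tauP t.
have [m mP] : moderate e Ws^-1.
  apply: (moderate_root e_inf e_neq0 (i := i)) => [a|].
    by apply/iE; exists a.
  exact: algebraic_inv.
have : `|Ws| < `|e| ^+ m.
  rewrite !cl_norm -(ultra_exp clU); apply/(ultra_lt UU clU).
  apply: filterS (Utail m.+1) => t /= mt; have [_ h2 h3 h4] := tauP t.
  apply: lt_le_trans h4 _; apply: ler_wiXn2l => //; last exact: ltnW.
  by apply: le_trans (ltW h2) _; rewrite invf_le1 ?ltr0n // ler1n.
rewrite ltNge => /negP; apply; move: mP.
by rewrite normfV mulrC ler_pdivrMr ?normr_gt0 // mul1r.
Qed.
End FiniteOrder.

(** * Constancy of the sign near a regular real zero *)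

Lemma lt_sign (R : realFieldType) (a b : R) : `|b - a| < `|a| -> (0 < a -> 0 < b) /\ (a < 0 -> b < 0).
Proof.
move=> H; split=> a0; move: H; [rewrite (gtr0_norm a0)|rewrite (ltr0_norm a0)];
by rewrite ltr_norml => /andP[]; lra.
Qed.

(** Let s0 be the supremum of the points where W > 0. By continuity W vanishes there. A positive
    sign around s0 is excluded by the points to its right, and a negative or zero one by points
    where W > 0 arbitrarily close to its left. *)
Lemma no_sign_change (R : realType) (W : R -> R) L : 0 <= L ->
  (forall t u, `|t| <= 2 -> `|u| <= 2 -> `|W t - W u| <= L * `|t - u|) ->
  (forall x, 0 <= x <= 1 -> exists2 e, 0 < e &
    [\/ forall t, `|t| < e -> W (x + t) = 0,
        forall t, 0 < `|t| < e -> 0 < W (x + t) |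
        forall t, 0 < `|t| < e -> W (x + t) < 0]) ->
  0 < W 0 -> 0 <= W 1.
Proof.
move=> L0 WL Wsgn W0; rewrite leNgt; apply/negP => W1.
pose S := [set t | 0 <= t <= 1 /\ 0 < W t]%classic.
have S0 : S 0 by rewrite /S /= lexx ler01.
have Sub : has_ubound S by exists 1 => t [/andP[]].
have Ssup : has_sup S by split=> //; exists 0.
pose s0 := sup S.
have s00 : 0 <= s0 by exact: ub_le_sup.
have s01 : s0 <= 1 by apply: ge_sup; [exists 0|move=> t [/andP[]]].
have Sgt t : s0 < t -> t <= 1 -> W t <= 0.
  move=> st t1; rewrite leNgt; apply/negP => Wt.
  have : t <= s0 by apply: ub_le_sup => //; rewrite /S /= t1 Wt (le_trans s00) ?ltW.
  by rewrite leNgt st.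
have Sadj e : 0 < e -> exists t, [/\ 0 <= t, t <= s0, s0 - e < t & 0 < W t].
  move=> e0; have [t [/andP[t0 t1] Wt] et] := sup_adherent e0 Ssup.
  by exists t; split=> //; apply: ub_le_sup => //; rewrite /S /= t0 t1.
have s02 t : `|t| <= 1 -> `|s0 + t| <= 2.
  by move=> t1; apply: le_trans (ler_normD _ _) _; rewrite ger0_norm //; lra.
have cont : W s0 != 0 -> exists2 e, 0 < e <= 1 & forall t, `|t| < e ->
    (0 < W s0 -> 0 < W (s0 + t)) /\ (W s0 < 0 -> W (s0 + t) < 0).
  move=> Ws; exists (Num.min 1 (`|W s0| / (L + 1))).
    by rewrite lt_min ltr01 divr_gt0 ?normr_gt0 ?ltr_wpDl //= ge_min lexx.
  move=> t; rewrite lt_min => /andP[t1]; rewrite ltr_pdivlMr ?ltr_wpDl // => tL.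
  apply: lt_sign; apply: le_lt_trans tL.
  have := WL (s0 + t) s0 (s02 _ (ltW t1)); rewrite [s0 + t]addrC addrK => H.
  apply: le_trans (H _) _; first by rewrite ger0_norm //; lra.
  by rewrite mulrC ler_wpM2l // lerDl.
have s0lt1 : 0 <= W s0 -> s0 < 1.
  by move=> Ws; rewrite lt_neqAle s01 andbT; apply/eqP => s1; move: Ws; rewrite s1; lra.
have Ws0 : W s0 = 0.
  apply/eqP; apply: contrapT => /negP Wn; have [e /andP[e0 e1] eP] := cont Wn.
  have [Ws|Ws|//] := ltgtP (W s0) 0; last by move/eqP: Wn.
    have [t [t0 ts st Wt]] := Sadj e e0.
    have te : `|t - s0| < e by rewrite ltr_norml; lra.
    by have [_ /(_ Ws)] := eP _ te; rewrite addrC subrK; lra.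
  have s1 := s0lt1 (ltW Ws); pose t := Num.min (e / 2) (1 - s0).
  have t0 : 0 < t by rewrite lt_min divr_gt0 // subr_gt0.
  have te : `|t| < e by rewrite gtr0_norm // gt_min; apply/orP; left; lra.
  have t1 : t <= 1 - s0 by rewrite ge_min lexx orbT.
  have [/(_ Ws) Wt _] := eP _ te.
  have : W (s0 + t) <= 0 by apply: Sgt; lra.
  lra.
have s1 : s0 < 1 by apply: s0lt1; rewrite Ws0.
have s01' : 0 <= s0 <= 1 by rewrite s00.
have [e e0 [eP|eP|eP]] := Wsgn s0 s01'.
- have [t [t0 ts st Wt]] := Sadj e e0.
  have te : `|t - s0| < e by rewrite ltr_norml; lra.
  by have := eP _ te; rewrite addrC subrK; lra.
- pose t := Num.min (e / 2) (1 - s0).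
  have t0 : 0 < t by rewrite lt_min divr_gt0 // subr_gt0.
  have te : `|t| < e by rewrite gtr0_norm // gt_min; apply/orP; left; lra.
  have t1 : t <= 1 - s0 by rewrite ge_min lexx orbT.
  have Wt : 0 < W (s0 + t) by apply: eP; rewrite te normr_gt0 gt_eqF.
  have : W (s0 + t) <= 0 by apply: Sgt; lra.
  lra.
- have [t [t0 ts st Wt]] := Sadj e e0.
  have tn : t != s0 by apply/eqP => E; move: Wt; rewrite E Ws0 ltxx.
  have te : 0 < `|t - s0| < e by rewrite normr_gt0 subr_eq0 tn ltr_norml; lra.
  by have := eP _ te; rewrite addrC subrK; lra.
Qed.

Section LocalSign.
Variables (R : realType) (N c : nat) (g : 'I_c -> {mpoly R[N]}) (s : 'I_c -> 'I_N).
Variable v : 'I_N -> R.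
Local Notation zero_at y := (forall l, (g l).@[y] = 0).
Hypotheses (gv : zero_at v) (jv : jac g s v \in unitmx).
Variables (w : {mpoly R[N]}) (A : seq {mpoly R[N]}).
Hypothesis rel : exists2 rho, 0 < rho & forall y, nball v rho y -> zero_at y ->
  w.@[y] ^+ 2 = \sum_(a <- A) a.@[y] ^+ 4.

Lemma jac_unit_near : exists2 rho, 0 < rho & forall y, nball v rho y -> jac g s y \in unitmx.
Proof.
pose p := \det (\matrix_(l, m) (g l)^`M(s m)).
have pE y : p.@[y] = \det (jac g s y).
  by rewrite /p -det_map_mx; congr (\det _); apply/matrixP => l m; rewrite !mxE.
have pv : p.@[v] != 0 by rewrite pE -unitfE -unitmxE.
have pv2 : 0 < `|p.@[v]| / 2 by rewrite divr_gt0 ?normr_gt0.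
have [d d0 dP] := meval_continuous p v pv2; exists d => // y yd.
rewrite unitmxE unitfE -pE; apply/eqP => py.
by have := dP y yd; rewrite py sub0r normrN; lra.
Qed.

(* Join the two points by a segment and lift it to the zero set by the implicit functions;
   w cannot change sign at the last point up to which it is positive. *)
Lemma local_sign : exists2 rho, 0 < rho & forall y z, nball v rho y -> nball v rho z ->
  zero_at y -> zero_at z -> 0 < w.@[y] -> 0 <= w.@[z].
Proof.
have [ra ra0 [C C0 lip0]] := newton_lipschitz jv.
have [rb rb0 relP] := rel; have [rc rc0 jacP] := jac_unit_near.
(* With (c + 1) r below [rb] and [rc], all lifted points satisfy the relation and have an invertible
   Jacobian matrix. *)
pose r := Num.min ra (Num.min rb rc / (c%:R + 1)).
have c1 : 0 < c%:R + 1 :> R by rewrite ltr_wpDl // ler0n.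
have r0 : 0 < r by rewrite lt_min ra0 divr_gt0 // lt_min rb0.
have rra : r <= ra by rewrite ge_min lexx.
have rbc : (c%:R + 1) * r <= Num.min rb rc by rewrite mulrC -ler_pdivlMr // ge_min lexx orbT.
have lip y h h' d : nball v r y -> cball r h -> cball r h' -> 0 <= d ->
    (forall l, `|(g l).@[fun n => y n + embv s h' n] - (g l).@[fun n => y n + embv s h n]| <= d) ->
    forall m, `|h' m - h m| <= C * d.
  by move=> yr hr h'r; apply: lip0 => n; apply: le_trans rra.
have near y h : nball v r y -> cball r h -> nball v (Num.min rb rc) (fun n => y n + embv s h n).
  move=> yr hr n; apply: le_trans rbc; rewrite addrAC mulrDl mul1r addrC.
  apply: le_trans (ler_normD _ _) _; apply: lerD; last exact: yr.
  exact: embv_bound.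
have r20 : 0 < r / 2 by rewrite divr_gt0.
have [r1 r10 sol] := newton_solution jv r20 gv.
(* For |t| <= 2 the point b t is within rho + 2 (2 rho) = 5 rho of [v]. The bound 2 covers s0 + t
   with s0 in [0, 1] and |t| <= 1. *)
exists (Num.min r r1 / 5); first by rewrite divr_gt0 // lt_min r0.
set rho := Num.min r r1 / 5 => y z yv zv gy gz wy; rewrite leNgt; apply/negP => wz.
have rho5 : 5 * rho <= r /\ 5 * rho <= r1.
  have -> : 5 * rho = Num.min r r1 by rewrite /rho mulrC divfK ?pnatr_eq0.
  by split; rewrite ge_min lexx ?orbT.
pose b (t : R) n := y n + t * (z n - y n).
have bv t : `|t| <= 2 -> nball v (5 * rho) (b t).
  move=> t2 n; rewrite /b.
  have -> : y n + t * (z n - y n) - v n = (y n - v n) + t * ((z n - v n) - (y n - v n)) by ring.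
  apply: le_trans (ler_normD _ _) _; rewrite normrM.
  have h1 : `|z n - v n - (y n - v n)| <= 2 * rho.
    by apply: le_trans (ler_normB _ _) _; have := yv n; have := zv n; lra.
  have : `|t| * `|z n - v n - (y n - v n)| <= 2 * (2 * rho) by rewrite ler_pM.
  by have := yv n; lra.
have bvr t : `|t| <= 2 -> nball v r (b t).
  by move=> t2 n; apply: le_trans (bv t t2 n) _; case: rho5.
have hex t : exists h, `|t| <= 2 -> cball (r / 2) h /\ zero_at (fun n => b t n + embv s h n).
  have [t2|t2] := leP `|t| 2; last by exists (fun=> 0) => h; exfalso; lra.
  have br1 : nball v r1 (b t) by move=> n; apply: le_trans (bv t t2 n) _; case: rho5.
  by have [h hr gh] := sol _ br1; exists h.
have [h hP] := choice hex.
have cb t : `|t| <= 2 -> cball r (h t).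
  by move=> /hP[hr _] m; apply: le_trans (hr m) _; lra.
have hu t h' : `|t| <= 2 -> cball r h' -> zero_at (fun n => b t n + embv s h' n) -> h' =1 h t.
  move=> t2 h'r gh' m; apply/eqP; rewrite -subr_eq0 -normr_le0 -(mulr0 C).
  apply: (lip (b t)) => // [||l]; [exact: bvr|exact: cb|].
  by have [_ gh] := hP t t2; rewrite gh gh' subrr normr0.
pose W t := w.@[fun n => b t n + embv s (h t) n].
have c0 : cball r (fun _ : 'I_c => 0).
  by move=> m; rewrite normr0 ltW.
(* Where b t already satisfies the equations, uniqueness makes its lift trivial; this is used for
   both end points. *)
have h0 x t : `|t| <= 2 -> b t =1 x -> zero_at x -> W t = w.@[x].
  move=> t2 bx gx; rewrite /W; congr (w.@[_]); apply/funext => n.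
  have H m : h t m = 0.
    rewrite -(hu t (fun=> 0)) // => l; rewrite -[RHS](gx l); congr ((g l).@[_]); apply/funext => k.
    by rewrite /embv big1 ?addr0 ?bx // => ? _; exact: mul0rn.
  by rewrite /embv big1 ?addr0 // => m _; rewrite H mul0rn.
have W0 : 0 < W 0.
  by rewrite (h0 y) ?normr0 // => n; rewrite /b mul0r addr0.
have W1 : W 1 < 0.
  by rewrite (h0 z) ?normr1 // => [|n]; [lra|rewrite /b mul1r addrC subrK].
have Wlip : exists2 L, 0 <= L & forall t u, `|t| <= 2 -> `|u| <= 2 -> `|W t - W u| <= L * `|t - u|.
  pose B := \sum_n `|v n| + (c%:R + 1) * r.
  have bound t h' : `|t| <= 2 -> cball r h' -> forall n, `|b t n + embv s h' n| <= B.
    move=> t2 h'r n; rewrite -[_ + _](subrK (v n)); apply: le_trans (ler_normD _ _) _.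
    rewrite addrC; apply: lerD; first by rewrite (bigD1 n) //= lerDl sumr_ge0.
    rewrite addrAC mulrDl mul1r addrC; apply: le_trans (ler_normD _ _) _.
    by apply: lerD; [exact: embv_bound|exact: bvr].
  have [Lw Lw0 LwP] := meval_lipschitz B w.
  have /choice[Lg LgP] l : exists L, 0 <= L /\ forall x x' d, (forall n, `|x n| <= B) ->
      (forall n, `|x' n| <= B) -> (forall n, `|x n - x' n| <= d) -> 0 <= d ->
      `|(g l).@[x] - (g l).@[x']| <= L * d.
    by have [L L0 LP] := meval_lipschitz B (g l); exists L.
  pose G := \sum_l Lg l.
  have G0 : 0 <= G by rewrite sumr_ge0 // => l _; case: (LgP l).
  have rho0 : 0 <= 2 * rho by apply: mulr_ge0 => //; apply: divr_ge0 => //; rewrite le_min !ltW.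
  have CG : 0 <= C * G by apply: mulr_ge0 => //; exact: ltW.
  have K0 : 0 <= 1 + c%:R * (C * G) by apply: addr_ge0 => //; apply: mulr_ge0 => //; exact: ler0n.
  exists (Lw * ((1 + c%:R * (C * G)) * (2 * rho))).
    by apply: mulr_ge0 => //; exact: mulr_ge0.
  move=> t u t2 u2; pose d := `|t - u| * (2 * rho).
  have d0 : 0 <= d by exact: mulr_ge0.
  have bd n : `|b t n - b u n| <= d.
    have -> : b t n - b u n = (t - u) * ((z n - v n) - (y n - v n)) by rewrite /b; ring.
    rewrite normrM ler_wpM2l //; apply: le_trans (ler_normB _ _) _.
    by have := yv n; have := zv n; lra.
  have hd m : `|h t m - h u m| <= C * (G * d).
    rewrite distrC; apply: (lip (b t)); [exact: bvr|exact: cb|exact: cb|exact: mulr_ge0|] => l.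
    have [_ gt] := hP t t2; have [_ gu] := hP u u2.
    rewrite gt -(gu l); apply: le_trans (_ : Lg l * d <= _).
      have [_ H] := LgP l; apply: H => //; [exact: bound (cb _ _)|exact: bound (cb _ _)|].
      by move=> n; rewrite opprD addrACA subrr addr0.
    rewrite ler_wpM2r // /G (bigD1 l) //= lerDl sumr_ge0 // => k _; by case: (LgP k).
  have -> : Lw * ((1 + c%:R * (C * G)) * (2 * rho)) * `|t - u| = Lw * ((1 + c%:R * (C * G)) * d).
    by rewrite /d; ring.
  apply: LwP; [exact: bound (cb _ _)|exact: bound (cb _ _)| |].
    move=> n; rewrite opprD addrACA mulrDl mul1r -embvB; apply: le_trans (ler_normD _ _) _.
    by apply: lerD => //; rewrite -!mulrA; apply: embv_bound.
  exact: mulr_ge0.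
have [L L0 WL] := Wlip.
have : 0 <= W 1; last by rewrite leNgt W1.
apply: (no_sign_change L0 WL) => // s0 /andP[s00 s01].
have s02 t : `|t| <= 1 -> `|s0 + t| <= 2.
  by move=> t1; apply: le_trans (ler_normD _ _) _; rewrite ger0_norm //; lra.
have bs0 t : b (s0 + t) = fun n => b s0 n + t * (z n - y n).
  by apply/funext => n; rewrite /b; ring.
have cE t : curve s (b s0) (fun n => z n - y n) (fun t => h (s0 + t)) t =
    fun n => b (s0 + t) n + embv s (h (s0 + t)) n.
  by apply/funext => n; rewrite /curve bs0.
have b_near t : `|t| <= 1 -> nball v r (fun n => b s0 n + t * (z n - y n)).
  by move=> t1; rewrite -bs0; apply: bvr; exact: s02.
have h_near t : `|t| <= 1 -> cball (r / 2) (h (s0 + t)).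
  by move=> t1; case: (hP _ (s02 _ t1)).
have on_curve t : `|t| <= 1 -> forall l, (g l).@[curve s (b s0) (fun n => z n - y n) (fun t => h (s0 + t)) t] = 0.
  by move=> t1 l; rewrite cE; case: (hP _ (s02 _ t1)).
have near0 t : `|t| <= 1 -> nball v (Num.min rb rc) (fun n => b (s0 + t) n + embv s (h (s0 + t)) n).
  by move=> t1; apply: near; [exact: bvr (s02 _ t1)|exact: cb (s02 _ t1)].
have jac0 : jac g s (curve s (b s0) (fun n => z n - y n) (fun t => h (s0 + t)) 0) \in unitmx.
  rewrite cE; apply: jacP => n; have n0 : `|0 : R| <= 1 by rewrite normr0.
  by apply: le_trans (near0 _ n0 n) _; rewrite ge_min lexx orbT.
have wA t : `|t| <= 1 -> w.@[curve s (b s0) (fun n => z n - y n) (fun t => h (s0 + t)) t] ^+ 2 =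
    \sum_(a <- A) a.@[curve s (b s0) (fun n => z n - y n) (fun t => h (s0 + t)) t] ^+ 4.
  move=> t1; rewrite cE; apply: relP; last by case: (hP _ (s02 _ t1)).
  by move=> n; apply: le_trans (near0 _ t1 n) _; rewrite ge_min lexx.
have fo := finite_order r0 lip ltr01 b_near h_near on_curve w.
have [e e0 eP] := curve_sign r0 C0 lip ltr01 b_near h_near on_curve jac0 wA fo.
exists e => //.
by case: eP => eP; [apply: Or31|apply: Or32|apply: Or33] => t /eP; rewrite cE.
Qed.
End LocalSign.

(** * Homogeneous primes and the function field *)


Notation hcomp d p := (pihomog (Measure.clone _ mdeg _) d p).

Section Homogeneous.
Variables (R S : comNzRingType) (N : nat).
Implicit Types (p q F : {mpoly R[N]}).

Lemma rmorph_mpoly (theta : {rmorphism {mpoly R[N]} -> S}) p :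
  theta p = mmap (theta \o @mpolyC N R) (fun l => theta 'X_l) p.
Proof.
elim/mpoly_ring_ind: p => [c|i|p q Ep Eq|p q Ep Eq].
- by rewrite mmapC.
- by rewrite mmapX mmap1U.
- by rewrite rmorphD mmapD Ep Eq.
- by rewrite rmorphM /= rmorphM /= -Ep -Eq.
Qed.

Lemma mmap_homog (f : {rmorphism R -> S}) (x : 'I_N -> S) c d F : F \is d.-homog ->
  mmap f (fun l => c * x l) F = c ^+ d * mmap f x F.
Proof.
move=> /dhomogP Fd; rewrite /mmap mulr_sumr big_seq [RHS]big_seq; apply: eq_bigr => m mF.
rewrite mulrCA; congr (_ * _); rewrite /mmap1 -(Fd m mF) /= mdegE -prodrXr -big_split /=.
by apply: eq_bigr => i _; rewrite exprMn.
Qed.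

Lemma homog_components p : p = \sum_(d < msize p) hcomp d p.
Proof. exact: pihomog_partitionE. Qed.

Lemma hcompM d e p F : F \is e.-homog -> hcomp (d + e) (p * F) = hcomp d p * F.
Proof.
move=> Fe; rewrite {1}[p]homog_components mulr_suml raddf_sum /=.
have H k : hcomp (d + e) (hcomp k p * F) = if k == d then hcomp d p * F else 0.
  have hk : hcomp k p * F \is (k + e).-homog by apply: dhomogM => //; exact: pihomogP.
  have [<-|kd] := eqVneq k d; first exact: pihomog_dE.
  by apply: (pihomog_ne0 _ hk); rewrite eqn_add2r.
under eq_bigr do rewrite H.
have [dp|dp] := ltnP d (msize p); first by rewrite -big_mkcond (big_pred1 (Ordinal dp)).
rewrite big1 => [|i _]; last by rewrite ltn_eqF // (leq_trans (ltn_ord i)).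
rewrite (pihomogwE _ _ (leqnn (msize p))) big1 ?mul0r // => m /eqP md.
by have := leq_trans (bmdeg m) dp; rewrite -[X in (_ < X)%N]md ltnn.
Qed.

Lemma hcomp_lt d e p F : F \is e.-homog -> (d < e)%N -> hcomp d (p * F) = 0.
Proof.
move=> Fe de; rewrite [p]homog_components mulr_suml raddf_sum /= big1 // => k _.
have hk : hcomp k p * F \is (k + e).-homog by apply: dhomogM => //; exact: pihomogP.
by apply: (pihomog_ne0 _ hk); rewrite gtn_eqF // (leq_trans de) // leq_addl.
Qed.

Lemma mderiv_homog d i F : F \is d.-homog -> F^`M(i) \is d.-1.-homog.
Proof.
move=> /dhomogP Fd; apply/dhomogP => m.
rewrite mcoeff_msupp mcoeff_mderiv => mF.
have : (m + U_(i))%MM \in msupp F.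
  by rewrite mcoeff_msupp; apply: contraNneq mF => ->; rewrite mul0rn.
by move/Fd; rewrite /= mdegD mdeg1 addn1 => <-.
Qed.
End Homogeneous.

(* The largest homogeneous ideal in the kernel of [phi] is the kernel of
   X_l |-> phi X_l * T, with values in a polynomial ring. *)
Section HomogPrime.
Variables (k : comNzRingType) (D : idomainType) (N : nat) (phi : {rmorphism {mpoly k[N]} -> D}).

Definition graded_map : {mpoly k[N]} -> {poly D} :=
  mmap (@polyC D \o (phi \o @mpolyC N k)) (fun l => 'X * (phi 'X_l)%:P).

Lemma graded_mapE d F : F \is d.-homog -> graded_map F = 'X^d * (phi F)%:P.
Proof.
move=> Fd; rewrite /graded_map (mmap_homog _ _ _ Fd); congr (_ * _).
by rewrite (rmorph_mmap (@polyC D)) -rmorph_mpoly.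
Qed.

Definition graded_kernel : {pred {mpoly k[N]}} := fun F => graded_map F == 0.

Lemma graded_kernel_idealr : idealr_closed graded_kernel.
Proof.
split; rewrite ?inE /graded_kernel /in_mem /=.
- by rewrite /graded_map mmap0.
- by rewrite /graded_map rmorph1 oner_eq0.
- move=> a u v; rewrite /in_mem /= /graded_map => /eqP u0 /eqP v0.
  by rewrite rmorphD rmorphM /= u0 v0 mulr0 addr0.
Qed.

Lemma graded_kernel_prime : prime_idealr_closed graded_kernel.
Proof.
move=> u v; rewrite /in_mem /= /graded_kernel /graded_map rmorphM /=.
by rewrite mulf_eq0.
Qed.

HB.instance Definition _ := isIdealr.Build _ graded_kernel graded_kernel_idealr.
HB.instance Definition _ := isPrimeIdealrClosed.Build _ graded_kernel graded_kernel_prime.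

Definition homog_prime : prime_idealr {mpoly k[N]} := graded_kernel.

Lemma homog_primeE d F : F \is d.-homog -> (F \in homog_prime) = (phi F == 0).
Proof.
move=> Fd; have -> : (F \in homog_prime) = (graded_map F == 0) by [].
by rewrite (graded_mapE Fd) mulf_eq0 polyC_eq0 expf_eq0 polyX_eq0 andbF.
Qed.

Lemma graded_map_coef d F : (graded_map F)`_d = phi (hcomp d F).
Proof.
rewrite {1}[F]homog_components /graded_map raddf_sum /= coef_sum.
have H e : (graded_map (hcomp e F))`_d = if e == d then phi (hcomp d F) else 0.
  rewrite (graded_mapE (pihomogP _ _ _)) coefMC coefXn eq_sym.
  by case: eqP => [->|_]; rewrite ?mul1r ?mul0r.
under eq_bigr do rewrite H.
have [dp|dp] := ltnP d (msize F); first by rewrite -big_mkcond (big_pred1 (Ordinal dp)).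
rewrite big1 => [|i _]; last by rewrite ltn_eqF // (leq_trans (ltn_ord i)).
rewrite (pihomogwE _ _ (leqnn (msize F))) big1 ?rmorph0 // => m /eqP md.
by have := leq_trans (bmdeg m) dp; rewrite -[X in (_ < X)%N]md ltnn.
Qed.
End HomogPrime.

Lemma homog_prime_homog (k : fieldType) (D : idomainType) n (phi : {rmorphism {mpoly k[n.+1]} -> D}) :
  homog_ideal (homog_prime phi).
Proof.
move=> d p; rewrite (homog_primeE _ (pihomogP _ _ _)) -graded_map_coef => /eqP p0.
by move: p0; rewrite /graded_map => ->; rewrite coef0.
Qed.

Lemma quotient_cancel (L : fieldType) (a b x : L) : x != 0 -> a / x / (b / x) = a / b.
Proof. by move=> x0; rewrite invf_div mulrA divfK. Qed.

(** * Dehomogenization into the function field *)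

Section FunctionFieldMap.
Variables (k : fieldType) (n : nat) (I : prime_idealr {mpoly k[n.+1]}).
Hypothesis homI : homog_ideal I.
Variable j : 'I_n.+1.
Hypothesis jI : 'X_j \notin I.
Local Notation K := (function_field I).

Definition coord_frac (p : {mpoly k[n.+1]}) : {fraction coord_ring I} :=
  FracField.tofrac (coord I p).

Fact coord_frac_zmod : zmod_morphism coord_frac.
Proof. by move=> p q; rewrite /coord_frac coordB tofracB. Qed.
Fact coord_frac_monoid : monoid_morphism coord_frac.
Proof. by split=> [|p q]; rewrite /coord_frac ?coord1 ?tofrac1 // coordM tofracM. Qed.
HB.instance Definition _ := GRing.isZmodMorphism.Build _ _ coord_frac coord_frac_zmod.
HB.instance Definition _ := GRing.isMonoidMorphism.Build _ _ coord_frac coord_frac_monoid.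

Lemma coord_frac_eq0 p : (coord_frac p == 0) = (p \in I).
Proof. by rewrite tofrac_eq0 coord_eq0. Qed.

Fact ffcst_subproof a : coord_frac a%:MP \in @degree0 k n I.
Proof.
apply/asboolP; exists 0%N, a%:MP, 1; split; rewrite ?dhomog1 ?idealr1 //.
  by rewrite -[a%:MP]mulr1 mul_mpolyC; apply: rpredZ; exact: dhomog1.
by rewrite /quotient_of_forms coord1 tofrac1 divr1.
Qed.
Fact ffvar_subproof l : coord_frac 'X_l / coord_frac 'X_j \in @degree0 k n I.
Proof. by apply/asboolP; exists 1%N, 'X_l, 'X_j; split; rewrite ?dhomogX /= ?mdeg1. Qed.

Definition ffcst a : K := SubfieldElt (ffcst_subproof a).
Definition ffvar l : K := SubfieldElt (ffvar_subproof l).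

Fact ffcst_zmod : zmod_morphism ffcst.
Proof.
by move=> a b; apply: val_inj; rewrite rmorphB /= mpolyCB rmorphB.
Qed.
Fact ffcst_monoid : monoid_morphism ffcst.
Proof.
split=> [|a b]; apply: val_inj; first by rewrite rmorph1 /= mpolyC1 rmorph1.
by rewrite rmorphM /= mpolyCM rmorphM.
Qed.
HB.instance Definition _ := GRing.isZmodMorphism.Build _ _ ffcst ffcst_zmod.
HB.instance Definition _ := GRing.isMonoidMorphism.Build _ _ ffcst ffcst_monoid.

(** Dehomogenization at X_j: a form F of degree d goes to F / X_j^d. It is a ring morphism on all
    polynomials, and gives quotients of forms of equal degree their meaning in the function
    field. *)
Definition psi : {rmorphism {mpoly k[n.+1]} -> K} := mmap ffcst ffvar.

Lemma val_psi d F : F \is d.-homog -> val (psi F) = coord_frac F / coord_frac 'X_j ^+ d.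
Proof.
move=> Fd; have -> := esym (rmorph_mmap (val : {rmorphism K -> _}) ffcst ffvar F).
have -> : mmap (val \o ffcst) (val \o ffvar) F =
    mmap (coord_frac \o @mpolyC n.+1 k) (fun l => (coord_frac 'X_j)^-1 * coord_frac 'X_l) F.
  by apply: eq_mmap => // l; rewrite /= mulrC.
by rewrite (mmap_homog _ _ _ Fd) -rmorph_mpoly mulrC exprVn.
Qed.

Lemma psi_eq0 d F : F \is d.-homog -> (psi F == 0) = (F \in I).
Proof.
move=> Fd; have -> : (psi F == 0) = (val (psi F) == 0).
  exact: esym (fmorph_eq0 (val : {rmorphism K -> _}) (psi F)).
rewrite (val_psi Fd) mulf_eq0 invr_eq0.
by rewrite expf_eq0 !coord_frac_eq0 (negbTE jI) andbF orbF.
Qed.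

Lemma psi_ideal p : p \in I -> psi p = 0.
Proof.
move=> pI; rewrite [p]homog_components rmorph_sum big1 // => d _; apply/eqP.
by rewrite (psi_eq0 (pihomogP _ _ _)) homI.
Qed.

Lemma local_ringP (P : prime_idealr {mpoly k[n.+1]}) (x : K) : {subset I <= P} ->
  local_ring P x <-> exists d F G, [/\ F \is d.-homog, G \is d.-homog, G \notin P & x = psi F / psi G].
Proof.
move=> IP.
have H d F G : F \is d.-homog -> G \is d.-homog -> G \notin P ->
    val (psi F / psi G) = quotient_of_forms I F G.
  move=> Fd Gd GP; have -> := fmorph_div (val : {rmorphism K -> _}) (psi F) (psi G).
  rewrite [LHS]/(val (psi F) / val (psi G)) (val_psi Fd) (val_psi Gd) /quotient_of_forms.
  have X0 : coord_frac 'X_j ^+ d != 0 by rewrite expf_eq0 coord_frac_eq0 (negbTE jI) andbF.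
  exact: quotient_cancel.
split=> [[d [F [G [Fd Gd GP xE]]]]|[d [F [G [Fd Gd GP ->]]]]]; exists d, F, G; split=> //.
  by apply: val_inj; rewrite (H d).
exact: H Gd GP.
Qed.

Lemma local_ring_generic (x : K) : local_ring I x.
Proof. exact/asboolP/(valP x). Qed.

Lemma psi_repr (x : K) : exists d F G, [/\ F \is d.-homog, G \is d.-homog, G \notin I & x = psi F / psi G].
Proof. by apply/(local_ringP _ (P := I)) => //; exact: local_ring_generic. Qed.
End FunctionFieldMap.

(** * Separation of the signs of a form on the real points *)


Lemma meval_homog (R : comNzRingType) N (F : {mpoly R[N]}) d (t : R) (y : 'I_N -> R) :
  F \is d.-homog -> F.@[fun l => t * y l] = t ^+ d * F.@[y].
Proof. exact: mmap_homog. Qed.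

Lemma poly_nonroot (R : numFieldType) (p : {poly R}) : p != 0 -> exists t, p.[t] != 0.
Proof.
move=> p0; apply: contrapT => nt.
have r0 t : root p t by apply/eqP; apply: contrapT => pt; apply: nt; exists t; apply/eqP.
have : (size [seq i%:R : R | i <- iota 0 (size p)] < size p)%N.
  apply: max_poly_roots => //; first by apply/allP => t _; exact: r0.
  by rewrite map_inj_uniq ?iota_uniq // => a b /eqP; rewrite eqr_nat => /eqP.
by rewrite size_map size_iota ltnn.
Qed.

Section RealPoint.
Variables (R : realType) (n : nat) (I : prime_idealr {mpoly R[n.+1]}).
Hypotheses (homI : homog_ideal I) (smoothI : smooth_variety I).
Variables (w : {mpoly R[n.+1]}) (A : seq {mpoly R[n.+1]}) (e : nat).
Hypothesis wA_homog : w ^+ 2 - \sum_(a <- A) a ^+ 4 \is e.-homog.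
Hypothesis wA_I : w ^+ 2 - \sum_(a <- A) a ^+ 4 \in I.

(* The real point v is the homogeneous prime of the forms vanishing at v. *)
Lemma real_point_sign (v : 'I_n.+1 -> R) : (exists i, v i != 0) -> (forall p, p \in I -> p.@[v] = 0) ->
  exists gs : seq {mpoly R[n.+1]}, (forall g, g \in gs -> g \in I /\ exists d, g \is d.-homog) /\
  exists2 rho, 0 < rho & forall y z, nball v rho y -> nball v rho z ->
    (forall g, g \in gs -> g.@[y] = 0) -> (forall g, g \in gs -> g.@[z] = 0) ->
    0 < w.@[y] -> 0 <= w.@[z].
Proof.
move=> [i vi] Iv; pose phi : {rmorphism {mpoly R[n.+1]} -> R} := meval v.
pose P := homog_prime phi.
have gmE t p : (graded_map phi p).[t] = p.@[fun l => t * v l].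
  have -> : graded_map phi p = mmap polyC (fun l => 'X * (v l)%:P) p.
    by apply: eq_mmap => [a|l] /=; rewrite ?mevalC ?mevalXU.
  rewrite horner_mmap; congr (p.@[_]); apply/funext => l.
  by rewrite hornerM hornerX hornerC.
have PI : scheme_point I P.
  split; first exact: homog_prime_homog.
    exists i; have X1 : 'X_i \is 1.-homog for mdeg by move=> ?; rewrite dhomogX /= mdeg1.
    by rewrite (homog_primeE phi (X1 R)) /= mevalXU.
  move=> p pI; have -> : (p \in P) = (graded_map phi p == 0) by [].
  apply/eqP; apply/(@polyP R) => d.
  by rewrite graded_map_coef coef0 /phi /= Iv // homI.
have [i0 [c [g [s [_ gI gen _ detP]]]]] := smoothI PI.
have /choice[dg dgP] l : exists d, g l \is d.-homog by case: (gI l).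
exists (codom g); split=> [_ /codomP[l ->]|]; first exact: gI.
have gv l : (g l).@[v] = 0 by apply: Iv; case: (gI l).
have jv : jac g s v \in unitmx.
  rewrite unitmxE unitfE; apply: contraNneq detP => det0.
  rewrite [_ \in _]/(graded_map phi _ == 0) /graded_map -det_map_mx.
  set B := map_mx _ _.
  (* At t v a partial derivative of a form is t^(degree - 1) times its value at v, so det B is a
     power of X times the Jacobian determinant at v. *)
  have -> : B = diag_mx (\row_l 'X^((dg l).-1)) *m map_mx (@polyC R) (jac g s v).
    apply/matrixP => l m; rewrite mul_diag_mx !mxE.
    exact: (graded_mapE phi (mderiv_homog (s m) (dgP l))).
  rewrite det_mulmx det_map_mx det0 rmorph0 mulr0; exact: eqxx.
have [h [hP [a ha]]] := gen _ wA_I.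
(* [h] is not a form: it may vanish at [v], but not on the whole line through [v]. The factor X
   makes [t0] nonzero, and homogeneity brings the relation from t0 v back to v. *)
have hq : graded_map phi h * 'X != 0 by rewrite mulf_neq0 ?polyX_eq0.
have [t0] := poly_nonroot hq; rewrite hornerM hornerX mulf_eq0 negb_or gmE => /andP[ht0 t00].
have ht2 : 0 < `|h.@[fun l => t0 * v l]| / 2 by rewrite divr_gt0 ?normr_gt0.
have [d d0 dP] := meval_continuous h (fun l => t0 * v l) ht2.
have rel : exists2 rho, 0 < rho & forall y, nball v rho y -> (forall l, (g l).@[y] = 0) ->
    w.@[y] ^+ 2 = \sum_(a <- A) a.@[y] ^+ 4.
  exists (d / `|t0|); first by rewrite divr_gt0 ?normr_gt0.
  move=> y yv gy; pose x l := t0 * y l.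
  have hx : h.@[x] != 0.
    apply/eqP => hx; have := dP x; rewrite hx sub0r normrN => H.
    have : `|h.@[fun l => t0 * v l]| <= `|h.@[fun l => t0 * v l]| / 2.
      by apply: H => l; rewrite /x -mulrBr normrM mulrC -ler_pdivlMr ?normr_gt0.
    by lra.
  have /eqP : h.@[x] * (w ^+ 2 - \sum_(a <- A) a ^+ 4).@[x] = 0.
    rewrite -mevalM ha raddf_sum big1 //= => l _.
    by rewrite mevalM /x (meval_homog _ _ (dgP l)) gy !mulr0.
  rewrite mulf_eq0 (negbTE hx) /= /x (meval_homog _ _ wA_homog) mulf_eq0 expf_eq0 (negbTE t00) andbF /=.
  rewrite rmorphB /= rmorph_sum rmorphXn /= => /eqP/subr0_eq ->.
  by apply: eq_bigr => b _; rewrite rmorphXn.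
have [rho rho0 rhoP] := local_sign gv jv rel.
exists rho => // y z yv zv gy gz; apply: rhoP => // l; [apply: gy|apply: gz]; exact: codom_f.
Qed.
End RealPoint.

Definition sphere (R : realType) N (y : 'I_N -> R) := \sum_l y l ^+ 2 = 1.

Lemma sphere_le1 (R : realType) N (y : 'I_N -> R) : sphere y -> forall l, `|y l| <= 1.
Proof.
move=> ys l; rewrite -(@expr_le1 _ 2) // real_normK ?num_real // -ys (bigD1 l) //= lerDl sumr_ge0 // => k _; exact: sqr_ge0.
Qed.

Section SignSeparation.
Variables (R : realType) (n : nat) (I : prime_idealr {mpoly R[n.+1]}).
Hypotheses (homI : homog_ideal I) (smoothI : smooth_variety I).
Variables (w : {mpoly R[n.+1]}) (A : seq {mpoly R[n.+1]}) (e : nat).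
Hypothesis wA_homog : w ^+ 2 - \sum_(a <- A) a ^+ 4 \is e.-homog.
Hypothesis wA_I : w ^+ 2 - \sum_(a <- A) a ^+ 4 \in I.

(** Otherwise there are y_j and z_j on the sphere with w > 0 and w < 0, closer and closer together
    and satisfying more and more equations of [I]. They converge to a real point of X, where
    [real_point_sign] forbids this. The list of equations is finite, as Artin-Lang requires. *)
Lemma sign_separation : exists ps : seq {mpoly R[n.+1]},
  (forall p, p \in ps -> p \in I /\ exists d, p \is d.-homog) /\
  exists2 rho, 0 < rho & forall y z, sphere y -> sphere z ->
    (forall p, p \in ps -> p.@[y] = 0) -> (forall p, p \in ps -> p.@[z] = 0) ->
    0 < w.@[y] -> w.@[z] < 0 -> exists l, rho < `|y l - z l|.
Proof.
apply: contrapT => nsep.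
pose good (p : {mpoly R[n.+1]}) := p \in I /\ exists d, p \is d.-homog.
have /choice[yz yzP] (j : seq {mpoly R[n.+1]} * nat) : exists x : ('I_n.+1 -> R) * ('I_n.+1 -> R),
    [/\ sphere x.1 /\ sphere x.2,
        forall p, p \in j.1 -> good p -> p.@[x.1] = 0 /\ p.@[x.2] = 0,
        0 < w.@[x.1], w.@[x.2] < 0 & forall l, `|x.1 l - x.2 l| <= (j.2.+1%:R)^-1].
  apply: contrapT => nx; apply: nsep.
  exists [seq p <- j.1 | `[< good p >]]; split=> [p|].
    by rewrite mem_filter => /andP[/asboolP].
  exists (j.2.+1%:R)^-1; first by rewrite invr_gt0 ltr0n.
  move=> y z ys zs py pz wy wz; apply: contrapT => nl; apply: nx; exists (y, z); split=> //=.
    by move=> p pj gp; split; [apply: py|apply: pz]; rewrite mem_filter pj andbT; apply/asboolP.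
  by move=> l; rewrite leNgt; apply/negP => ll; apply: nl; exists l.
have [U [UU Utail]] := tail_ultrafilter {mpoly R[n.+1]}.
have yB j l : `|(yz j).1 l| <= 1 by have [[ys _] _ _ _ _] := yzP j; exact: sphere_le1.
have [v vP] := ultra_lim_vec UU yB.
have lim0 p : U [set j | p.@[(yz j).1] = 0]%classic -> p.@[v] = 0.
  move=> Up; apply/eqP; apply: contrapT => /negP pv.
  have pv2 : 0 < `|p.@[v]| / 2 by rewrite divr_gt0 ?normr_gt0.
  have [d d0 dP] := meval_continuous p v pv2.
  have [j [/= pj vj]] := filter_ex (filterI Up (vP d d0)).
  by have := dP _ vj; rewrite pj sub0r normrN; lra.
have Iv p : p \in I -> p.@[v] = 0.
  move=> pI; rewrite [p]homog_components raddf_sum big1 //= => d _.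
  apply: lim0; apply: filterS (Utail [:: hcomp d p] 0%N) => j /= [sj _].
  have [_ H _ _ _] := yzP j; have [] := H (hcomp d p) => //.
    by apply: sj; rewrite mem_head.
  by split; [exact: homI|exists d; exact: pihomogP].
have vs : sphere v.
  have : (\sum_l 'X_l ^+ 2 - 1 : {mpoly R[n.+1]}).@[v] = 0.
    apply: lim0; apply: filterS filterT => j _ /=; have [[ys _] _ _ _ _] := yzP j.
    rewrite rmorphB rmorph1 rmorph_sum /=; under eq_bigr do rewrite rmorphXn /= mevalXU.
    by rewrite ys subrr.
  rewrite rmorphB rmorph1 rmorph_sum /=; under eq_bigr do rewrite rmorphXn /= mevalXU.
  by move/subr0_eq.
have vn0 : exists i, v i != 0.
  apply: contrapT => nv; move: vs; rewrite /sphere big1 => [/eqP|i _]; first by rewrite eq_sym oner_eq0.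
  by have [->|vi] := eqVneq (v i) 0; [rewrite expr0n|case: nv; exists i].
have [gs [gsI [rho rho0 rhoP]]] := real_point_sign homI smoothI wA_homog wA_I vn0 Iv.
have r2 : 0 < rho / 2 by rewrite divr_gt0.
have [m mP] := small_inv r2.
have [j [/= vj [sj mj]]] := filter_ex (filterI (vP _ r2) (Utail gs m)).
have [_ H wy wz yzj] := yzP j.
have nz : nball v rho (yz j).2.
  move=> l; rewrite -[_ - v l](subrKA ((yz j).1 l)).
  apply: le_trans (ler_normD _ _) _; rewrite [rho]splitr; apply: lerD; last exact: vj.
  rewrite distrC; apply: le_trans (yzj l) _; apply: le_trans (ltW mP).
  by rewrite lef_pV2 ?posrE ?ltr0n // ler_nat.
have ny : nball v rho (yz j).1 by move=> l; apply: le_trans (vj l) _; lra.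
have := rhoP _ _ ny nz; rewrite leNgt wz => /(_ _ _ wy) F.
by have : false by apply: F => g gg; have [] := H g (sj g gg) (gsI g gg).
Qed.
End SignSeparation.

Lemma bernoulli (R : realFieldType) (x : R) k : 0 <= x -> 1 + k%:R * x <= (1 + x) ^+ k.
Proof.
move=> x0; elim: k => [|k IH]; first by rewrite mul0r addr0 expr0.
have x1 : 0 <= 1 + x by lra.
rewrite exprSr; apply: le_trans (ler_wpM2r x1 IH); rewrite -natr1.
have : 0 <= k%:R * x * x by rewrite !mulr_ge0.
lra.
Qed.

Lemma pow_dominates (R : archiRealFieldType) (a b M : R) : 0 < a -> a < b ->
  exists k, M * a ^+ k.+1 < b ^+ k.+1.
Proof.
move=> a0 ab; pose x := b / a - 1.
have x0 : 0 < x by rewrite subr_gt0 ltr_pdivlMr // mul1r.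
have bE : b = a * (1 + x) by rewrite /x addrC subrK mulrC divfK // gt_eqF.
exists (Num.bound (M / x)); rewrite bE exprMn mulrC ltr_pM2l ?exprn_gt0 //.
apply: lt_le_trans (bernoulli _ (ltW x0)).
have : M / x < (Num.bound (M / x))%:R.
  have [Mx|Mx] := leP 0 (M / x); first exact: archi_boundP.
  by apply: lt_le_trans Mx _.
by rewrite ltr_pdivrMr // -natr1; lra.
Qed.

(** One point of [A] is chosen in each cell of side [e] that meets [A], so the net consists of
    points of [A] itself. *)
Lemma cube_net (R : realType) N (A : ('I_N -> R) -> Prop) e : 0 < e ->
  (forall y, A y -> forall l, `|y l| <= 1) ->
  exists Z : seq {ffun 'I_N -> R}, (forall z : {ffun 'I_N -> R}, z \in Z -> A z) /\
  forall y, A y -> exists2 z : {ffun 'I_N -> R}, z \in Z & forall l, `|y l - z l| <= e.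
Proof.
move=> e0 A1; pose K := Num.truncn (2 / e).
pose cell (y : 'I_N -> R) := [ffun l => inord (Num.truncn ((y l + 1) / e)) : 'I_K.+1].
have /choice[pk pkP] c : exists z : {ffun 'I_N -> R}, (exists y, A y /\ cell y = c) -> A z /\ cell z = c.
  have [[y [Ay yc]]|ny] := pselect (exists y, A y /\ cell y = c); last by exists [ffun=> 0].
  exists [ffun l => y l]; have -> : ([ffun l => y l] : 'I_N -> R) = y by apply/funext => l; rewrite ffunE.
  by [].
exists [seq pk c | c <- enum {: {ffun 'I_N -> 'I_K.+1}} & `[< exists y, A y /\ cell y = c >]]; split.
  by move=> z /mapP[c]; rewrite mem_filter => /andP[/asboolP yc _] ->; case: (pkP c yc).
move=> y Ay; have yc : exists x, A x /\ cell x = cell y by exists y.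
have [Az zc] := pkP _ yc; exists (pk (cell y)).
  by apply: map_f; rewrite mem_filter mem_enum andbT; apply/asboolP.
have nnK x l : A x -> 0 <= (x l + 1) / e /\ (Num.truncn ((x l + 1) / e) < K.+1)%N.
  move=> Ax; have := A1 x Ax l; rewrite ler_norml => /andP[x1 x2].
  split; first by apply: divr_ge0 (ltW e0); lra.
  by rewrite ltnS; apply: le_truncn; rewrite ler_pM2r ?invr_gt0 //; lra.
move=> l; have := congr1 (fun f : {ffun 'I_N -> 'I_K.+1} => val (f l)) zc.
rewrite !ffunE /= !inordK; try by case: (nnK _ l Ay); case: (nnK _ l Az).
move=> E; have [y0 _] := nnK _ l Ay; have [z0 _] := nnK _ l Az.
have /andP[h1 h2] := truncn_itv y0; have /andP[h3 h4] := truncn_itv z0.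
move: h3 h4; rewrite E => h3 h4; move: h1 h2 h3 h4; rewrite -natr1.
rewrite !ler_pdivlMr // !ltr_pdivrMr // mulrDl mul1r ler_norml; lra.
Qed.

Definition norm2 (R : comNzRingType) N : {mpoly R[N]} := \sum_l 'X_l ^+ 2.

Lemma meval_norm2 (R : comNzRingType) N (y : 'I_N -> R) : (norm2 R N).@[y] = \sum_l y l ^+ 2.
Proof. by rewrite /norm2 rmorph_sum; apply: eq_bigr => l _; rewrite rmorphXn /= mevalXU. Qed.

Lemma homog_var (R : comNzRingType) N (l : 'I_N) : ('X_l : {mpoly R[N]}) \is 1.-homog.
Proof. by rewrite dhomogX /= mdeg1. Qed.

Lemma homog_norm2 (R : comNzRingType) N : norm2 R N \is 2.-homog.
Proof. by apply: rpred_sum => l _; rewrite -[2%N]/(1 * 2)%N; apply: dhomogMn; exact: homog_var. Qed.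

(* Sum of high powers of the scalar products with finitely many points of P, minus a constant:
   up to sign, the points of M stay away from those of P. *)
Lemma separating_form (R : realType) N (P M : ('I_N -> R) -> Prop) rho : 0 < rho ->
  (forall y, P y -> sphere y) -> (forall y, M y -> sphere y) ->
  (forall y z, P y -> M z -> (exists l, rho < `|y l - z l|) /\ (exists l, rho < `|y l + z l|)) ->
  exists k (U : {mpoly R[N]}) (eta : R), [/\ U \is (2 * k.+1).-homog, 0 < eta,
    forall y, P y -> eta <= U.@[y] & forall y, M y -> U.@[y] <= - eta].
Proof.
move=> rho0' Ps Ms PM'; pose rho1 := Num.min rho 1.
have rho0 : 0 < rho1 by rewrite lt_min rho0' ltr01.
have PM y z : P y -> M z -> (exists l, rho1 < `|y l - z l|) /\ (exists l, rho1 < `|y l + z l|).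
  by move=> Py Mz; have [[l hl] [m hm]] := PM' y z Py Mz;
    split; [exists l|exists m]; rewrite gt_min ?hl ?hm.
have rho1' : rho1 <= 1 by rewrite ge_min lexx orbT.
pose dot (y z : 'I_N -> R) := \sum_l y l * z l.
have dotB y z : sphere y -> sphere z -> \sum_l (y l - z l) ^+ 2 = 2 - 2 * dot y z.
  move=> ys zs; transitivity (\sum_l y l ^+ 2 + \sum_l z l ^+ 2 - 2 * dot y z).
    by rewrite /dot mulr_sumr -big_split -sumrB /=; apply: eq_bigr => l _; ring.
  by rewrite ys zs.
have dotD y z : sphere y -> sphere z -> \sum_l (y l + z l) ^+ 2 = 2 + 2 * dot y z.
  move=> ys zs; transitivity (\sum_l y l ^+ 2 + \sum_l z l ^+ 2 + 2 * dot y z).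
    by rewrite /dot mulr_sumr -!big_split /=; apply: eq_bigr => l _; ring.
  by rewrite ys zs.
have far (f : 'I_N -> R) : (exists l, rho1 < `|f l|) -> rho1 ^+ 2 <= \sum_l f l ^+ 2.
  move=> [l hl]; rewrite (bigD1 l) //= -[f l ^+ 2]real_normK ?num_real //.
  rewrite ler_wpDr ?sumr_ge0 // => [k _|]; first exact: sqr_ge0.
  by rewrite ler_pXn2r ?nnegrE ?normr_ge0 // ?ltW.
(* Points whose coordinates differ by at most e have squared distance at most N e^2 <= rho1^2 / 4,
   since 4 N <= (N + 1)^2. *)
pose e := rho1 / (N%:R + 1).
have N1 : 0 < N%:R + 1 :> R by rewrite ltr_wpDl.
have e0 : 0 < e by rewrite divr_gt0.
have [Z [ZP Znet]] := cube_net e0 (fun y Py => sphere_le1 (Ps y Py)).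
(* [a1] is an upper bound for the squared scalar product of a point of [M] with a net point, as 2 -
   2 |y.z| >= rho1^2; [a2] is a lower bound for a point of [P] and a close net point. *)
pose a1 := (1 - rho1 ^+ 2 / 2) ^+ 2; pose a2 := (1 - rho1 ^+ 2 / 4) ^+ 2.
have r2 : 0 < rho1 ^+ 2 <= 1 by rewrite exprn_gt0 //= expr_le1 // ltW.
have a10 : 0 < a1 by rewrite exprn_gt0 //; lra.
have a12 : a1 < a2 by rewrite ltr_pXn2r // ?nnegrE; lra.
have near y (z : {ffun 'I_N -> R}) : P y -> z \in Z -> (forall l, `|y l - z l| <= e) -> a2 <= dot y z ^+ 2.
  move=> Py Zz yz; have h1 : \sum_l (y l - z l) ^+ 2 <= N%:R * e ^+ 2.
    apply: le_trans (_ : \sum_(l < N) e ^+ 2 <= _); last by rewrite sumr_const card_ord mulr_natl.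
    apply: ler_sum => l _; rewrite -[(_ - _) ^+ 2]real_normK ?num_real //.
    by rewrite ler_pXn2r ?nnegrE ?normr_ge0 // ?ltW.
  have h2 : N%:R * e ^+ 2 <= rho1 ^+ 2 / 4.
    rewrite /e expr_div_n mulrA ler_pdivrMr ?exprn_gt0 //.
    have := sqr_ge0 (N%:R - 1 : R); have := sqr_ge0 rho1.
    move: (rho1 ^+ 2) (N%:R : R) => s t s0 t1.
    have : 0 <= s * ((t - 1) ^+ 2) by rewrite mulr_ge0.
    lra.
  move: h1; rewrite (dotB _ _ (Ps _ Py) (Ps _ (ZP _ Zz))) => h1.
  by rewrite ler_pXn2r // ?nnegrE; lra.
have away y (z : {ffun 'I_N -> R}) : M y -> z \in Z -> dot y z ^+ 2 <= a1.
  move=> My Zz; have [f1 f2] := PM _ _ (ZP _ Zz) My.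
  have h1 := far (fun l => z l - y l) f1; have h2 := far (fun l => z l + y l) f2.
  move: h1 h2; rewrite (dotB _ _ (Ps _ (ZP _ Zz)) (Ms _ My)) (dotD _ _ (Ps _ (ZP _ Zz)) (Ms _ My)).
  have -> : dot z y = dot y z by apply: eq_bigr => l _; rewrite mulrC.
  move=> h1 h2; rewrite /a1 -[dot y z ^+ 2]real_normK ?num_real //.
  by rewrite ler_pXn2r ?nnegrE // ?ler_norml; lra.
(* A single term a2^(k+1) outweighs all terms at a point of [M], and [kappa] is halfway between.
   Multiplied by a power of [norm2] it becomes a form that is constant on the sphere. *)
have [k kP] := pow_dominates (size Z)%:R a10 a12.
pose kappa := (a2 ^+ k.+1 + (size Z)%:R * a1 ^+ k.+1) / 2.
pose lin (z : {ffun 'I_N -> R}) : {mpoly R[N]} := \sum_l z l *: 'X_l.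
pose U : {mpoly R[N]} := \sum_(z <- Z) (lin z ^+ 2) ^+ k.+1 - kappa *: norm2 R N ^+ k.+1.
have Uy y : sphere y -> U.@[y] = \sum_(z <- Z) (dot y z ^+ 2) ^+ k.+1 - kappa.
  move=> ys; rewrite /U rmorphB rmorph_sum /= mevalZ rmorphXn /= meval_norm2 ys expr1n mulr1.
  congr (_ - _); apply: eq_bigr => z _; rewrite !rmorphXn /=; congr ((_ ^+ 2) ^+ _).
  by rewrite rmorph_sum; apply: eq_bigr => l _; rewrite /= mevalZ mevalXU mulrC.
exists k, U, ((a2 ^+ k.+1 - (size Z)%:R * a1 ^+ k.+1) / 2); split.
- apply: rpredB; last by apply: rpredZ; apply: dhomogMn; exact: homog_norm2.
  apply: rpred_sum => z _; apply: dhomogMn; rewrite -[2%N]/(1 * 2)%N; apply: dhomogMn.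
  by apply: rpred_sum => l _; apply: rpredZ; exact: homog_var.
- by rewrite divr_gt0 // subr_gt0.
- move=> y Py; rewrite (Uy _ (Ps _ Py)) /kappa.
  have [z Zz yz] := Znet y Py; have h := near _ _ Py Zz yz.
  have : a2 ^+ k.+1 <= \sum_(z <- Z) (dot y z ^+ 2) ^+ k.+1.
    rewrite (big_rem z) //= ler_wpDr ?sumr_ge0 // => [x _|]; first by rewrite exprn_ge0 ?sqr_ge0.
    by rewrite ler_pXn2r ?nnegrE ?sqr_ge0.
  lra.
- move=> y My; rewrite (Uy _ (Ms _ My)) /kappa.
  have : \sum_(z <- Z) (dot y z ^+ 2) ^+ k.+1 <= (size Z)%:R * a1 ^+ k.+1.
    rewrite mulr_natl -sum1_size -sumrMnr big_seq [X in _ <= X]big_seq; apply: ler_sum => z Zz.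
    by rewrite mulr1n ler_pXn2r ?nnegrE ?sqr_ge0 // away.
  lra.
Qed.

(** * Elements whose square is a sum of fourth powers *)


Lemma prime_idealrX (R : comNzRingType) (P : prime_idealr R) x m : x \notin P -> x ^+ m \notin P.
Proof.
move=> xP; elim: m => [|m IH]; first by rewrite expr0 idealr1.
by rewrite exprS prime_idealrM negb_or xP.
Qed.

Lemma homog_varX (R : comNzRingType) N (l : 'I_N) m : ('X_l ^+ m : {mpoly R[N]}) \is m.-homog.
Proof. by rewrite -[X in X.-homog]mul1n; apply: dhomogMn; exact: homog_var. Qed.

Lemma quotient_unit (K : fieldType) (f a b : K) : a != 0 -> b != 0 -> f = a / b * (f * b / a).
Proof. by move=> a0 b0; field; rewrite a0. Qed.

Section FourthPowers.
Variables (R : realType) (n : nat) (I : prime_idealr {mpoly R[n.+1]}).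
Hypotheses (homI : homog_ideal I) (smoothI : smooth_variety I).
Variables (K : fieldType) (psi : {rmorphism {mpoly R[n.+1]} -> K}).
Hypothesis psi0 : forall d F, F \is d.-homog -> (psi F == 0) = (F \in I).
Hypothesis psiI : forall p, p \in I -> psi p = 0.
Hypothesis psiK : forall x, exists d F G,
  [/\ F \is d.-homog, G \is d.-homog, G \notin I & x = psi F / psi G].

Lemma common_denominator (s : seq K) : exists e Q, [/\ Q \is e.-homog, Q \notin I &
  forall x, x \in s -> exists F, F \is e.-homog /\ x = psi F / psi Q].
Proof.
elim: s => [|x s [e [Q [Qe QI sQ]]]].
  by exists 0%N, 1; split; rewrite ?dhomog1 ?idealr1.
have [d [F [G [Fd Gd GI ->]]]] := psiK x.
have [G0 Q0] : psi G != 0 /\ psi Q != 0 by rewrite (psi0 Gd) (psi0 Qe).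
exists (d + e)%N, (G * Q); split; first exact: dhomogM.
  by rewrite prime_idealrM negb_or GI.
move=> y; rewrite inE => /orP[/eqP ->|ys].
  exists (F * Q); split; first exact: dhomogM.
  by rewrite !rmorphM /= invfM mulrACA divff // mulr1.
have [H [He ->]] := sQ y ys; exists (G * H); split; first exact: dhomogM.
by rewrite !rmorphM /= invfM mulrACA divff // mul1r.
Qed.

(* psi F / psi G is the unit u of the local ring at P in the definition of D(X). *)
Definition unit_times_sos (f : K) (P : prime_idealr {mpoly R[n.+1]}) :=
  exists d F G g, [/\ F \is d.-homog /\ G \is d.-homog, F \notin P, G \notin P,
    g != 0 /\ sum_of_powers 2 g & f = psi F / psi G * g].

Section Relation.
Variables (w : {mpoly R[n.+1]}) (A : seq {mpoly R[n.+1]}) (e : nat).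
Hypothesis we : w \is (e + e).-homog.
Hypothesis wAe : w ^+ 2 - \sum_(a <- A) a ^+ 4 \is ((e + e) * 2).-homog.
Hypothesis wAI : w ^+ 2 - \sum_(a <- A) a ^+ 4 \in I.

(** Otherwise Artin-Lang gives a real y with the equations [ps] and V w < 0. The degree of V w is
    positive, so y is nonzero and can be rescaled to the sphere, where the signs contradict this. *)
Lemma homog_sop2 (ps : seq {mpoly R[n.+1]}) d (V : {mpoly R[n.+1]}) :
  (forall p, p \in ps -> p \in I /\ exists d, p \is d.-homog) -> V \is (2 * d.+1).-homog ->
  (forall y, sphere y -> (forall p, p \in ps -> p.@[y] = 0) -> 0 < w.@[y] -> 0 < V.@[y]) ->
  (forall y, sphere y -> (forall p, p \in ps -> p.@[y] = 0) -> w.@[y] < 0 -> V.@[y] < 0) ->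
  sum_of_powers 2 (psi (V * w)).
Proof.
move=> psP Ve Vp Vn; apply: contrapT; rewrite rmorph_mpoly => nsop.
have ps0 p : p \in ps -> mmap (psi \o @mpolyC n.+1 R) (fun l => psi 'X_l) p = 0.
  by move=> /psP[pI _]; rewrite -rmorph_mpoly psiI.
have [y [py]] := artin_lang ps0 nsop.
have Vwe : V * w \is (2 * d.+1 + (e + e)).-homog by exact: dhomogM.
pose q := \sum_l y l ^+ 2; have q0 : 0 <= q by rewrite sumr_ge0 // => l _; exact: sqr_ge0.
have {q0}[q0|q0] : q = 0 \/ 0 < q.
  by have [->|qn] := eqVneq q 0; [left|right; rewrite lt_neqAle eq_sym qn].
  have y0 l : y l = 0 * y l.
    apply/eqP; rewrite mul0r -sqrf_eq0; move/eqP: q0; rewrite /q psumr_eq0 => [/allP/(_ l)|k _]; last exact: sqr_ge0.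
    by apply; rewrite mem_index_enum.
  have -> : y = fun l => 0 * y l by apply/funext.
  by rewrite (meval_homog _ _ Vwe) expr0n /= mul0r ltxx.
pose t := (Num.sqrt q)^-1; have t0 : 0 < t by rewrite invr_gt0 sqrtr_gt0.
pose x l := t * y l.
have xs : sphere x.
  rewrite /sphere /x; under eq_bigr do rewrite exprMn.
  by rewrite -mulr_sumr -/q exprVn sqr_sqrtr ?mulVf ?gt_eqF // ltW.
have px p : p \in ps -> p.@[x] = 0.
  by move=> pps; have [_ [d' pd]] := psP p pps; rewrite (meval_homog _ _ pd) py // mulr0.
move=> Vwy; have : (V * w).@[x] < 0 by rewrite (meval_homog _ _ Vwe) pmulr_rlt0 ?exprn_gt0.
rewrite mevalM; have [wx|wx|->] := ltgtP w.@[x] 0; last by rewrite mulr0 ltxx.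
  by have := Vn x xs px wx; nra.
by have := Vp x xs px wx; nra.
Qed.

(** As [w] has even degree its sign is the same at -z, so points of opposite signs are far from each
    other even up to sign. If the separating form [U] lies in P, eta / 2 X_i^(2k+2) is added: on the
    sphere it is between 0 and eta / 2 and preserves the signs. *)
Lemma unit_form P : scheme_point I P -> exists i k V, [/\ 'X_i \notin P, V \is (2 * k.+1).-homog,
  V \notin P & sum_of_powers 2 (psi (V * w))].
Proof.
move=> [homP [i iP] IP].
have [ps [psP [rho rho0 sep]]] := sign_separation homI smoothI wAe wAI.
pose Z (y : 'I_n.+1 -> R) := sphere y /\ forall p, p \in ps -> p.@[y] = 0.
have ZN y : Z y -> Z (fun l => -1 * y l) /\ w.@[fun l => -1 * y l] = w.@[y].
  move=> [ys py]; split; last first.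
    by rewrite (meval_homog _ _ we) addnn -mul2n exprM sqrrN expr1n expr1n mul1r.
  split=> [|p pps].
    by rewrite /sphere -[RHS]ys; apply: eq_bigr => l _; rewrite mulN1r sqrrN.
  by have [_ [d pd]] := psP p pps; rewrite (meval_homog _ _ pd) py // mulr0.
have PM (y z : 'I_n.+1 -> R) : Z y /\ 0 < w.@[y] -> Z z /\ w.@[z] < 0 ->
    (exists l, rho < `|y l - z l|) /\ (exists l, rho < `|y l + z l|).
  move=> [[ys py] wy] [Zz wz]; split; first by case: Zz => zs pz; exact: sep.
  have [[zs pz] wz'] := ZN z Zz.
  have wz0 : w.@[fun l => -1 * z l] < 0 by rewrite wz'.
  have [l hl] := sep y _ ys zs py pz wy wz0.
  by exists l; move: hl; rewrite mulN1r opprK.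
have sP (y : 'I_n.+1 -> R) : Z y /\ 0 < w.@[y] -> sphere y by case=> -[].
have sM (y : 'I_n.+1 -> R) : Z y /\ w.@[y] < 0 -> sphere y by case=> -[].
have [k [U [eta [Uk eta0 UP UM]]]] := separating_form rho0 sP sM PM.
have sop_near t : 0 <= t <= eta / 2 -> sum_of_powers 2 (psi ((U + t *: 'X_i ^+ (2 * k.+1)) * w)).
  move=> /andP[t0 t1].
  have Ut y : sphere y -> 0 <= (U + t *: 'X_i ^+ (2 * k.+1)).@[y] - U.@[y] <= eta / 2.
    move=> ys; rewrite mevalD mevalZ rmorphXn /= mevalXU addrC addKr.
    have h : 0 <= y i ^+ (2 * k.+1) <= 1.
      rewrite exprM exprn_ge0 ?sqr_ge0 //= exprn_ile1 ?sqr_ge0 //.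
      by rewrite -[y i ^+ 2]real_normK ?num_real // exprn_ile1 // sphere_le1.
    by case/andP: h => h1 h2; rewrite mulr_ge0 //=; nra.
  apply: (homog_sop2 psP (d := k)) => [|y ys py wy|y ys py wy].
  - by apply: rpredD => //; apply: rpredZ; exact: homog_varX.
  - by have /andP[h1 h2] := Ut y ys; have := UP y (conj (conj ys py) wy); lra.
  - by have /andP[h1 h2] := Ut y ys; have := UM y (conj (conj ys py) wy); lra.
have [UinP|UP'] := boolP (U \in P); last first.
  exists i, k, U; split=> //; have := sop_near 0; rewrite scale0r addr0; apply.
  by rewrite lexx divr_ge0 // ltW.
exists i, k, (U + (eta / 2) *: 'X_i ^+ (2 * k.+1)); split=> //.
- apply: rpredD => //; apply: rpredZ; exact: homog_varX.
- apply/negP => H; have : (eta / 2)^-1%:MP * ((eta / 2) *: 'X_i ^+ (2 * k.+1)) \in P.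
    by apply: idealMr; rewrite -[_ *: _](addKr U) rpredD // rpredN.
  rewrite mul_mpolyC scalerA mulVf ?scale1r ?gt_eqF ?divr_gt0 //.
  by apply/negP/prime_idealrX.
- by apply: sop_near; rewrite lexx divr_ge0 // ltW.
Qed.
End Relation.

Lemma sop4_unit_times_sos (f : K) P : f != 0 -> sum_of_powers 4 (f ^+ 2) -> scheme_point I P ->
  unit_times_sos f P.
Proof.
move=> f0 [s fs] PI; have [_ _ IP] := PI.
have [e [Q [Qe QI sQ]]] := common_denominator (f :: s).
have /choice[num numP] x : exists F, x \in f :: s -> F \is e.-homog /\ x = psi F / psi Q.
  have [xs|xs] := boolP (x \in f :: s); last by exists 0.
  by have [F FP] := sQ x xs; exists F.
have Q0 : psi Q != 0 by rewrite (psi0 Qe).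
have [Fe fE] := numP f (mem_head _ _).
(* Multiplying the numerator of f by [Q] makes the degree of [w] even and gives w^2 and the fourth
   powers the common degree 4 e. *)
pose A := [seq num a | a <- s]; pose w := num f * Q.
have we : w \is (e + e).-homog by exact: dhomogM.
have fw : f = psi w / psi Q ^+ 2.
  by rewrite {1}fE rmorphM /= expr2 invfM mulrACA divff // mulr1.
have wAe : w ^+ 2 - \sum_(a <- A) a ^+ 4 \is ((e + e) * 2).-homog.
  apply: rpredB; first exact: dhomogMn.
  rewrite /A big_map big_seq; apply: rpred_sum => a sa.
  have -> : ((e + e) * 2 = e * 4)%N by rewrite addnn -muln2 -mulnA.
  by apply: dhomogMn; case: (numP a); rewrite // inE sa orbT.
have wAI : w ^+ 2 - \sum_(a <- A) a ^+ 4 \in I.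
  rewrite -(psi0 wAe) rmorphB rmorphXn rmorph_sum /=.
  have -> : psi w = f * psi Q ^+ 2 by rewrite fw divfK // expf_neq0.
  rewrite exprMn fs mulr_suml /A big_map -sumrB big_seq big1 // => a sa.
  have [|_ aE] := numP a; first by rewrite inE sa orbT.
  by rewrite rmorphXn /= {1}aE; field.
have [i [k [V [iP Vk VP sopV]]]] := unit_form we wAe wAI PI.
have Xk : ('X_i ^+ (2 * k.+1) : {mpoly R[n.+1]}) \is (2 * k.+1).-homog by exact: homog_varX.
have XP := prime_idealrX (2 * k.+1) iP.
have V0 : psi V != 0 by rewrite (psi0 Vk); apply: contraNN VP; exact: IP.
have X0 : psi ('X_i ^+ (2 * k.+1)) != 0 by rewrite (psi0 Xk); apply: contraNN XP; exact: IP.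
exists (2 * k.+1)%N, ('X_i ^+ (2 * k.+1)), V, (f * psi V / psi ('X_i ^+ (2 * k.+1))).
split=> //; last exact: quotient_unit.
split; first by rewrite !mulf_neq0 ?invr_eq0.
have -> : f * psi V / psi ('X_i ^+ (2 * k.+1)) = psi (V * w) / (psi Q * psi 'X_i ^+ k.+1) ^+ 2.
  have X1 : psi 'X_i != 0 by move: X0; rewrite rmorphXn /= expf_eq0.
  rewrite fw !rmorphM rmorphXn /= exprMn -exprM mulnC.
  move: (psi 'X_i ^+ (k.+1 * 2)) (expf_neq0 (k.+1 * 2) X1) => z z0.
  by field; rewrite z0 Q0.
by apply: sop_div => //; exact: sopX.
Qed.
End FourthPowers.

(** * Squares that are sums of fourth powers *)


Section Bounded.
Variables (R : realType) (K : fieldType) (iota : {rmorphism R -> K}).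
Local Notation S := (@sum_of_powers K 2).
Local Notation T := (@sum_of_powers K 4).
Implicit Types (s t b f g x : K) (c q : R).

Let natK m : (m.+1%:R : K) != 0.
Proof. by rewrite -(rmorph_nat iota) fmorph_eq0 pnatr_eq0. Qed.

Lemma sop4_cst c : 0 <= c -> T (iota c).
Proof.
move=> c0; have -> : iota c = iota (Num.sqrt (Num.sqrt c)) ^+ 4.
  by rewrite -rmorphXn (exprM _ 2 2) sqr_sqrtr ?sqrtr_ge0 // sqr_sqrtr.
exact: sopX.
Qed.

Lemma sop2_cst c : 0 <= c -> S (iota c).
Proof.
move=> c0; have -> : iota c = iota (Num.sqrt c) ^+ 2 by rewrite -rmorphXn sqr_sqrtr.
exact: sopX.
Qed.

Let S_nat m : S m%:R. Proof. exact: sop_nat. Qed.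
Let T_nat m : T m%:R. Proof. exact: sop_nat. Qed.

(* The left-hand side is the mean of (b + xi)^4, with xi a centred Gaussian of variance s,
   which may be replaced by a sum of variables with values 0, +-sqrt 3. *)
Lemma gauss_fourth_moment s b : S s -> T (3 * s ^+ 2 + 6 * s * b ^+ 2 + b ^+ 4).
Proof.
move=> [l ->] {s}; elim: l b => [|x l IH] b.
  by rewrite big_nil expr0n !mulr0 mul0r !add0r; exact: sopX.
rewrite big_cons; move: (\sum_(a <- l) a ^+ 2) IH => s IH.
(* The weights 2/3, 1/6, 1/6 on 0, sqrt 3, -sqrt 3 give variance 1 and fourth moment 3, as for a
   Gaussian. *)
pose r := iota (Num.sqrt 3); have r2 : r ^+ 2 = 3 by rewrite -rmorphXn sqr_sqrtr // rmorph_nat.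
pose F b := 3 * s ^+ 2 + 6 * s * b ^+ 2 + b ^+ 4.
have -> : 3 * (x ^+ 2 + s) ^+ 2 + 6 * (x ^+ 2 + s) * b ^+ 2 + b ^+ 4 =
    2 / 3 * F b + 1 / 6 * (F (b + r * x) + F (b - r * x)).
  have -> : F (b + r * x) + F (b - r * x) =
      2 * (3 * s ^+ 2 + 6 * s * (b ^+ 2 + r ^+ 2 * x ^+ 2) +
        (b ^+ 4 + 6 * r ^+ 2 * x ^+ 2 * b ^+ 2 + (r ^+ 2) ^+ 2 * x ^+ 4)) by rewrite /F; ring.
  by rewrite r2 /F; field; rewrite (natK 5) (natK 2).
have T23 : T (2 / 3) by apply: sop_div => //; exact: T_nat.
have T16 : T (1 / 6) by apply: sop_div => //; exact: sop1.
by apply: sopD; apply: sopM => //; [exact: IH|apply: sopD; exact: IH].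
Qed.

Let T_div m x : T (m.+1%:R * x) -> T x.
Proof.
move=> Tx; have -> : x = m.+1%:R * x / m.+1%:R by rewrite mulrC mulrA mulVf ?mul1r.
exact: sop_div.
Qed.

Lemma sop2_sqr g : S g -> T (g ^+ 2).
Proof.
move=> Sg; apply: (@T_div 2); have := gauss_fourth_moment 0 Sg.
by rewrite !expr0n !mulr0 !addr0.
Qed.

(** The Gaussian moment with s = q - b^2: a bound b^2 <= q in all orderings makes the negative term
    -2 b^4 available up to a correction. *)
Lemma sop4_diff (q b : K) : S (q - b ^+ 2) -> T (3 * q ^+ 2 - 2 * b ^+ 4).
Proof.
move=> /(gauss_fourth_moment b); congr (sum_of_powers 4 _); ring.
Qed.

(** 2 (x+3)^4 - 6 (x+2)^4 + 6 (x+1)^4 - 2 x^4, twice a third difference, is 48 x + 72. [sop4_diff]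
    with (x+2)^2 <= 9 and x^2 <= 1 absorbs the negative terms at the cost of 729 + 3, and 12 more
    make the constant 816 = 48 * 17. *)
Lemma sop4_shift x : S (1 - x) -> S (1 + x) -> T (x + 17).
Proof.
move=> Sm Sp; apply: (@T_div 47).
have h1 : T (3 * 9 ^+ 2 - 2 * (x + 2) ^+ 4).
  apply: sop4_diff; have -> : 9 - (x + 2) ^+ 2 = (1 - x) * (4 + (1 + x)) by ring.
  by apply: sopM => //; apply: sopD.
have h2 : T (3 * 1 ^+ 2 - 2 * x ^+ 4).
  apply: sop4_diff; have -> : 1 - x ^+ 2 = (1 - x) * (1 + x) by ring.
  exact: sopM.
have -> : 48 * (x + 17) = 2 * (x + 3) ^+ 4 + 6 * (x + 1) ^+ 4 + 3 * (3 * 9 ^+ 2 - 2 * (x + 2) ^+ 4)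
    + (3 * 1 ^+ 2 - 2 * x ^+ 4) + 12 by ring.
by do !apply: sopD => //; apply: sopM => //; exact: sopX.
Qed.

Lemma sop4_nonreal : S (-1) -> forall x, T x.
Proof.
move=> SN x; have Sall := sos_nonreal (natK 1) SN.
by have := sop4_shift (Sall (1 - (x - 17))) (Sall (1 + (x - 17))); rewrite subrK.
Qed.

(** [sop4_shift] for 32 t - 31, which lies between -1 and 1; the remaining constant is 31 - 17 =
    14. *)
Lemma sop4_near1 t : S (1 - t) -> S (t - iota (15 / 16)) -> T t.
Proof.
move=> S1 S2; apply: (@T_div 31); have -> : 32 * t = (32 * t - 31 + 17) + 14 by ring.
apply: sopD => //; apply: sop4_shift.
  by have -> : 1 - (32 * t - 31) = 32 * (1 - t) by [ring]; apply: sopM.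
have -> : 1 + (32 * t - 31) = 32 * (t - iota (15 / 16)).
  by rewrite rmorphM fmorphV !rmorph_nat; field; exact: (natK 15).
exact: sopM.
Qed.

(* The map t |-> 4 t / (1 + t)^2 drives [c, 1] to 1, and t is its value times ((1 + t) / 2)^2. *)
Lemma sop4_iter k t c : 0 < c <= 1 -> (1 - c) ^+ (2 ^ k) <= 1 / 16 ->
  ~ S (-1) -> S (1 - t) -> S (t - iota c) -> T t.
Proof.
move=> + + nr; elim: k t c => [|k IH] t c /andP[c0 c1] ck S1 S2.
  apply: sop4_near1 => //; have -> : t - iota (15 / 16) = (t - iota c) + iota (c - 15 / 16).
    by rewrite rmorphB; ring.
  by apply: sopD => //; apply: sop2_cst; move: ck; rewrite expr1; lra.
have St : S t by rewrite -(subrK (iota c) t); apply: sopD => //; apply: sop2_cst; exact: ltW.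
have t1 : 1 + t != 0.
  by apply: contra_notN nr => /eqP/(canRL (addKr _)); rewrite addr0 => <-.
have c10 : 1 + c != 0 by rewrite gt_eqF //; lra.
have ic1 : 1 + iota c != 0 by rewrite -(rmorph1 iota) -rmorphD fmorph_eq0.
(* 1 - c' is at most (1 - c)^2: each step squares the bound on the distance to 1, hence the exponent
   2 ^ k. *)
pose c' := 4 * c / (1 + c) ^+ 2; pose t' := 4 * t / (1 + t) ^+ 2.
have c'1 : 1 - c' = ((1 - c) / (1 + c)) ^+ 2 by rewrite /c'; field.
have Tt' : T t'.
  apply: (IH t' c').
  - rewrite divr_gt0 ?exprn_gt0 ?mulr_gt0 //=; last by lra.
    by rewrite -subr_ge0 c'1 sqr_ge0.
  - apply: le_trans ck; rewrite c'1 expnS exprM; apply: lerXn2r; rewrite ?nnegrE ?sqr_ge0 //.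
    have h1 : 0 <= (1 - c) / (1 + c) by apply: divr_ge0; lra.
    rewrite ler_pXn2r ?nnegrE //; last by lra.
    by rewrite ler_pdivrMr; [nra|lra].
  - have -> : 1 - t' = ((1 - t) / (1 + t)) ^+ 2 by rewrite /t'; field.
    exact: sopX.
  - have -> : t' - iota c' = 4 * (t - iota c) * ((1 - iota c) + iota c * (1 - t)) /
        ((1 + t) * (1 + iota c)) ^+ 2.
      by rewrite /t' /c' fmorph_div rmorphM rmorph_nat rmorphXn rmorphD rmorph1; field; rewrite t1 ic1.
    apply: sop_div => //; last exact: sopX.
    apply: sopM; first exact: sopM.
    rewrite -(rmorph1 iota) -rmorphB; apply: sopD; first by apply: sop2_cst; lra.
    by apply: sopM; [apply: sop2_cst; lra|rewrite rmorph1].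
have -> : t = t' * (1 + t) ^+ 2 / 4 by rewrite /t'; field; rewrite t1 (natK 3).
apply: sop_div => //; apply: sopM => //; apply: sop2_sqr; apply: sopD => //; exact: sop1.
Qed.

Lemma sop4_pos t c : 0 < c -> S (1 - t) -> S (t - iota c) -> T t.
Proof.
move=> c0 S1 S2; have [SN|nr] := pselect (S (-1)); first exact: sop4_nonreal.
(* The bound 1/2 keeps 1 - c' positive, as [pow_dominates] requires. The factor 16 gives (1 -
   c')^(k+1) < 1/16, and 2^(k+1) >= k + 1. *)
pose c' := Num.min c (1 / 2).
have c'0 : 0 < c' by rewrite lt_min c0 /=; lra.
have c'1 : c' <= 1 / 2 by rewrite ge_min lexx orbT.
have S2' : S (t - iota c').
  have -> : t - iota c' = (t - iota c) + iota (c - c') by rewrite rmorphB; ring.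
  by apply: sopD => //; apply: sop2_cst; rewrite subr_ge0 ge_min lexx.
have a0 : 0 < 1 - c' by lra.
have a1 : 1 - c' < 1 by lra.
have [k kP] := pow_dominates 16 a0 a1.
apply: (sop4_iter (k := k.+1) (c := c')) => //; first by rewrite c'0; lra.
apply: le_trans (_ : (1 - c') ^+ k.+1 <= _).
  by apply: ler_wiXn2l; [lra|lra|exact: ltnW (ltn_expl _ _)].
by move: kP; rewrite expr1n; lra.
Qed.

Definition bounded x := exists c, S (iota c - x ^+ 2).

Lemma boundedD x y : bounded x -> bounded y -> bounded (x + y).
Proof.
move=> [c Sc] [d Sd]; exists (2 * (c + d)).
have -> : iota (2 * (c + d)) - (x + y) ^+ 2 =
    2 * (iota c - x ^+ 2) + 2 * (iota d - y ^+ 2) + (x - y) ^+ 2.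
  by rewrite rmorphM rmorph_nat rmorphD; ring.
by apply: sopD; [apply: sopD; apply: sopM|exact: sopX].
Qed.

Lemma bounded_sum m (F : 'I_m -> K) : (forall i, bounded (F i)) -> bounded (\sum_i F i).
Proof.
move=> H; apply: big_ind => //; last exact: boundedD.
by exists 0; rewrite rmorph0 expr0n subr0; exact: sop0.
Qed.

(* In every ordering the eta_r have the sign of f, so eps := \sum_r eta_r has it too, and
   eps, 1/eps are bounded, whence eps^2 is a sum of fourth powers; and f / eps is a sum of
   squares. *)
Lemma sop4_of_bounded f m (eta a : 'I_m -> K) :
  (forall r, S (f * eta r)) -> \sum_r a r * eta r = 1 ->
  (forall r, bounded (a r)) -> (forall r, bounded (eta r)) -> T (f ^+ 2).
Proof.
move=> Sf sum1 ba beta; have [SN|nr] := pselect (S (-1)); first exact: sop4_nonreal.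
have [->|fn0] := eqVneq f 0; first by rewrite expr0n; exact: sop0.
pose eps := \sum_r eta r.
have Sfe : S (f * eps) by rewrite mulr_sumr; apply: sop_sum.
(* If the sum of the f eta_r vanishes with a nonzero term, then -1 is a sum of squares; if all terms
   vanish, [sum1] gives f = 0. *)
have eps0 : f * eps != 0.
  apply: contraNneq fn0 => fe0; apply/eqP; have fr0 r : f * eta r = 0.
    apply/eqP; apply: contrapT => /negP fr; apply: nr.
    have -> : -1 = (\sum_(i | i != r) f * eta i) / (f * eta r).
      move: fe0; rewrite mulr_sumr (bigD1 r) //= => /(canRL (addKr _)); rewrite addr0 => ->.
      by rewrite mulNr divff.
    by apply: sop_div => //; apply: sop_sum.
  by rewrite -[f]mulr1 -sum1 mulr_sumr big1 // => r _; rewrite mulrCA fr0 mulr0.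
have /norP[f0 e0] : ~~ ((f == 0) || (eps == 0)) by rewrite -mulf_eq0.
(* The eta_r have the sign of eps, so [th r] lies between 0 and 1 in every ordering; this bounds 1 /
   eps = \sum a_r th_r. *)
pose th r := eta r / eps.
have Sth r : S (th r).
  have -> : th r = (f * eta r) * (f * eps) / (f * eps) ^+ 2 by rewrite /th; field; rewrite e0.
  by apply: sop_div; [|apply: sopM|exact: sopX].
have th1 r : S (1 - th r).
  have -> : 1 - th r = \sum_(i | i != r) th i.
    have <- : \sum_i th i = 1 by rewrite -mulr_suml divff.
    by rewrite (bigD1 r) //= [X in X - _]addrC addrK.
  exact: sop_sum.
have bV : bounded eps^-1.
  have -> : eps^-1 = \sum_r a r * th r.
    by rewrite -[LHS]mul1r -sum1 mulr_suml; apply: eq_bigr => r _; rewrite mulrA.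
  apply: bounded_sum => r; have [c Sc] := ba r; exists c.
  have -> : iota c - (a r * th r) ^+ 2 = (iota c - a r ^+ 2) + a r ^+ 2 * ((1 - th r) * (1 + th r)) by ring.
  apply: sopD => //; apply: sopM; first exact: sopX.
  by apply: sopM => //; apply: sopD => //; exact: sop1.
have [c1 Sc1] := bV; have [c2 Sc2] := bounded_sum beta.
pose q1 := `|c1| + 1; pose q2 := `|c2| + 1.
have q10 : 0 < q1 by rewrite ltr_wpDl.
have q20 : 0 < q2 by rewrite ltr_wpDl.
have Sq x c : S (iota c - x) -> S (iota (`|c| + 1) - x).
  move=> Sc; have -> : iota (`|c| + 1) - x = (iota c - x) + iota (`|c| + 1 - c) by rewrite !rmorphD rmorphN; ring.
  by apply: sopD => //; apply: sop2_cst; have := ler_norm c; lra.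
have {}Sc1 := Sq _ _ Sc1; have {}Sc2 := Sq _ _ Sc2; rewrite -/q1 -/q2 -/eps in Sc1 Sc2.
have iq1 : iota q1 != 0 by rewrite fmorph_eq0 gt_eqF.
have iq2 : iota q2 != 0 by rewrite fmorph_eq0 gt_eqF.
(* Divided by q2, eps^2 lies between 1 / (q1 q2) and 1, where [sop4_pos] applies. *)
have Tt : T (eps ^+ 2 / iota q2).
  apply: (@sop4_pos _ (q1 * q2)^-1); first by rewrite invr_gt0 mulr_gt0.
    have -> : 1 - eps ^+ 2 / iota q2 = (iota q2 - eps ^+ 2) / iota q2 by field.
    by apply: sop_div => //; apply: sop2_cst; exact: ltW.
  have -> : eps ^+ 2 / iota q2 - iota (q1 * q2)^-1 = (iota q1 - eps^-1 ^+ 2) * eps ^+ 2 / (iota q1 * iota q2).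
    by rewrite fmorphV rmorphM; field; rewrite iq1 iq2 e0.
  apply: sop_div => //; first by apply: sopM => //; exact: sopX.
  by rewrite -rmorphM; apply: sop2_cst; rewrite mulr_ge0 ?ltW.
have -> : f ^+ 2 = (eps ^+ 2 / iota q2) * iota q2 * (f * eps / eps ^+ 2) ^+ 2.
  by field; rewrite e0 iq2.
apply: sopM; first by apply: sopM => //; apply: sop4_cst; exact: ltW.
by apply: sop2_sqr; apply: sop_div => //; exact: sopX.
Qed.
End Bounded.

(** * The ideal of the forms with the sign of f *)

Section PrimeAvoiding.
Variable R : comNzRingType.

Definition ideal_set (A : set R) :=
  [/\ A 0, forall x y, A x -> A y -> A (x + y) & forall a x, A x -> A (a * x)].

(** An ideal maximal among those without powers of [s] is prime: if u and v are outside, some powers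
    of s have the form a + b u and a' + b' v, and if u v were inside, so would be their product. *)
Lemma prime_avoiding (J : set R) (s : R) : ideal_set J -> (forall m, ~ J (s ^+ m)) ->
  exists Q : prime_idealr R, (forall x, J x -> x \in Q) /\ s \notin Q.
Proof.
move=> idJ Js; pose good A := ideal_set A /\ forall m, ~ A (s ^+ m).
have [|F [A0 FA0] Fg Ft|A [[[A00 AD AM] As] JA Amax]] := @Zorn_above R good J; first by [].
  split; first split.
  - by have [[h _ _] _] := Fg _ FA0; exists A0.
  - move=> x y [X FX Xx] [Y FY Yy].
    have [XY|YX] := Ft X Y FX FY; [have [[_ H _] _] := Fg Y FY; exists Y|
      have [[_ H _] _] := Fg X FX; exists X] => //; apply: H => //; [exact: XY|exact: YX].
  - by move=> a x [X FX Xx]; exists X => //; have [[_ _ H] _] := Fg X FX; exact: H.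
  - by move=> m [X FX]; have [_ H] := Fg X FX; exact: H.
have add u : ~ A u -> exists m a b, A a /\ s ^+ m = a + b * u.
  move=> nAu; apply: contrapT => nm; apply: nAu.
  pose B : set R := [set x | exists a b, A a /\ x = a + b * u]%classic.
  have AB : (A `<=` B)%classic by move=> x Ax; exists x, 0; rewrite mul0r addr0.
  have Bg : good B.
    split; first split.
    - exact: AB.
    - move=> _ _ [a [b [Aa ->]]] [a' [b' [Aa' ->]]]; exists (a + a'), (b + b').
      by rewrite mulrDl addrACA; split=> //; exact: AD.
    - move=> c _ [a [b [Aa ->]]]; exists (c * a), (c * b).
      by rewrite mulrDr mulrA; split=> //; exact: AM.
    - by move=> m [a [b [Aa E]]]; apply: nm; exists m, a, b.
  by apply: (Amax _ Bg AB); exists 0, 1; rewrite mul1r add0r.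
pose q : {pred R} := fun x => `[< A x >].
have qI : idealr_closed q.
  split; rewrite /in_mem /=.
  - exact/asboolP.
  - by apply/asboolP; have := As 0%N; rewrite expr0.
  - move=> a u v; rewrite /in_mem /= => /asboolP Au /asboolP Av.
    by apply/asboolP; apply: AD => //; exact: AM.
have qP : prime_idealr_closed q.
  move=> u v; rewrite /in_mem /= => /asboolP Auv.
  apply: contrapT => /negP; rewrite negb_or => /andP[/asboolP nu /asboolP nv].
  have [m [a [b [Aa E]]]] := add u nu; have [m' [a' [b' [Aa' E']]]] := add v nv.
  apply: (As (m + m')%N); rewrite exprD E E'.
  have -> : (a + b * u) * (a' + b' * v) = (a' + b' * v) * a + ((b * u) * a' + (b * b') * (u * v)) by ring.
  by apply: (AD); [exact: AM|apply: (AD); exact: AM].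
pose Q : prime_idealr R := HB.pack q (isIdealr.Build R q qI) (isPrimeIdealrClosed.Build R q qP).
exists Q; split=> [x Jx|]; first by apply/asboolP; exact: JA.
by apply/asboolP; have := As 1%N; rewrite expr1.
Qed.
End PrimeAvoiding.

Section CoordMap.
Variables (k : fieldType) (n : nat) (Q : prime_idealr {mpoly k[n.+1]}).
Fact coord_zmod : zmod_morphism (coord Q). Proof. exact: coordB. Qed.
Fact coord_monoid : monoid_morphism (coord Q). Proof. by split; [exact: coord1|exact: coordM]. Qed.
HB.instance Definition _ := GRing.isZmodMorphism.Build _ _ (coord Q) coord_zmod.
HB.instance Definition _ := GRing.isMonoidMorphism.Build _ _ (coord Q) coord_monoid.
Definition coord_map : {rmorphism {mpoly k[n.+1]} -> coord_ring Q} := coord Q.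
End CoordMap.

Section FormBound.
Variables (R : realType) (N : nat) (K : fieldType) (psi : {rmorphism {mpoly R[N]} -> K}).
Local Notation S := (@sum_of_powers K 2).
Local Notation iota := (psi \o @mpolyC N R).
Local Notation sigma := (psi (norm2 R N)).

Lemma sigmaE : sigma = \sum_l psi 'X_l ^+ 2.
Proof. by rewrite /norm2 rmorph_sum; apply: eq_bigr => l _; rewrite rmorphXn. Qed.

Lemma sop2_sigma : S sigma.
Proof. by rewrite sigmaE; apply: sop_sum => l _; exact: sopX. Qed.

(** x^2 <= c sigma^d in every ordering: the graded form of [bounded], for which degrees add up under
    products. *)
Definition sigma_bounded d x := exists c : R, S (iota c * sigma ^+ d - x ^+ 2).

Lemma sigma_boundedD d x y : sigma_bounded d x -> sigma_bounded d y -> sigma_bounded d (x + y).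
Proof.
move=> [c Sc] [c' Sc']; exists (2 * (c + c')).
have -> : iota (2 * (c + c')) * sigma ^+ d - (x + y) ^+ 2 =
    2 * (iota c * sigma ^+ d - x ^+ 2) + 2 * (iota c' * sigma ^+ d - y ^+ 2) + (x - y) ^+ 2.
  by rewrite rmorphM rmorph_nat rmorphD; ring.
by apply: sopD; [apply: sopD; apply: sopM => //; exact: sop_nat|exact: sopX].
Qed.

Lemma sigma_boundedM d d' x y : sigma_bounded d x -> sigma_bounded d' y ->
  sigma_bounded (d + d') (x * y).
Proof.
move=> [c Sc] [c' Sc']; exists (c * c').
have -> : iota (c * c') * sigma ^+ (d + d') - (x * y) ^+ 2 =
    (iota c * sigma ^+ d - x ^+ 2) * ((iota c' * sigma ^+ d' - y ^+ 2) + y ^+ 2)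
     + x ^+ 2 * (iota c' * sigma ^+ d' - y ^+ 2).
  by rewrite rmorphM exprD; ring.
apply: sopD; apply: sopM => //; last exact: sopX.
by apply: sopD => //; exact: sopX.
Qed.

Lemma sigma_bounded_cst (c : R) : sigma_bounded 0 (iota c).
Proof. by exists (c ^+ 2); rewrite expr0 mulr1 rmorphXn subrr; exact: sop0. Qed.

Lemma sigma_boundedX l m : sigma_bounded m (psi 'X_l ^+ m).
Proof.
elim: m => [|m IH]; first by rewrite expr0 -(rmorph1 iota); exact: sigma_bounded_cst.
rewrite exprS -add1n; apply: sigma_boundedM => //; exists 1.
rewrite rmorph1 mul1r expr1 sigmaE (bigD1 l) //= [X in X - _]addrC addrK.
by apply: sop_sum => k _; exact: sopX.
Qed.

Lemma sigma_bounded_form d F : F \is d.-homog -> sigma_bounded d (psi F).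
Proof.
move=> /dhomogP Fd; rewrite rmorph_mpoly /mmap big_seq.
apply: (big_ind (sigma_bounded d)) => [|x y|m mF].
- exists 0; rewrite rmorph0 mul0r expr0n subr0; exact: sop0.
- exact: sigma_boundedD.
- rewrite -[d]add0n; apply: sigma_boundedM; first exact: sigma_bounded_cst.
  rewrite -(Fd m mF) /= mdegE /mmap1.
  apply: (big_ind2 (fun x d => sigma_bounded d x)) => [|x1 d1 x2 d2|l _].
  + by rewrite -(rmorph1 iota); exact: sigma_bounded_cst.
  + exact: sigma_boundedM.
  + exact: sigma_boundedX.
Qed.

Lemma bounded_form d F : sigma != 0 -> F \is (2 * d).-homog -> bounded iota (psi F / sigma ^+ d).
Proof.
move=> s0 /sigma_bounded_form[c Sc]; exists c.
have sd : sigma ^+ (2 * d) != 0 by rewrite expf_neq0.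
have -> : iota c - (psi F / sigma ^+ d) ^+ 2 = (iota c * sigma ^+ (2 * d) - psi F ^+ 2) / sigma ^+ (2 * d).
  by rewrite mulrBl mulfK // expr_div_n -exprM mulnC.
by apply: sop_div => //; apply: sopXn => //; exact: sop2_sigma.
Qed.
End FormBound.

Section UnitsTimesSquares.
Variables (R : realType) (n : nat) (I : prime_idealr {mpoly R[n.+1]}).
Hypotheses (homI : homog_ideal I) (irrI : not_irrelevant I).
Variables (K : fieldType) (psi : {rmorphism {mpoly R[n.+1]} -> K}).
Hypothesis psi0 : forall d F, F \is d.-homog -> (psi F == 0) = (F \in I).
Hypothesis psiI : forall p, p \in I -> psi p = 0.
Local Notation S := (@sum_of_powers K 2).
Local Notation Sp := (norm2 R n.+1).
Variable f : K.
Hypothesis fD : forall P, scheme_point I P -> unit_times_sos psi f P.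

(* the forms whose sign is that of f *)
Definition sign_form H := exists d, H \is (2 * d).-homog /\ S (f * psi H).

(** The ideal generated by [I] and the [sign_form]s, with explicit coefficients because their
    homogeneous components are needed later. *)
Definition sign_ideal : set {mpoly R[n.+1]} := [set p | exists i, i \in I /\
  exists s : seq ({mpoly R[n.+1]} * {mpoly R[n.+1]}), (forall x, x \in s -> sign_form x.2) /\
  p = i + \sum_(x <- s) x.1 * x.2]%classic.

Lemma sign_ideal_ideal : ideal_set sign_ideal.
Proof.
split.
- by exists 0; split; [exact: idealr0|exists [::]; rewrite big_nil addr0].
- move=> _ _ [i [iI [s [sS ->]]]] [i' [i'I [s' [s'S ->]]]]; exists (i + i'); split; first exact: rpredD.
  exists (s ++ s'); split; last by rewrite big_cat addrACA.
  by move=> x; rewrite mem_cat => /orP[/sS|/s'S].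
- move=> a _ [i [iI [s [sS ->]]]]; exists (a * i); split; first exact: idealMr.
  exists [seq (a * x.1, x.2) | x <- s]; split; first by move=> _ /mapP[x /sS xS ->].
  rewrite mulrDr big_map mulr_sumr; congr (_ + _).
  by apply: eq_bigr => x _; rewrite mulrA.
Qed.

(** Otherwise some prime Q contains the ideal but not [Sp]. Its largest homogeneous part P is a
    point of X, since Q does not contain all the variables. If f = (F / G) g at P, then f F G = F^2
    g, so F G is a [sign_form] and lies in P, which contains neither F nor G. *)
Lemma norm2_sign_ideal : exists m, sign_ideal (Sp ^+ m).
Proof.
apply: contrapT => nm; have [m Jm|Q [JQ SQ]] := prime_avoiding (s := Sp) sign_ideal_ideal.
  by apply: nm; exists m.
have phi0 F : (coord_map Q F == 0) = (F \in Q) by exact: coord_eq0.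
have IQ p : p \in I -> p \in Q.
  by move=> pI; apply: JQ; exists p; split=> //; exists [::]; rewrite big_nil addr0.
pose P := homog_prime (coord_map Q).
have PI : scheme_point I P.
  split; first exact: homog_prime_homog.
    apply: contrapT => nX; move/negP: SQ; apply; rewrite /norm2; apply: rpred_sum => l _.
    rewrite expr2; apply: idealMr; rewrite -phi0 -(homog_primeE _ (homog_var R l)).
    by apply: contrapT => /negP XP; apply: nX; exists l.
  move=> p pI; have -> : (p \in P) = (graded_map (coord_map Q) p == 0) by [].
  apply/eqP; apply/(@polyP (coord_ring Q)) => d; rewrite graded_map_coef coef0.
  by apply/eqP; rewrite phi0; apply: IQ; exact: homI.
have [d [F [G [g [[Fd Gd] FP GP [g0 Sg] fE]]]]] := fD PI.
have [_ _ IP] := PI.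
have G0 : psi G != 0 by rewrite (psi0 Gd); apply: contraNN GP; exact: IP.
have FGd : F * G \is (2 * d).-homog by rewrite mul2n -addnn; exact: dhomogM.
have : F * G \in P.
  rewrite (homog_primeE _ FGd) phi0; apply: JQ; exists 0; split; first exact: idealr0.
  exists [:: (1, F * G)]; split; last by rewrite big_seq1 mul1r add0r.
  move=> x; rewrite inE => /eqP ->; exists d; split=> //=.
  have -> : f * psi (F * G) = psi F ^+ 2 * g by rewrite fE rmorphM /=; field.
  by apply: sopM => //; exact: sopX.
by rewrite prime_idealrM (negbTE FP) (negbTE GP).
Qed.

Lemma unit_times_sos_sop4 : sum_of_powers 4 (f ^+ 2).
Proof.
pose iota : {rmorphism R -> K} := psi \o @mpolyC n.+1 R.
have [SN|nr] := pselect (S (-1)); first exact: (sop4_nonreal iota SN).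
pose sigma := psi Sp.
(* If sigma vanished, division by the nonzero X_j^2 would make -1 a sum of squares. *)
have s0 : sigma != 0.
  apply: contra_notN nr => /eqP; rewrite /sigma sigmaE; have [j jI] := irrI.
  have xj : psi 'X_j ^+ 2 != 0 by rewrite expf_neq0 // (psi0 (homog_var R j)).
  rewrite (bigD1 j) //= => /(canRL (addKr _)); rewrite addr0 => E.
  have -> : -1 = (\sum_(i | i != j) psi 'X_i ^+ 2) / psi 'X_j ^+ 2 by rewrite E mulNr divff.
  by apply: sop_div => //; [apply: sop_sum => l _|]; exact: sopX.
have Ss : S sigma := sop2_sigma psi.
have [m [i [iI [s [sS sE]]]]] := norm2_sign_ideal.
have /choice[dg dgP] (x : {mpoly R[n.+1]} * {mpoly R[n.+1]}) : exists d, x \in s ->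
    x.2 \is (2 * d).-homog /\ S (f * psi x.2).
  have [xs|xs] := boolP (x \in s); last by exists 0%N.
  by have [d dP] := sS x xs; exists d.
(* The component of the coefficient that complements [x.2] to degree 2 m. A form of degree above 2 m
   contributes 0, which also covers the truncated subtraction. *)
pose B x : {mpoly R[n.+1]} := if (dg x <= m)%N then hcomp (2 * (m - dg x)) x.1 else 0.
have Bhom x : B x \is (2 * (m - dg x)).-homog.
  by rewrite /B; case: ifP => _; [exact: pihomogP|exact: rpred0].
have Spm : Sp ^+ m \is (2 * m).-homog by apply: dhomogMn; exact: homog_norm2.
have E1 : Sp ^+ m = hcomp (2 * m) i + \sum_(x <- s) B x * x.2.
  rewrite -(pihomog_dE Spm) sE raddfD raddf_sum /=; congr (_ + _).
  rewrite big_seq [RHS]big_seq; apply: eq_bigr => x xs; have [xd _] := dgP x xs.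
  rewrite /B; case: leqP => dm; last by rewrite (hcomp_lt _ xd) ?mul0r // ltn_pmul2l.
  by rewrite -(hcompM _ _ xd) -mulnDr subnK.
have sum1 : \sum_(x <- s) (psi (B x) / sigma ^+ (m - dg x)) * (psi x.2 / sigma ^+ dg x) = 1.
  have -> : 1 = psi (Sp ^+ m) / sigma ^+ m by rewrite rmorphXn divff // expf_neq0.
  have Ei : psi (hcomp (2 * m) i) = 0 by apply: psiI; exact: homI.
  rewrite E1 rmorphD Ei add0r rmorph_sum mulr_suml; apply: eq_bigr => x _.
  rewrite rmorphM mulrACA -invfM -exprD /B; case: leqP => dm; first by rewrite subnK.
  by rewrite rmorph0 !mul0r.
pose x0 : {mpoly R[n.+1]} * {mpoly R[n.+1]} := (0, 0).
pose x (r : 'I_(size s)) := nth x0 s r.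
have xs r : x r \in s by exact: mem_nth.
apply: (@sop4_of_bounded R K iota f (size s) (fun r => psi (x r).2 / sigma ^+ dg (x r))
  (fun r => psi (B (x r)) / sigma ^+ (m - dg (x r)))) => [r||r|r].
- have [_ Sr] := dgP _ (xs r); rewrite mulrA; apply: sop_div => //; exact: sopXn.
- by rewrite -sum1 (big_nth x0) big_mkord.
- exact: bounded_form.
- by apply: bounded_form => //; case: (dgP _ (xs r)).
Qed.
End UnitsTimesSquares.

Lemma quotient_mul1 (K : fieldType) (a b a' b' : K) : b != 0 -> b' != 0 ->
  a / b * (a' / b') = 1 -> a * a' = b * b'.
Proof.
move=> b0 b0' E; rewrite -[RHS]mul1r -E mulf_div divfK //.
by rewrite mulf_neq0.
Qed.

Lemma quotient_inv (K : fieldType) (a b : K) : a != 0 -> b != 0 -> a / b * (b / a) = 1.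
Proof. by move=> a0 b0; rewrite mulrA divfK // divff. Qed.

Lemma idealr_subl (S : nzRingType) (J : idealr S) x y : x - y \in J -> x \in J -> y \in J.
Proof. by move=> xy xJ; rewrite -[y](subKr x) rpredB. Qed.

(** * The condition of D(X) in terms of forms *)

Section Link.
Variables (R : realType) (n : nat) (I : prime_idealr {mpoly R[n.+1]}).
Hypothesis homI : homog_ideal I.
Variable j : 'I_n.+1.
Hypothesis jI : 'X_j \notin I.

(** A unit of the local ring is F / G with both forms outside P: if its inverse is F' / G', then F
    F' - G G' lies in [I], hence in P, while G G' does not. *)
Lemma in_D_unit_times_sos (f : function_field I) :
  in_D f <-> f != 0 /\ forall P, scheme_point I P -> unit_times_sos (psi jI) f P.
Proof.
split=> -[f0 fD]; split=> // P PI; have [homP _ IP] := PI.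
  have [u [g [[y [Pu Py uy]] g0 Sg fE]]] := fD P PI.
  have [d [F [G [Fd Gd GP uE]]]] := (local_ringP jI u IP).1 Pu.
  have [d' [F' [G' [Fd' Gd' GP' yE]]]] := (local_ringP jI y IP).1 Py.
  exists d, F, G, g; split=> //; last by rewrite -uE.
  apply/negP => FP.
  have G0 : psi jI G != 0 by rewrite (psi_eq0 jI Gd); apply: contraNN GP; exact: IP.
  have G0' : psi jI G' != 0 by rewrite (psi_eq0 jI Gd'); apply: contraNN GP'; exact: IP.
  rewrite uE yE in uy; have E := quotient_mul1 G0 G0' uy.
  have : G * G' \in P.
    have hd : F * F' - G * G' \is (d + d').-homog by apply: rpredB; exact: dhomogM.
    have : F * F' - G * G' \in P.
      by apply: IP; rewrite -(psi_eq0 jI hd) rmorphB !rmorphM E subrr.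
    by move/idealr_subl; apply; rewrite mulrC; exact: idealMr.
  by rewrite prime_idealrM (negbTE GP) (negbTE GP').
have [d [F [G [g [[Fd Gd] FP GP [g0 Sg] fE]]]]] := fD P PI.
have F0 : psi jI F != 0 by rewrite (psi_eq0 jI Fd); apply: contraNN FP; exact: IP.
have G0 : psi jI G != 0 by rewrite (psi_eq0 jI Gd); apply: contraNN GP; exact: IP.
have Pu : local_ring P (psi jI F / psi jI G) by apply/(local_ringP jI _ IP); exists d, F, G.
have Py : local_ring P (psi jI G / psi jI F) by apply/(local_ringP jI _ IP); exists d, G, F.
exists (psi jI F / psi jI G), g; apply: (And4 _ g0 Sg fE).
by exists (psi jI G / psi jI F); exact: (And3 Pu Py (quotient_inv F0 G0)).
Qed.
End Link.

Theorem mainTheorem1 (R : realType) (n : nat)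
    (I : prime_idealr {mpoly R[n.+1]})
    (X_variety : proj_variety I)
    (X_smooth : smooth_variety I)
    (X_abs_irr : absolutely_irreducible I)
    (X_real_point : has_real_point I)
    (f : function_field I) (f_neq0 : f != 0) :
  (in_D f <-> nonzero_square (f ^+ 2) /\ sum_of_powers 4 (f ^+ 2)) /\
  (in_D f <-> sum_of_powers 4 (f ^+ 2)).
Proof.
have [homI irrI] := X_variety; have [j jI] := irrI.
have psi0 d F : F \is d.-homog for mdeg -> (psi jI F == 0) = (F \in I) by exact: psi_eq0.
have psiI p : p \in I -> psi jI p = 0 by exact: psi_ideal.
have psiK x : exists d F G, [/\ F \is d.-homog for mdeg, G \is d.-homog for mdeg, G \notin I & x = psi jI F / psi jI G].
  exact: psi_repr.
have H : in_D f <-> sum_of_powers 4 (f ^+ 2).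
  split=> [/(in_D_unit_times_sos jI)[_ fD]|f4].
    exact: (unit_times_sos_sop4 homI irrI psi0 psiI fD).
  apply/(in_D_unit_times_sos jI); split=> // P PI.
  exact: (sop4_unit_times_sos homI X_smooth psi0 psiI psiK f_neq0 f4 PI).
split=> //; split=> [/H f4|[_ /H //]]; split=> //.
by exists f.
Qed.
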